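(* Let $k\le \ell\le m$ be positive integers with $\frac1k+\frac1\ell+\frac1m<1$. (A) Suppose that a pull-back transformation of degree $d\ge 2$ converts a hypergeometric differential equation whose local exponent differences at its three singular points are, in some order, $\frac1k,\frac1\ell,\frac1m$ into a hypergeometric differential equation with local exponent differences $e'_1,e'_2,e'_3\ge 0$ (in some order). Then the triple consisting of the unordered starting exponent differences, the unordered transformed exponent differences and the degree $d$ is one of the following (in the first item $\lambda,\mu$ are positive integers such that $\{2,\lambda,\mu\}=\{k,\ell,m\}$ as multisets, with no order imposed between $\lambda$ and $\mu$). Classical transformations: 1. $(\frac12,\frac1\lambda,\frac1\mu)\to(\frac1\lambda,\frac1\lambda,\frac2\mu)$, $d=2$; 2. $(\frac12,\frac13,\frac1m)\to(\frac12,\frac1m,\frac2m)$, $d=3$; 3. $(\frac12,\frac13,\frac1m)\to(\frac13,\frac1m,\frac3m)$, $d=4$; 4. $(\frac12,\frac13,\frac1m)\to(\frac1m,\frac1m,\frac4m)$, $d=6$; 5. $(\frac12,\frac13,\frac1m)\to(\frac2m,\frac2m,\frac2m)$, $d=6$; 6. $(\frac12,\frac14,\frac1m)\to(\frac1m,\frac1m,\frac2m)$, $d=4$; 7. $(\frac13,\frac13,\frac1m)\to(\frac1m,\frac1m,\frac1m)$, $d=3$. Non-classical transformations: 8. $(\frac12,\frac13,\frac17)\to(\frac13,\frac13,\frac17)$, $d=8$; 9. $(\frac12,\frac13,\frac17)\to(\frac12,\frac17,\frac17)$, $d=9$; 10. $(\frac12,\frac13,\frac17)\to(\frac13,\frac17,\frac27)$,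 $d=10$; 11. $(\frac12,\frac13,\frac17)\to(\frac17,\frac17,\frac27)$, $d=18$; 12. $(\frac12,\frac13,\frac17)\to(\frac17,\frac17,\frac17)$, $d=24$; 13. $(\frac12,\frac13,\frac18)\to(\frac13,\frac18,\frac18)$, $d=10$; 14. $(\frac12,\frac13,\frac18)\to(\frac14,\frac18,\frac18)$, $d=12$; 15. $(\frac12,\frac13,\frac19)\to(\frac19,\frac19,\frac19)$, $d=12$; 16. $(\frac12,\frac14,\frac15)\to(\frac14,\frac14,\frac15)$, $d=6$. (B) Conversely, each entry of this list (for all values of $m$, respectively $\lambda,\mu$, such that the starting exponent differences have sum less than $1$) is realized by some pull-back transformation of the indicated degree between hypergeometric differential equations with the indicated local exponent differences.
   Context: The hypergeometric differential equation with parameters $A,B,C\in\mathbb{C}$ is $z(1-z)y''(z)+(C-(A+B+1)z)y'(z)-AB\,y(z)=0$. It is a Fuchsian equation on $\mathbb{P}^1=\mathbb{P}^1(\mathbb{C})$ with singular points $z=0,1,\infty$; its local exponent differences at these points are, up to sign, $1-C$, $C-A-B$, $A-B$. Local exponent differences are considered up to sign (taken nonnegative when real). A pull-back transformation of the equation is a transformation $z\mapsto\varphi(x)$, $y(z)\mapsto Y(x)=\theta(x)\,y(\varphi(x))$, where $\varphi(x)$ is a non-constant rational function and $\theta(x)$ is a product of (complex) powers of rational functions; the transformed equation is the second-order linear differential equation satisfied by the functions $Y(x)$, with $y$ running over solutions of the original equation. The degree of the pull-back transformation is the degree $d$ of the covering $\varphi:\mathbb{P}^1_x\to\mathbb{P}^1_z$.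 *)

(* Defs.v *)
From HB Require Import structures.
From mathcomp Require Import all_boot all_order all_algebra.
From mathcomp Require Import all_classical all_reals all_analysis.
From mathcomp Require Import complex.

Set Implicit Arguments.
Unset Strict Implicit.
Unset Printing Implicit Defensive.

Import Order.TTheory GRing.Theory Num.Theory.
Import numFieldNormedType.Exports.

Local Open Scope ring_scope.
Local Open Scope classical_set_scope.
Local Open Scope complex_scope.

(* The topology and the normed module structure on the complex numbers live on
   the regular module [R[i]^o]; derivability in the direction 1 there is
   derivability with respect to a complex variable. *)
Notation Cplx R := ((R[i])^o) (only parsing).

Section ComplexFunctions.
Variable R : realType.
Implicit Types (V : set (Cplx R)) (f : Cplx R -> Cplx R).

Definition cexp (z : Cplx R) : Cplx R :=
  let: a +i* b := z in (expR a * cos b) +i* (expR a * sin b).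

Definition holomorphic_on V f := forall z, V z -> derivable f z 1.

End ComplexFunctions.

Section RationalFunctions.
Variable R : realType.

Record ratfun := RatFun {
  rnum : {poly R[i]};
  rden : {poly R[i]};
  rden_neq0 : rden != 0;
  rcoprime : coprimep rnum rden }.

Implicit Types f : ratfun.

(* Only meaningful where [rden f] does not vanish. *)
Definition reval f (x : Cplx R) : Cplx R := (rnum f).[x] / (rden f).[x].

(* Degree of the covering of the projective line by itself defined by [f];
   it is 0 exactly when [f] is constant. *)
Definition rdegree f : nat := maxn (size (rnum f)).-1 (size (rden f)).-1.

(* [th] is, on [V], a branch of the product of the complex powers
   [r i ^ a i]: each power is [cexp (a i * L i)] for a holomorphic branch [L i]
   of the logarithm of [r i]. *)
Definition power_product_branch n (r : 'I_n -> ratfun) (a : 'I_n -> R[i])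
    (V : set (Cplx R)) (th : Cplx R -> Cplx R) : Prop :=
  exists L : 'I_n -> Cplx R -> Cplx R,
    [/\ forall i, holomorphic_on V (L i),
        forall i x, V x ->
          (rden (r i)).[x] != 0 /\ cexp (L i x) = reval (r i) x
      & forall x, V x -> th x = \prod_(i < n) cexp (a i * L i x)].

End RationalFunctions.

Section Hypergeometric.
Variable R : realType.

Record hgeq := HGEq { hgA : R[i]; hgB : R[i]; hgC : R[i] }.

Implicit Types E : hgeq.

(* Local solutions are considered away from the singular points. *)
Definition hg_solution E (U : set (Cplx R)) (y : Cplx R -> Cplx R) : Prop :=
  [/\ open U,
      forall z, U z -> z != 0 /\ z != 1,
      holomorphic_on U y,
      holomorphic_on U (fun z => 'D_1 y z)
    & forall z, U z ->
        z * (1 - z) * 'D_1 (fun w => 'D_1 y w) z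
        + (hgC E - (hgA E + hgB E + 1) * z) * 'D_1 y z
        - hgA E * hgB E * y z = 0].

(* The differences at 0, 1 and infinity, each defined up to sign. *)
Definition exponent_differences E : seq R[i] :=
  [:: 1 - hgC E; hgC E - hgA E - hgB E; hgA E - hgB E].

(* The real numbers [e] are, in some order and up to sign, the local exponent
   differences. *)
Definition has_exponent_differences E (e : seq R) : Prop :=
  exists2 e' : seq R, perm_eq e' e &
    all2 (fun (x : R) (c : R[i]) => (c == x%:C) || (c == - x%:C))
      e' (exponent_differences E).

(* [E2] is the equation satisfied by the functions [th(x) * y(phi(x))], where
   [y] runs over the local solutions of [E1] and [th] over the local branches
   of a product of complex powers of rational functions. The factors [r i] must
   not be identically zero: otherwise there would be no branch at all. *)
Definition pullback (phi : ratfun R) E1 E2 : Prop :=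
  (0 < rdegree phi)%N /\
  exists n (r : 'I_n -> ratfun R) (a : 'I_n -> R[i]),
    (forall i, rnum (r i) != 0) /\
    forall (U V : set (Cplx R)) (y th : Cplx R -> Cplx R),
      hg_solution E1 U y ->
      open V ->
      (forall x, V x -> x != 0 /\ x != 1) ->
      (forall x, V x -> (rden phi).[x] != 0 /\ U (reval phi x)) ->
      power_product_branch r a V th ->
      hg_solution E2 V (fun x => th x * y (reval phi x)).

End Hypergeometric.

Section Table.
Variable R : realType.

(* [hg_table s t d]: the starting exponent differences are the inverses of the
   integers in [s], the transformed ones are [t], and the degree is [d]. *)
Inductive hg_table : seq nat -> seq R -> nat -> Prop :=
| classical_2_l_m l m : (0 < l)%N -> (0 < m)%N ->
    hg_table [:: 2; l; m] [:: 1 / l%:R; 1 / l%:R; 2 / m%:R] 2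
| classical_2_3_m_deg3 m : (0 < m)%N ->
    hg_table [:: 2; 3; m] [:: 1 / 2; 1 / m%:R; 2 / m%:R] 3
| classical_2_3_m_deg4 m : (0 < m)%N ->
    hg_table [:: 2; 3; m] [:: 1 / 3; 1 / m%:R; 3 / m%:R] 4
| classical_2_3_m_deg6_114 m : (0 < m)%N ->
    hg_table [:: 2; 3; m] [:: 1 / m%:R; 1 / m%:R; 4 / m%:R] 6
| classical_2_3_m_deg6_222 m : (0 < m)%N ->
    hg_table [:: 2; 3; m] [:: 2 / m%:R; 2 / m%:R; 2 / m%:R] 6
| classical_2_4_m m : (0 < m)%N ->
    hg_table [:: 2; 4; m] [:: 1 / m%:R; 1 / m%:R; 2 / m%:R] 4
| classical_3_3_m m : (0 < m)%N ->
    hg_table [:: 3; 3; m] [:: 1 / m%:R; 1 / m%:R; 1 / m%:R] 3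
| nonclassical_2_3_7_deg8 :
    hg_table [:: 2; 3; 7] [:: 1 / 3; 1 / 3; 1 / 7] 8
| nonclassical_2_3_7_deg9 :
    hg_table [:: 2; 3; 7] [:: 1 / 2; 1 / 7; 1 / 7] 9
| nonclassical_2_3_7_deg10 :
    hg_table [:: 2; 3; 7] [:: 1 / 3; 1 / 7; 2 / 7] 10
| nonclassical_2_3_7_deg18 :
    hg_table [:: 2; 3; 7] [:: 1 / 7; 1 / 7; 2 / 7] 18
| nonclassical_2_3_7_deg24 :
    hg_table [:: 2; 3; 7] [:: 1 / 7; 1 / 7; 1 / 7] 24
| nonclassical_2_3_8_deg10 :
    hg_table [:: 2; 3; 8] [:: 1 / 3; 1 / 8; 1 / 8] 10
| nonclassical_2_3_8_deg12 :
    hg_table [:: 2; 3; 8] [:: 1 / 4; 1 / 8; 1 / 8] 12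
| nonclassical_2_3_9 :
    hg_table [:: 2; 3; 9] [:: 1 / 9; 1 / 9; 1 / 9] 12
| nonclassical_2_4_5 :
    hg_table [:: 2; 4; 5] [:: 1 / 4; 1 / 4; 1 / 5] 6.

Definition inverses (s : seq nat) : seq R := [seq 1 / n%:R | n <- s].

(* Some pull-back transformation of degree [d] converts a hypergeometric
   equation with exponent differences [s] into one with differences [t]. *)
Definition hg_transformation (s t : seq R) (d : nat) : Prop :=
  exists (phi : ratfun R) (E1 E2 : hgeq R),
    [/\ rdegree phi = d, pullback phi E1 E2,
        has_exponent_differences E1 s & has_exponent_differences E2 t].

End Table.

(* Main.v *)
(** Comparing coefficients in the transformed equation turns "phi pulls E1 back
    to E2" into a polynomial identity between the numerator F and the denominator
    G of phi ([pull_identity]); this equivalence needs local solutions of E1 and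
    local branches of complex powers only at generic points.

    Classification. Reading the identity at a point of the line shows that a
    point of ramification index e above 0, 1 or infinity is either ordinary (e is
    the order k of that fibre) or one of the three singular points of E2, with
    exponent difference e/k, and that phi is unramified elsewhere. The degree of
    the Wronskian F' G - F G' (Riemann-Hurwitz) then says that the number of
    ordinary points is d - 1, which bounds d by 42 and leaves finitely many
    branching patterns. Those which are not in the table are excluded
    algebraically: two by factoring a difference of squares, the others by writing
    the covering as A^2 + l B^3 + X^n q^e = 0, with an ordinary or special point
    moved to 0; the operator which kills X^n q^e gives a recursion for the
    coefficients of A and B, and solving it from both ends leaves incompatible
    equations for q, or a common root of A, B and q.

    Construction. Pull-backs compose, so the list reduces to the coordinate
    changes 1 - x and 1/x and to nine explicit coverings of degree 2, 3, 3, 4, 6,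
    8, 9, 10, 10. When F, G and F - G are powers of polynomials up to factors
    x^i (x - 1)^j, the identity reduces to one of small degree. *)
Require Import Defs.
From HB Require Import structures.
From mathcomp Require Import all_boot all_order all_algebra.
From mathcomp Require Import all_classical all_reals all_analysis.
From mathcomp Require Import complex polyorder ring lra zify.

Set Implicit Arguments.
Unset Strict Implicit.
Unset Printing Implicit Defensive.

Import Order.TTheory GRing.Theory Num.Theory.
Import numFieldNormedType.Exports ComplexField.Normc.

Local Open Scope classical_set_scope.
Local Open Scope ring_scope.

(** * Complex derivatives, power series and local solutions *)

(** Multiplying solutions by theta changes an equation Y'' + N Y' + Q Y = 0 but not its invariant 2
    N' + N^2 - 4 Q. Comparing coefficients of y' forces the logarithmic derivative of theta, and
    what remains is an equality of invariants; conversely the forced logarithmic derivative has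
    simple poles only, so theta is a product of powers. A pull-back is tested at regular points
    only, but an identity of polynomials extends to the singular ones. At a point the double pole of
    the invariant has coefficient S - 1, with S the square of the exponent difference. Signs are
    therefore lost, squares are carried along, and nonnegativity recovers the differences at the
    very end. The count is squeezed from two sides: Riemann-Hurwitz gives at least d - 1 ordinary
    points, 1/k + 1/l + 1/m < 1 gives fewer than d. Equality forces the three singular points of the
    transformed equation into the three fibres. The number 42 is the inverse of the least positive
    value of 1 - 1/k - 1/l - 1/m, attained at (2, 3, 7). *)

Section ComplexDerivative.
Variable K : numFieldType.
Local Notation T := (K^o).
Implicit Types (f g : T -> T) (z l : T).

Definition cder f z l : Prop := is_derive z (1 : T) f l.

Lemma cder_eq f z l l' : cder f z l -> l = l' -> cder f z l'.
Proof. by move=> h <-. Qed.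

Lemma cder_derive f z l : cder f z l -> 'D_1 f z = l.
Proof. by move=> h; exact: derive_val. Qed.

Lemma cder_derivable f z l : cder f z l -> derivable f z 1.
Proof. by case. Qed.

Lemma derivable_cder f z : derivable f z 1 -> cder f z ('D_1 f z).
Proof. exact: derivableP. Qed.

Lemma cder_near f g z l : {near z, f =1 g} -> cder f z l -> cder g z l.
Proof.
exact: near_eq_is_derive.
Qed.

Lemma cder_ext f g z l : f =1 g -> cder f z l -> cder g z l.
Proof. by move=> /funext ->. Qed.

Lemma cder_continuous f z l : cder f z l -> {for z, continuous f}.
Proof.
by move=> /cder_derivable/derivable1_diffP; exact: differentiable_continuous.
Qed.

Lemma cder_cst (a : T) z : cder (fun=> a) z 0.
Proof. exact: is_derive_cst. Qed.

Lemma cder_id z : cder (fun x => x) z 1.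
Proof. exact: is_derive_id. Qed.

Lemma cderD f g z l m : cder f z l -> cder g z m ->
  cder (fun x => f x + g x) z (l + m).
Proof. by move=> fl gm; exact: (is_deriveD fl gm). Qed.

Lemma cderM f g z l m : cder f z l -> cder g z m ->
  cder (fun x => f x * g x) z (l * g z + f z * m).
Proof.
move=> fl gm; apply: cder_eq; first exact: (is_deriveM fl gm).
by rewrite /GRing.scale/= addrC (mulrC l).
Qed.

Lemma cderV f z l : f z != 0 -> cder f z l ->
  cder (fun x => (f x)^-1) z (- l / f z ^+ 2).
Proof.
move=> fz fl; apply: DeriveDef.
  by apply: derivableV fz _; exact: cder_derivable fl.
rewrite deriveV//; last exact: cder_derivable fl.
by rewrite (cder_derive fl) /GRing.scale/= mulNr mulrC mulNr.
Qed.

Lemma cder_comp f g z l m : cder f z l -> cder g (f z) m ->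
  cder (fun x => g (f x)) z (m * l).
Proof.
move=> fl gm.
have df := (derivable1_diffP f z).1 (cder_derivable fl).
have dg := (derivable1_diffP g (f z)).1 (cder_derivable gm).
have dgf : differentiable (g \o f) z by exact: differentiable_comp.
apply: DeriveDef; first exact/derivable1_diffP.
have dfl : 'd f z (1 : T) = l by rewrite -(deriveE (1 : T) df); exact: cder_derive fl.
rewrite deriveE// diff_comp//; apply: etrans (congr1 ('d g (f z) : T -> T) dfl) _.
have -> : 'd g (f z) l = l *: 'd g (f z) 1.
  by rewrite -linearZ /GRing.scale/= mulr1.
by rewrite -(deriveE _ dg) (cder_derive gm) /GRing.scale/= mulrC.
Qed.

Lemma cder_poly (p : {poly K}) z : cder (horner p) z p^`().[z].
Proof.
elim/poly_ind: p => [|p c IH].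
  rewrite deriv0 horner0; apply: cder_ext (cder_cst 0 z).
  by move=> x; rewrite horner0.
have : cder (fun x => p.[x] * x + c) z ((p^`().[z] * z + p.[z] * 1) + 0).
  by apply: cderD (cder_cst _ _); apply: cderM => //; exact: cder_id.
rewrite derivD derivC addr0 derivM derivX !hornerE => h.
by apply: cder_ext (cder_eq h _) => [x|]; rewrite ?hornerE ?addr0.
Qed.

(** Power series, the exponential and the logarithm are all differentiated through an explicit
    quadratic bound of the remainder; this turns such a bound into a derivative. *)
Lemma cder_quad_norm f z l (M d : K) : 0 < d ->
  (forall h : K, `|h| < d -> `|f (z + h) - f z - l * h| <= M * `|h| ^+ 2) ->
  cder f z l.
Proof.
move=> d0 H.
suff cv : h^-1 *: (f (h *: (1 : T) + z) - f z) @[h --> 0^'] --> l.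
  by apply: DeriveDef; [apply/cvg_ex; exists l|exact: cvg_lim cv].
apply/cvgrPdist_lt => e e0; have M1 : 0 < `|M| + 1 by rewrite ltr_wpDl.
near=> h.
have h0 : h != 0 by near: h; exact: nbhs_dnbhs_neq.
have hd : `|h| < d by near: h; apply: dnbhs0_lt.
have he : `|h| < e / (`|M| + 1).
  by near: h; apply: dnbhs0_lt; rewrite divr_gt0.
have h0' : 0 < `|h| by rewrite normr_gt0.
rewrite /GRing.scale/= mulr1 -(@ltr_pM2r _ `|h|)// -normrM -normrN.
have -> : - ((l - h^-1 * (f (h + z) - f z)) * h) = f (z + h) - f z - l * h.
  by rewrite (addrC z); field.
apply: le_lt_trans (H _ hd) _; rewrite expr2 mulrA ltr_pM2r//.
apply: le_lt_trans (_ : (`|M| + 1) * `|h| < _); last first.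
  by rewrite mulrC -ltr_pdivlMr.
rewrite ler_pM2r//.
(* The order of [K] is partial. The bound makes [M] times a positive number nonnegative, so [M] is
   real and comparable with its norm. *)
have Mr : M \is Num.real.
  have := H h hd; move/(le_trans (normr_ge0 _)); rewrite pmulr_lge0 ?exprn_gt0//.
  exact: ger0_real.
by apply: le_trans (real_ler_norm Mr) _; rewrite lerDl.
Unshelve. all: by end_near. Qed.

End ComplexDerivative.

Section ComplexNorm.
Variable R : realType.
Local Notation C := (R[i]).
Local Notation T := (C^o).
Implicit Types (z w : C).
Local Notation cn := (@normc R).

Lemma normcC z : `|z| = (cn z)%:C%C.
Proof. by []. Qed.

Lemma cn_ge0 z : 0 <= cn z.
Proof. by rewrite -lecR -normcC; exact: normr_ge0. Qed.

Lemma cn_eq0 z : (cn z == 0) = (z == 0).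
Proof. by rewrite -(inj_eq (@complexI R)) -normcC normr_eq0. Qed.

Lemma cn_gt0 z : (0 < cn z) = (z != 0).
Proof. by rewrite lt_neqAle cn_ge0 andbT eq_sym cn_eq0. Qed.

Lemma cnX z n : cn (z ^+ n) = cn z ^+ n.
Proof.
by elim: n => [|n IH]; rewrite ?expr0 ?exprS ?normcM ?IH// normc1.
Qed.

Lemma cn_real (x : R) : cn x%:C%C = `|x|.
Proof. by rewrite /normc/= expr0n/= addr0 sqrtr_sqr. Qed.

Lemma cn_nat n : cn n%:R = n%:R.
Proof.
by apply: (@complexI R); rewrite -normcC normr_nat rmorph_nat.
Qed.

Lemma le_cnB z w : cn (z - w) <= cn z + cn w.
Proof. by rewrite -(normcN w); exact: le_normcD. Qed.

Lemma cn_le_ReIm (x y : R) : cn (x +i* y)%C <= `|x| + `|y|.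
Proof.
rewrite /normc -[leRHS]ger0_norm ?addr_ge0// -sqrtr_sqr ler_sqrt ?sqr_ge0//.
rewrite sqrrD !real_normK ?num_real// lerD2r lerDl mulrn_wge0// mulr_ge0//.
Qed.

Lemma Re_le_cn z : `|complex.Re z| <= cn z.
Proof. by rewrite -lecR; exact: normc_ge_Re. Qed.

Lemma Im_le_cn z : `|complex.Im z| <= cn z.
Proof.
have := Re_le_cn (z * 'i%C); rewrite ReiNIm normrN normcM.
suff -> : cn 'i%C = 1 by rewrite mulr1.
by rewrite /normc expr0n/= expr1n add0r sqrtr1.
Qed.

Lemma cder_quad (f : T -> T) (z l : T) (M d : R) : 0 < d ->
  (forall h, cn h < d -> cn (f (z + h) - f z - l * h) <= M * cn h ^+ 2) ->
  cder f z l.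
Proof.
move=> d0 H; apply: (@cder_quad_norm _ f z l M%:C%C d%:C%C).
  by rewrite ltcR.
by move=> h; rewrite !normcC ltcR -rmorphXn -rmorphM lecR; exact: H.
Qed.

End ComplexNorm.

(** * Complex series with a geometric majorant *)

Section ComplexSeries.
Variable R : realType.
Local Notation C := (R[i]).
Local Notation T := (C^o).
Local Notation cn := (@normc R).
Implicit Types (u v : nat -> C).

(** Summing real and imaginary parts separately reduces convergence to real series. The value is
    meaningful under [csummable]. *)
Definition csum u : C :=
  (limn (series (fun n => complex.Re (u n))) +i* limn (series (fun n => complex.Im (u n))))%C.

Definition csummable (M : R) u := forall n, cn (u n) <= M / 2 ^+ n.

Lemma limn_half_series_le (x : nat -> R) (M : R) :
  (forall n, `|x n| <= M / 2 ^+ n) ->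
  cvgn (series x) /\ `|limn (series x)| <= 2 * M.
Proof.
move=> H.
have c : (series (geometric M 2^-1) @ \oo --> M * (1 - 2^-1)^-1)%classic.
  by apply: cvg_geometric_series; rewrite ger0_norm ?invr_ge0 ?invf_lt1// ltr1n.
have cM : cvgn (series (geometric M 2^-1)) by apply/cvg_ex; eexists; exact: c.
have xM n : `|x n| <= geometric M 2^-1 n.
  by rewrite /geometric/= exprVn; exact: H.
have nx : cvgn [normed series x].
  apply: series_le_cvg cM => n /=.
  - exact: normr_ge0.
  - exact: le_trans (normr_ge0 _) (xM n).
  - exact: xM.
split; first exact: normed_cvg.
apply: le_trans (lim_series_norm nx) _.
apply: le_trans (lim_series_le nx cM xM) _.
rewrite (cvg_lim _ c)//; have -> : (1 - 2^-1 : R)^-1 = 2 by field.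
by rewrite mulrC.
Qed.

Lemma csummable_Re M u : csummable M u ->
  forall n, `|complex.Re (u n)| <= M / 2 ^+ n.
Proof. by move=> h n; exact: le_trans (Re_le_cn _) (h n). Qed.

Lemma csummable_Im M u : csummable M u ->
  forall n, `|complex.Im (u n)| <= M / 2 ^+ n.
Proof. by move=> h n; exact: le_trans (Im_le_cn _) (h n). Qed.

Lemma csum_le M u : csummable M u -> cn (csum u) <= 4 * M.
Proof.
move=> h; have [_ hr] := limn_half_series_le (csummable_Re h).
have [_ hi] := limn_half_series_le (csummable_Im h).
apply: le_trans (cn_le_ReIm _ _) _; apply: le_trans (lerD hr hi) _.
lra.
Qed.

Lemma eq_csum u v : u =1 v -> csum u = csum v.
Proof. by move=> /funext ->. Qed.

Lemma csum0 : csum (fun=> 0) = 0.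
Proof.
apply/eqP; rewrite -cn_eq0 eq_le cn_ge0 andbT.
have -> : (0 : R) = 4 * 0 by rewrite mulr0.
by apply: csum_le => n; rewrite mul0r normc0.
Qed.

Lemma complexReD (z w : C) : complex.Re (z + w) = complex.Re z + complex.Re w.
Proof. by case: z; case: w. Qed.

Lemma complexImD (z w : C) : complex.Im (z + w) = complex.Im z + complex.Im w.
Proof. by case: z; case: w. Qed.

Lemma complexReM (a b : R) (z : C) :
  complex.Re ((a +i* b)%C * z) = a * complex.Re z - b * complex.Im z.
Proof. by case: z. Qed.

Lemma complexImM (a b : R) (z : C) :
  complex.Im ((a +i* b)%C * z) = a * complex.Im z + b * complex.Re z.
Proof. by case: z. Qed.

Lemma csumD M N u v : csummable M u -> csummable N v ->
  csum (fun n => u n + v n) = csum u + csum v.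
Proof.
move=> hu hv.
have [ur _] := limn_half_series_le (csummable_Re hu).
have [ui _] := limn_half_series_le (csummable_Im hu).
have [vr _] := limn_half_series_le (csummable_Re hv).
have [vi _] := limn_half_series_le (csummable_Im hv).
rewrite /csum; congr (_ +i* _)%C.
- rewrite -lim_seriesD//; congr (limn (series _)); apply/funext => n.
  exact: complexReD.
- rewrite -lim_seriesD//; congr (limn (series _)); apply/funext => n.
  exact: complexImD.
Qed.

Lemma csumZ M (c : C) u : csummable M u ->
  csum (fun n => c * u n) = c * csum u.
Proof.
move=> hu.
have [ur _] := limn_half_series_le (csummable_Re hu).
have [ui _] := limn_half_series_le (csummable_Im hu).
case: c => a b.
have -> : ((a +i* b) * csum u)%C = ((a * complex.Re (csum u) - b * complex.Im (csum u))
  +i* (a * complex.Im (csum u) + b * complex.Re (csum u)))%C by [].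
rewrite {1}/csum; congr (_ +i* _)%C.
- rewrite -[a * _](lim_seriesZ a ur) -[b * _](lim_seriesZ b ui) -lim_seriesB; try exact: is_cvg_seriesZ.
  by congr (limn (series _)); apply/funext => n; rewrite [LHS]complexReM.
- rewrite -[b * _](lim_seriesZ b ur) -[a * _](lim_seriesZ a ui) -lim_seriesD; try exact: is_cvg_seriesZ.
  by congr (limn (series _)); apply/funext => n; rewrite [LHS]complexImM.
Qed.

Lemma limn_series_recl (x : nat -> R) : cvgn (series x) ->
  limn (series x) = x 0%N + limn (series (fun n => x n.+1)).
Proof.
move=> cx.
have e n : series x n.+1 = x 0%N + series (fun n => x n.+1) n.
  rewrite /series/= big_nat_recl//.
have c1 : (series (fun n => x n.+1) @ \oo --> limn (series x) - x 0%N)%classic.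
  have -> : series (fun n => x n.+1) = (fun n => series x n.+1 - x 0%N).
    by apply/funext => n; rewrite e addrC addKr.
  by apply: cvgB; [rewrite (cvg_shiftS (series x))|exact: cvg_cst].
by rewrite (cvg_lim _ c1)// addrC subrK.
Qed.

Lemma csum_recl M u : csummable M u ->
  csum u = u 0%N + csum (fun n => u n.+1).
Proof.
move=> hu.
have [ur _] := limn_half_series_le (csummable_Re hu).
have [ui _] := limn_half_series_le (csummable_Im hu).
rewrite {1}/csum (limn_series_recl ur) (limn_series_recl ui) /csum.
by case: (u 0%N).
Qed.

Lemma csummableD M N u v : csummable M u -> csummable N v ->
  csummable (M + N) (fun n => u n + v n).
Proof.
move=> hu hv n; apply: le_trans (le_normcD _ _) _.
by rewrite mulrDl lerD.
Qed.

Lemma csummableZ M (c : C) u : csummable M u ->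
  csummable (cn c * M) (fun n => c * u n).
Proof.
by move=> hu n; rewrite normcM -mulrA; apply: ler_wpM2l; [exact: cn_ge0|exact: hu].
Qed.

End ComplexSeries.

Section PowerSeries.
Variable R : realType.
Local Notation C := (R[i]).
Local Notation T := (C^o).
Local Notation cn := (@normc R).
Implicit Types (a b : nat -> C) (t h : C) (M r : R).

(** The rate [r] acts as an inverse radius of convergence: series are summed where
    [r * cn t <= 2^-1], which is the ratio built into [csummable]. *)
Definition geobound r a := exists M : R, forall n, cn (a n) <= M * r ^+ n.

Definition psum a t : C := csum (fun n => a n * t ^+ n).

Definition dseq a n : C := n.+1%:R * a n.+1.

Definition shiftseq a n : C := if n is k.+1 then a k else 0.

Lemma geobound_summable r a t : 0 <= r -> r * cn t <= 2^-1 ->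
  geobound r a -> exists M, csummable M (fun n => a n * t ^+ n).
Proof.
move=> r0 rt [M aM]; exists M => n.
have M0 : 0 <= M by have := aM 0%N; rewrite expr0 mulr1; apply: le_trans; exact: cn_ge0.
rewrite normcM cnX; apply: le_trans (ler_wpM2r _ (aM n)) _.
  by rewrite exprn_ge0// cn_ge0.
rewrite -mulrA -exprMn -exprVn; apply: ler_wpM2l => //.
by apply: lerXn2r; rewrite ?nnegrE ?invr_ge0// mulr_ge0// cn_ge0.
Qed.

Lemma geobound_le r s a : 0 <= r -> r <= s -> geobound r a -> geobound s a.
Proof.
move=> r0 rs [M aM]; exists M => n; apply: le_trans (aM n) _.
have M0 : 0 <= M by have := aM 0%N; rewrite expr0 mulr1; apply: le_trans; exact: cn_ge0.
by apply: ler_wpM2l => //; apply: lerXn2r; rewrite ?nnegrE// (le_trans r0).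
Qed.

(** Since n + 1 <= 2^n, differentiation costs no more than a doubled rate. *)
Lemma geobound_dseq r a : 0 <= r -> geobound r a -> geobound (2 * r) (dseq a).
Proof.
move=> r0 [M aM]; exists (M * r) => n; rewrite /dseq normcM cn_nat.
have M0 : 0 <= M by have := aM 0%N; rewrite expr0 mulr1; apply: le_trans; exact: cn_ge0.
apply: le_trans (ler_wpM2l _ (aM _)) _ => //.
rewrite exprMn -mulrA (mulrCA r) -exprS mulrCA; apply: ler_wpM2l => //.
rewrite -natrX ler_wpM2r ?exprn_ge0// ler_nat.
exact: ltn_expl.
Qed.

Lemma geobound_shift r a : 1 <= r -> geobound r a -> geobound r (shiftseq a).
Proof.
move=> r1 [M aM]; exists M => -[|n]; rewrite /shiftseq.
  by rewrite normc0 expr0 mulr1; have := aM 0%N; rewrite expr0 mulr1; apply: le_trans; exact: cn_ge0.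
apply: le_trans (aM n) _.
have M0 : 0 <= M by have := aM 0%N; rewrite expr0 mulr1; apply: le_trans; exact: cn_ge0.
by apply: ler_wpM2l => //; rewrite exprS ler_peMl// exprn_ge0// (le_trans _ r1).
Qed.

Lemma geoboundD r a b : geobound r a -> geobound r b ->
  geobound r (fun n => a n + b n).
Proof.
move=> [M aM] [N bN]; exists (M + N) => n.
by apply: le_trans (le_normcD _ _) _; rewrite mulrDl lerD.
Qed.

Lemma geoboundZ r a (c : C) : geobound r a -> geobound r (fun n => c * a n).
Proof.
move=> [M aM]; exists (cn c * M) => n.
by rewrite normcM -mulrA ler_wpM2l// cn_ge0.
Qed.

Lemma psumD r a b t : 0 <= r -> r * cn t <= 2^-1 -> geobound r a ->
  geobound r b -> psum (fun n => a n + b n) t = psum a t + psum b t.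
Proof.
move=> r0 rt ga gb; have [M aM] := geobound_summable r0 rt ga.
have [N bN] := geobound_summable r0 rt gb.
by rewrite /psum -(csumD aM bN); apply: eq_csum => n; rewrite mulrDl.
Qed.

Lemma psumZ r a (c : C) t : 0 <= r -> r * cn t <= 2^-1 -> geobound r a ->
  psum (fun n => c * a n) t = c * psum a t.
Proof.
move=> r0 rt ga; have [M aM] := geobound_summable r0 rt ga.
by rewrite /psum -(csumZ c aM); apply: eq_csum => n; rewrite mulrA.
Qed.

Lemma psum_shift r a t : 1 <= r -> r * cn t <= 2^-1 -> geobound r a ->
  psum (shiftseq a) t = t * psum a t.
Proof.
move=> r1 rt ga; have r0 : 0 <= r by exact: le_trans r1.
have [M aM] := geobound_summable r0 rt ga.
have [N bN] := geobound_summable r0 rt (geobound_shift r1 ga).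
rewrite /psum (csum_recl bN) mul0r add0r -(csumZ _ aM).
by apply: eq_csum => n; rewrite /= exprS mulrCA.
Qed.

Lemma psum_at0 a r : 0 <= r -> geobound r a -> psum a 0 = a 0%N.
Proof.
move=> r0 ga; have rt : r * cn 0 <= 2^-1 by rewrite normc0 mulr0.
have [M aM] := geobound_summable r0 rt ga.
rewrite /psum (csum_recl aM) expr0 mulr1 (_ : (fun n => _) = fun=> 0).
  by rewrite csum0 addr0.
by apply/funext => n; rewrite exprS mul0r mulr0.
Qed.

(** The second-order remainder of t^n is bounded by n^2 |h|^2 s^(n-2). Multiplying by [s ^+ 2]
    avoids the exponent n - 2, which would truncate for small n. *)
Lemma exp_quad t h n (s : R) : cn t <= s -> cn (t + h) <= s ->
  cn ((t + h) ^+ n - t ^+ n - n%:R * t ^+ n.-1 * h) * s ^+ 2 <=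
  n%:R ^+ 2 * cn h ^+ 2 * s ^+ n.
Proof.
move=> ts ths; have s0 : 0 <= s := le_trans (cn_ge0 t) ts.
elim: n => [|n IH].
  by rewrite !expr0 subrr !mul0r subr0 normc0 expr0n/= !mul0r.
have -> : (t + h) ^+ n.+1 - t ^+ n.+1 - n.+1%:R * t ^+ n.+1.-1 * h =
   (t + h) * ((t + h) ^+ n - t ^+ n - n%:R * t ^+ n.-1 * h) +
   n%:R * t ^+ n.-1 * h ^+ 2.
  rewrite /= !exprS -(@natr1 _ n); case: n {IH} => [|n /=]; first by rewrite !expr0; ring.
  by rewrite !exprS; ring.
apply: le_trans (ler_wpM2r (exprn_ge0 _ s0) (le_normcD _ _)) _.
rewrite mulrDl (normcM (t + h)) (normcM _ (h ^+ 2)) (normcM n%:R) !cnX cn_nat.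
apply: le_trans (_ : s * (n%:R ^+ 2 * cn h ^+ 2 * s ^+ n)
   + n%:R * cn h ^+ 2 * s ^+ n.+1 <= _).
  apply: lerD.
    rewrite -(mulrA (cn (t + h))); apply: ler_pM => //; try exact: cn_ge0.
    by rewrite mulr_ge0 ?exprn_ge0//; exact: cn_ge0.
  case: n {IH} => [|n]; first by rewrite mulr0n !mul0r.
  rewrite [leLHS](_ : _ = n.+1%:R * cn h ^+ 2 * (cn t ^+ n * s ^+ 2)); last by rewrite /=; ring.
  rewrite ler_wpM2l ?mulr_ge0 ?exprn_ge0 ?cn_ge0//.
  have -> : s ^+ n.+2 = s ^+ n * s ^+ 2 by rewrite -exprD addn2.
  by rewrite ler_wpM2r ?exprn_ge0// lerXn2r// nnegrE// cn_ge0.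
rewrite -(@natr1 _ n) (exprS s n).
set X := cn h ^+ 2; have X0 : 0 <= X by rewrite exprn_ge0// cn_ge0.
have Y0 : 0 <= s * s ^+ n by rewrite mulr_ge0// exprn_ge0.
have -> : s * (n%:R ^+ 2 * X * s ^+ n) + n%:R * X * (s * s ^+ n) =
  (n%:R ^+ 2 + n%:R) * (X * (s * s ^+ n)) by ring.
have n0 : 0 <= n%:R :> R by [].
rewrite -(mulrA _ X); apply: ler_wpM2r; first by rewrite mulr_ge0.
nra.
Qed.

Lemma cder_psum r a t : 0 < r -> 8 * r * cn t < 1 -> geobound r a ->
  cder (psum a : T -> T) t (psum (dseq a) t).
Proof.
(* The n-th remainder is of size n^2 (r s)^n; with r s = 1/8 and n^2 <= 4^n it is dominated by
   2^-n. *)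
move=> r0 rt ga; pose s := (8 * r)^-1.
have s0 : 0 < s by rewrite invr_gt0 mulr_gt0.
have rs : r * s = 8^-1 by rewrite /s; field; rewrite gt_eqF.
have ts : cn t < s by rewrite /s -[_^-1]mul1r ltr_pdivlMr ?mulr_gt0// mulrC.
have sm (x : C) : cn x <= s -> r * cn x <= 2^-1.
  move=> xs; apply: le_trans (ler_wpM2l (ltW r0) xs) _; rewrite rs; lra.
have [M aM] := ga.
have M0 : 0 <= M by have := aM 0%N; rewrite expr0 mulr1; apply: le_trans; exact: cn_ge0.
have sd : 2 * r * cn t <= 2^-1.
  apply: le_trans (ler_wpM2l _ (ltW ts)) _; first by rewrite mulr_ge0// ltW.
  rewrite -mulrA rs; lra.
have [N dN] := geobound_summable (mulr_ge0 (ler0n _ 2) (ltW r0)) sd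
  (geobound_dseq (ltW r0) ga).
apply: (@cder_quad _ _ _ _ (4 * (M / s ^+ 2)) (s - cn t)); first by rewrite subr_gt0.
move=> h hs.
have ths : cn (t + h) <= s.
  by apply: le_trans (le_normcD _ _) _; rewrite addrC -lerBrDr ltW.
have [Mu uM] := geobound_summable (ltW r0) (sm _ ths) ga.
have [Mw wM] := geobound_summable (ltW r0) (sm _ (ltW ts)) ga.
(* The termwise derivative times h, preceded by a zero: its indices are now those of [a], and the
   whole remainder becomes one series. *)
pose v n := if n is k.+1 then h * (dseq a k * t ^+ k) else 0.
have vM : csummable (2 * (cn h * N)) v.
  have N0 : 0 <= N.
    by have := dN 0%N; rewrite expr0 divr1; apply: le_trans; exact: cn_ge0.
  case=> [|n]; first by rewrite normc0 divr_ge0 ?exprn_ge0// !mulr_ge0// cn_ge0.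
  apply: le_trans (csummableZ h dN n) _; rewrite exprS.
  have e0 : (2 : R) ^+ n != 0 by rewrite expf_neq0.
  by have -> : 2 * (cn h * N) / (2 * 2 ^+ n) = cn h * N / 2 ^+ n by field.
pose e n := a n * ((t + h) ^+ n - t ^+ n - n%:R * t ^+ n.-1 * h).
have eM : csummable (M / s ^+ 2 * cn h ^+ 2) e.
  move=> n; rewrite /e normcM.
  have s2 : 0 < s ^+ 2 by rewrite exprn_gt0.
  rewrite -(@ler_pM2r _ (s ^+ 2))// -(mulrA (cn (a n))).
  apply: le_trans (ler_pM _ _ (aM n) (exp_quad n (ltW ts) ths)) _.
  - exact: cn_ge0.
  - by rewrite mulr_ge0 ?cn_ge0// ltW.
  have -> : M * r ^+ n * (n%:R ^+ 2 * cn h ^+ 2 * s ^+ n) =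
     M * cn h ^+ 2 * (n%:R ^+ 2 * (r * s) ^+ n) by rewrite exprMn; ring.
  have e0 : (2 : R) ^+ n != 0 by rewrite expf_neq0.
  have -> : M / s ^+ 2 * cn h ^+ 2 / 2 ^+ n * s ^+ 2 = M * cn h ^+ 2 * (2 ^+ n)^-1.
    by field; rewrite e0 gt_eqF.
  apply: ler_wpM2l; first by rewrite mulr_ge0// exprn_ge0// cn_ge0.
  rewrite rs -(@ler_pM2r _ (8 ^+ n)) ?exprn_gt0// -mulrA -exprMn mulVf// expr1n mulr1.
  have -> : (8 : R) ^+ n = 2 ^+ n * (2 ^+ n) ^+ 2.
    have -> : 8 = 2 ^+ 3 :> R by rewrite -natrX.
    by rewrite -!exprM -exprD; congr (_ ^+ _); lia.
  rewrite mulrA mulVf// mul1r -!natrX ler_nat leq_exp2r//.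
  exact/ltnW/ltn_expl.
have -> : psum a (t + h) - psum a t - psum (dseq a) t * h = csum e.
  have -> : psum (dseq a) t * h = csum v.
    by rewrite (csum_recl vM) /v add0r (csumZ h dN) mulrC.
  have -> : psum a (t + h) = csum e + (psum a t + csum v).
    rewrite -(csumD wM vM) -(csumD eM (csummableD wM vM)).
    apply: eq_csum => -[|n]; rewrite /e /v /dseq /=; first by rewrite !expr0; ring.
    ring.
  ring.
by have := csum_le eM; rewrite mulrA.
Qed.

End PowerSeries.

Lemma linear_recurrence (T : Type) (step : nat -> T -> T -> T) (a0 a1 : T) :
  exists a : nat -> T,
    [/\ a 0%N = a0, a 1%N = a1 & forall n, a n.+2 = step n (a n) (a n.+1)].
Proof.
pose aux n := iteri n (fun k p => (p.2, step k p.1 p.2)) (a0, a1).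
by exists (fun n => (aux n).1).
Qed.

(** * Power series solutions of the hypergeometric equation *)

Section LocalSolution.
Variable R : realType.
Local Notation C := (R[i]).
Local Notation T := (C^o).
Local Notation cn := (@normc R).

Lemma open_cn_ball (z0 : C) (e : R) : open ([set z : T | cn (z - z0) < e] : set T).
Proof.
have -> : [set z : T | cn (z - z0) < e] = ball (z0 : T) (e%:C%C).
  by apply/funext => z; apply/propext; rewrite -ball_normE /= distrC normcC ltcR.
exact: ball_open.
Qed.

Section Coefficients.
Variables (al be ga de p : C).
Hypothesis al0 : al != 0.

(** Taylor recursion for (al + be t - t^2) y'' + (ga + de t) y' - p y = 0, the form which the
    hypergeometric equation takes in t = z - z0. *)
Definition ode_step n (x y : C) : C :=
  - ((be * n%:R + ga) * n.+1%:R * y + (de * n%:R - n%:R * (n%:R - 1) - p) * x)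
  / (al * n.+2%:R * n.+1%:R).

(** The coefficients of the recursion are bounded uniformly in n, whence the geometric growth of its
    solutions. *)
Lemma ode_step_le n x y :
  cn (ode_step n x y) <= (cn be + cn ga) / cn al * cn y
    + (cn de + 1 + cn p) / cn al * cn x.
Proof.
have a0 : 0 < cn al by rewrite cn_gt0.
have n1 : 0 < n.+1%:R :> R by rewrite ltr0n.
have n2 : 0 < n.+2%:R :> R by rewrite ltr0n.
rewrite /ode_step normcM normcV normcN !normcM !cn_nat.
rewrite ler_pdivrMr ?mulr_gt0//.
have -> : ((cn be + cn ga) / cn al * cn y + (cn de + 1 + cn p) / cn al * cn x) *
   (cn al * n.+2%:R * n.+1%:R) =
   (cn be + cn ga) * n.+2%:R * n.+1%:R * cn y + (cn de + 1 + cn p) * n.+2%:R * n.+1%:R * cn x.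
  by field; rewrite gt_eqF.
apply: le_trans (le_normcD _ _) _; rewrite !(normcM (_ * _)) !normcM !cn_nat.
have b0 := cn_ge0 be; have g0 := cn_ge0 ga; have d0 := cn_ge0 de; have p0 := cn_ge0 p.
have nn : 0 <= n%:R :> R by [].
have E1 : n.+1%:R = n%:R + 1 :> R by rewrite natr1.
have E2 : n.+2%:R = n%:R + 2 :> R by rewrite -!natr1; ring.
apply: lerD; apply: ler_wpM2r; rewrite ?cn_ge0//.
  apply: ler_wpM2r => //; apply: le_trans (le_normcD _ _) _.
  rewrite normcM cn_nat E2; nra.
apply: le_trans (le_cnB _ _) _; apply: le_trans (lerD (le_cnB _ _) (lexx _)) _.
have -> : cn (n%:R * (n%:R - 1)) = n%:R * `|n%:R - 1|.
  by rewrite normcM cn_nat -(cn_real (n%:R - 1)) rmorphB rmorph_nat rmorph1.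
rewrite normcM cn_nat E1 E2.
have h : `|n%:R - 1| <= n%:R + 1 :> R by rewrite ler_norml; apply/andP; split; lra.
have h2 : n%:R * `|n%:R - 1| <= n%:R * (n%:R + 1) :> R by rewrite ler_wpM2l.
have h3 : 0 <= cn de * (n%:R ^+ 2) :> R by rewrite mulr_ge0// exprn_ge0.
have h4 : 0 <= cn p * (n%:R ^+ 2) :> R by rewrite mulr_ge0// exprn_ge0.
have h5 : 0 <= cn p * n%:R :> R by rewrite mulr_ge0.
have h6 : 0 <= cn de * n%:R :> R by rewrite mulr_ge0.
have h7 : 0 <= (n%:R : R) ^+ 2 by rewrite exprn_ge0.
nra.
Qed.

Lemma ode_coefficients (y0 y1 : C) : exists (a : nat -> C) (r : R),
  [/\ 1 <= r, geobound r a, a 0%N = y0, a 1%N = y1 &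
    forall n, a n.+2 = ode_step n (a n) (a n.+1)].
Proof.
have [a [a0 a1 aS]] := linear_recurrence ode_step y0 y1.
pose c1 := (cn be + cn ga) / cn al; pose c2 := (cn de + 1 + cn p) / cn al.
have c10 : 0 <= c1 by rewrite divr_ge0 ?addr_ge0 ?cn_ge0.
have c20 : 0 <= c2 by rewrite divr_ge0 ?addr_ge0 ?cn_ge0.
have r1 : 1 <= 1 + c1 + c2 by rewrite -addrA lerDl addr_ge0.
exists a, (1 + c1 + c2); split => //; exists (cn y0 + cn y1).
have M0 : 0 <= cn y0 + cn y1 by rewrite addr_ge0 ?cn_ge0.
have r0 : 0 <= 1 + c1 + c2 by exact: le_trans r1.
suff H n : cn (a n) <= (cn y0 + cn y1) * (1 + c1 + c2) ^+ n /\
   cn (a n.+1) <= (cn y0 + cn y1) * (1 + c1 + c2) ^+ n.+1 by move=> n; case: (H n).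
elim: n => [|n [H1 H2]].
  rewrite a0 a1 expr0 mulr1 expr1 lerDl cn_ge0; split=> //.
  by apply: le_trans (_ : cn y0 + cn y1 <= _); rewrite ?lerDr ?cn_ge0// ler_peMr.
split=> //; rewrite aS; apply: le_trans (ode_step_le _ _ _) _.
rewrite -/c1 -/c2.
apply: le_trans (_ : c1 * ((cn y0 + cn y1) * (1 + c1 + c2) ^+ n.+1) +
   c2 * ((cn y0 + cn y1) * (1 + c1 + c2) ^+ n.+1) <= _).
  apply: lerD; apply: ler_wpM2l => //; apply: le_trans H1 _.
  by rewrite ler_wpM2l// exprS ler_peMl// exprn_ge0.
rewrite -mulrDl mulrCA (exprS _ n.+1) ler_wpM2l// ler_wpM2r ?exprn_ge0//.
by rewrite -addrA lerDr.
Qed.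

Lemma psum_ode r a t : 1 <= r -> 4 * r * cn t <= 2^-1 -> geobound r a ->
  (forall n, a n.+2 = ode_step n (a n) (a n.+1)) ->
  (al + be * t - t ^+ 2) * psum (dseq (dseq a)) t + (ga + de * t) * psum (dseq a) t
    - p * psum a t = 0.
Proof.
move=> r1 rt g0 aS; have r0 : 0 <= r by exact: le_trans r1.
have r4 : 1 <= 4 * r by lra.
have r40 : 0 <= 4 * r by exact: le_trans r4.
have g1 := geobound_dseq r0 g0.
have g2 : geobound (4 * r) (dseq (dseq a)).
  by apply: geobound_le (geobound_dseq _ g1); rewrite ?mulr_ge0//; lra.
have {}g0 : geobound (4 * r) a by apply: geobound_le g0 => //; lra.
have {}g1 : geobound (4 * r) (dseq a) by apply: geobound_le g1; rewrite ?mulr_ge0//; lra.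
have gs2 := geobound_shift r4 g2; have gs1 := geobound_shift r4 g1.
have gss2 := geobound_shift r4 gs2.
have S2 := psum_shift r4 rt g2; have S1 := psum_shift r4 rt g1.
have SS2 := psum_shift r4 rt gs2.
have -> : (al + be * t - t ^+ 2) * psum (dseq (dseq a)) t + (ga + de * t) * psum (dseq a) t
    - p * psum a t = al * psum (dseq (dseq a)) t +
   (be * psum (shiftseq (dseq (dseq a))) t + (-1 * psum (shiftseq (shiftseq (dseq (dseq a)))) t +
   (ga * psum (dseq a) t + (de * psum (shiftseq (dseq a)) t + (- p) * psum a t)))).
  rewrite SS2 S2 S1; ring.
do ![rewrite -(psumZ _ r40 rt); last by []].
do ![rewrite -(psumD r40 rt); [|by do ?apply: geoboundD; exact: geoboundZ..]].
rewrite /psum -(@csum0 R); apply: eq_csum => n.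
rewrite -[RHS](mul0r (t ^+ n)); congr (_ * _).
have n2 : n.+2%:R != 0 :> C by rewrite pnatr_eq0.
have n1 : n.+1%:R != 0 :> C by rewrite pnatr_eq0.
have -> : dseq (dseq a) n = n.+1%:R * (n.+2%:R * ode_step n (a n) (a n.+1)).
  by rewrite /dseq aS.
have -> : shiftseq (dseq (dseq a)) n = n%:R * n.+1%:R * a n.+1.
  by case: (n) => [|k]; rewrite /shiftseq /dseq ?mul0r// mulrA.
have -> : shiftseq (shiftseq (dseq (dseq a))) n = n%:R * (n%:R - 1) * a n.
  case: (n) => [|[|k]]; rewrite /shiftseq /dseq ?mul0r ?subrr ?mulr0 ?mul0r//.
  by rewrite -!natr1; ring.
have -> : shiftseq (dseq a) n = n%:R * a n.
  by case: (n) => [|k]; rewrite /shiftseq /dseq ?mul0r.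
rewrite /dseq /ode_step; field.
by rewrite al0 -mulrS n1 -(natrD _ 2 n) n2.
Qed.

End Coefficients.

(** The initial values are free. This is what later allows the coefficients of y and y' in the
    transformed equation to be compared separately. *)
Lemma local_solution (E : hgeq R) (z0 y0 y1 : C) : z0 != 0 -> z0 != 1 ->
  exists (U : set T) (y : T -> T),
    [/\ U z0, hg_solution E U y, y z0 = y0 & 'D_1 y z0 = y1].
Proof.
move=> z00 z01.
pose al := z0 * (1 - z0); pose be := 1 - 2 * z0.
pose de := - (hgA E + hgB E + 1); pose ga := hgC E + de * z0.
have al0 : al != 0 by rewrite mulf_neq0// subr_eq0 eq_sym.
have [a [r [r1 g0 a0 a1 aS]]] := ode_coefficients be ga de (hgA E * hgB E) al0 y0 y1.
have r0 : 0 < r by exact: lt_le_trans r1.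
have g1 := geobound_dseq (ltW r0) g0.
(* The bounds by |z0| and |1 - z0| keep the disc away from the singular points. The 16 serves the
   second derivative: y' has coefficients of rate 2 r, and [cder_psum] asks for 8 times the rate. *)
have [e [e0 e1 e2 e3]] : exists e : R, [/\ 0 < e, e <= cn z0, e <= cn (1 - z0) &
    16 * r * e <= 1].
  exists (Num.min (Num.min (cn z0) (cn (1 - z0))) (16 * r)^-1); split.
  - by rewrite !lt_min !cn_gt0 z00 subr_eq0 eq_sym z01 invr_gt0 mulr_gt0.
  - by rewrite !ge_min lexx.
  - by rewrite !ge_min lexx orbT.
  - rewrite -ler_pdivlMl ?mulr_gt0// mulr1 ge_min lexx orbT//.
pose U : set T := [set z : T | cn (z - z0) < e].
have Uo : open U by exact: open_cn_ball.
pose y : T -> T := fun z => psum a (z - z0).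
pose yy : T -> T := fun z => psum (dseq a) (z - z0).
pose yyy : T -> T := fun z => psum (dseq (dseq a)) (z - z0).
have shift1 (z : T) : cder (fun w : T => w - z0) z 1.
  by apply: cder_eq (cderD (cder_id z) (cder_cst (- z0 : T) z)) _; rewrite addr0.
have small z : U z -> 16 * r * cn (z - z0) < 1.
  by move=> Uz; apply: lt_le_trans e3; rewrite ltr_pM2l ?mulr_gt0.
have dy z : U z -> cder y z (yy z).
  move=> /small Uz; apply: cder_eq (cder_comp (g := psum a : T -> T) (shift1 z) (cder_psum r0 _ g0)) _.
    by have := cn_ge0 (z - z0); nra.
  by rewrite mulr1.
have dyy z : U z -> cder yy z (yyy z).
  move=> /small Uz.
  apply: cder_eq (cder_comp (g := psum (dseq a) : T -> T) (shift1 z) (cder_psum _ _ g1)) _.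
  - by rewrite mulr_gt0.
  - by rewrite mulrA -natrM.
  - by rewrite mulr1.
have Dy z : U z -> 'D_1 y z = yy z by move=> Uz; exact: cder_derive (dy z Uz).
have dDy z : U z -> cder (fun w => 'D_1 y w) z (yyy z).
  move=> Uz; apply: cder_near (dyy z Uz).
  have : nbhs z U by exact: open_nbhs_nbhs.
  by apply: filterS => w Uw; rewrite Dy.
exists U, y; split.
- by rewrite /U/= subrr normc0.
- split=> //.
  + move=> z; rewrite /U /= => Uz; split; apply: contraTneq Uz => ->; rewrite -leNgt//.
    by rewrite sub0r normcN.
  + by move=> z Uz; exact: cder_derivable (dy z Uz).
  + by move=> z Uz; exact: cder_derivable (dDy z Uz).
  + move=> z Uz; rewrite (cder_derive (dDy z Uz)) Dy//.
    have sm : 4 * r * cn (z - z0) <= 2^-1.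
      by have := small z Uz; have := cn_ge0 (z - z0); nra.
    rewrite -[RHS](psum_ode al0 r1 sm g0 aS) /y /yy /yyy /al /be /ga /de; ring.
- by rewrite /y subrr (psum_at0 (ltW r0)).
- rewrite Dy /yy ?subrr; last by rewrite /U/= subrr normc0.
  by rewrite (psum_at0 _ g1) ?mulr_ge0 ?ltW// /dseq mul1r.
Qed.

End LocalSolution.

Section RealEstimates.
Variable R : realType.
Implicit Types (x : R).

Lemma mean_value0 (f df : R -> R) x :
  (forall y : R, is_derive y 1 f (df y)) ->
  exists2 c, `|c| <= `|x| & f x - f 0 = df c * x.
Proof.
move=> fd.
have cf a b : {within `[a, b], continuous f}.
  apply: derivable_within_continuous => y _.
  by have [] := fd y.
have [x0|x0] := leP 0 x.
  have [c /andP[c0 cx] E] := MVT_segment x0 (fun y _ => fd y) (cf _ _).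
  exists c; last by rewrite E subr0.
  by move: c0 cx; rewrite !bnd_simp => c0 cx; rewrite !ger0_norm.
have [c /andP[c0 cx] E] := MVT_segment (ltW x0) (fun y _ => fd y) (cf _ _).
move: c0 cx; rewrite !bnd_simp => c0 cx; exists c.
  by rewrite !ler0_norm ?lerN2// ltW.
by rewrite -[LHS]opprB E sub0r mulrN opprK.
Qed.

Lemma norm_sin_le x : `|sin x| <= `|x|.
Proof.
have [c _] := mean_value0 x (@is_derive_sin R).
rewrite sin0 subr0 => ->; rewrite normrM ler_piMl//; exact: cos_max.
Qed.

Lemma norm_cosB1_le x : `|cos x - 1| <= `|x| ^+ 2.
Proof.
have [c cx] := mean_value0 x (@is_derive_cos R).
rewrite cos0 => ->; rewrite normrM normrN expr2 ler_wpM2r//.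
exact: le_trans (norm_sin_le _) cx.
Qed.

Lemma norm_sinB_le x : `|x| <= 1 -> `|sin x - x| <= `|x| ^+ 2.
Proof.
move=> x1; have [c cx] := mean_value0 x (@is_derive_sin R).
rewrite sin0 subr0 => ->; rewrite -{2}(mul1r x) -mulrBl normrM expr2.
apply: ler_wpM2r => //; apply: le_trans (norm_cosB1_le _) _.
have := normr_ge0 c; nra.
Qed.

Lemma norm_expRB1_le x : `|x| <= 1 -> `|expR x - 1| <= expR 1 * `|x|.
Proof.
move=> x1; have [c cx] := mean_value0 x (@is_derive_expR R).
rewrite expR0 => ->; rewrite normrM ler_wpM2r// ger0_norm ?expR_ge0// ler_expR.
exact: le_trans (ler_norm c) (le_trans cx x1).
Qed.

Lemma norm_expRB_le x : `|x| <= 1 -> `|expR x - 1 - x| <= expR 1 * `|x| ^+ 2.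
Proof.
move=> x1; have [c cx] := mean_value0 x (@is_derive_expR R).
rewrite expR0 => ->; rewrite -{2}(mul1r x) -mulrBl normrM expr2 mulrA.
rewrite ler_wpM2r//; apply: le_trans (norm_expRB1_le (le_trans cx x1)) _.
by rewrite ler_wpM2l ?expR_ge0.
Qed.

End RealEstimates.

(** * The complex exponential and branches of the logarithm *)

Section ComplexExponential.
Variable R : realType.
Local Notation C := (R[i]).
Local Notation T := (C^o).
Local Notation cn := (@normc R).
Local Notation cexp := (@cexp R).
Implicit Types (z w h : C).

Lemma cexpD z w : cexp (z + w) = cexp z * cexp w :> C.
Proof.
case: z => a b; case: w => c d.
have -> : ((a +i* b) + (c +i* d) = (a + c) +i* (b + d))%C by [].
rewrite /Defs.cexp expRD cosD sinD.
apply/eqP; rewrite eq_complex; apply/andP; split; apply/eqP => /=; ring.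
Qed.

Lemma cexp0 : cexp 0 = 1.
Proof. by rewrite /Defs.cexp /= expR0 cos0 sin0 mulr0 mulr1. Qed.

Lemma cexp_neq0 z : cexp z != 0.
Proof.
apply/eqP => e; have := cexpD z (- z); rewrite subrr cexp0 e mul0r => /eqP.
by rewrite oner_eq0.
Qed.

Lemma norm_cexpB_le h : cn h <= 1 ->
  cn (cexp h - 1 - h) <= 4 * expR 1 * cn h ^+ 2.
Proof.
case: h => a b; set r := cn (a +i* b)%C => r1.
have ar : `|a| <= r by exact: (Re_le_cn (a +i* b)%C).
have br : `|b| <= r by exact: (Im_le_cn (a +i* b)%C).
rewrite [X in cn X](_ : _ =
   ((expR a * cos b - 1 - a) +i* (expR a * sin b - b))%C); last first.
  by apply/eqP; rewrite eq_complex /=; apply/andP; split; apply/eqP; ring.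
apply: le_trans (cn_le_ReIm _ _) _.
have a1 : `|a| <= 1 by exact: le_trans r1.
have b1 : `|b| <= 1 by exact: le_trans r1.
have r0 : 0 <= r by exact: cn_ge0.
have E0 : 0 < expR 1 :> R by exact: expR_gt0.
have Ea : expR a <= expR 1 by rewrite ler_expR (le_trans (ler_norm a)).
have sq (x : R) : `|x| <= r -> `|x| ^+ 2 <= r ^+ 2 by move=> xr; apply: lerXn2r; rewrite ?nnegrE.
have -> : expR a * cos b - 1 - a = expR a * (cos b - 1) + (expR a - 1 - a) by ring.
have -> : expR a * sin b - b = expR a * (sin b - b) + (expR a - 1) * b by ring.
have -> : 4 * expR 1 * r ^+ 2 = (expR 1 * r ^+ 2 + expR 1 * r ^+ 2) +
   (expR 1 * r ^+ 2 + expR 1 * r * r) by ring.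
apply: lerD; apply: le_trans (ler_normD _ _) _; apply: lerD; rewrite ?normrM.
- rewrite ger0_norm ?expR_ge0//; apply: ler_pM => //; try exact: expR_ge0.
  exact: le_trans (norm_cosB1_le _) (sq _ br).
- apply: le_trans (norm_expRB_le a1) _; by apply: ler_wpM2l; [exact: ltW|exact: sq].
- rewrite ger0_norm ?expR_ge0//; apply: ler_pM => //; try exact: expR_ge0.
  exact: le_trans (norm_sinB_le b1) (sq _ br).
- apply: ler_pM => //; apply: le_trans (norm_expRB1_le a1) _.
  by apply: ler_wpM2l => //; exact: ltW.
Qed.

Lemma norm_cexp_quad z h : cn h <= 1 ->
  cn (cexp (z + h) - cexp z - cexp z * h) <= cn (cexp z) * (4 * expR 1) * cn h ^+ 2.
Proof.
move=> h1; rewrite cexpD.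
have -> : cexp z * cexp h - cexp z - cexp z * h = cexp z * (cexp h - 1 - h) by ring.
by rewrite normcM -mulrA ler_wpM2l ?cn_ge0// norm_cexpB_le.
Qed.

Lemma cder_cexp z : cder cexp z (cexp z).
Proof.
apply: (@cder_quad _ _ _ _ (cn (cexp z) * (4 * expR 1)) 1) => // h h1.
by apply: norm_cexp_quad; exact: ltW.
Qed.

(** Continuity of an inverse branch suffices. If D is the increment of L, then |h - w D| <= K |D|^2;
    as soon as K |D| <= |w| / 2 this is absorbed into |w D| <= 2 |h|, and the error becomes
    quadratic in h. *)
Lemma cder_log (L : T -> T) (V : set T) w : open V -> V w -> w != 0 ->
  (forall v, V v -> cexp (L v) = v) -> {for w, continuous L} -> cder L w (w^-1 : C).
Proof.
move=> Vo Vw w0 VL cL.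
have cw : 0 < cn w by rewrite cn_gt0.
pose K := cn w * (4 * expR 1).
have K0 : 0 < K by rewrite /K !mulr_gt0// expR_gt0.
have [e [e0 e1 eK]] : exists e : R, [/\ 0 < e, e <= 1 & K * e <= cn w / 2].
  exists (Num.min 1 (cn w / 2 / K)); split.
  - by rewrite lt_min ltr01 !divr_gt0.
  - by rewrite ge_min lexx.
  - by rewrite mulrC -ler_pdivlMr// ge_min lexx orbT.
have [d d0 dH] : exists2 d : R, 0 < d & forall h, cn h < d ->
    V (w + h) /\ cn (L (w + h) - L w) < e.
  have e0' : 0 < e%:C%C :> C by rewrite ltcR.
  have : \forall v \near (w : T), V v /\ cn (L v - L w) < e.
    have Vn : nbhs (w : T) V by exact: open_nbhs_nbhs.
    have /cvgrPdist_lt/(_ _ e0') := cL.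
    by apply: filterS2 Vn => v Vv; rewrite distrC normcC ltcR.
  move=> /nbhs_ballP[d /= d0 dH].
  have dE : d = (complex.Re d)%:C%C by rewrite RRe_real// gtr0_real.
  exists (complex.Re d) => [|h hd]; first by rewrite -ltcR -dE.
  apply: dH; rewrite -ball_normE /= opprD addrA subrr sub0r normrN normcC dE.
  by rewrite ltcR.
apply: (@cder_quad _ _ _ _ (4 * K / cn w ^+ 3) d) => // h /dH[Vh de].
set D := L (w + h) - L w in de *.
have E : cn (h - w * D) <= K * cn D ^+ 2.
  have D1 : cn D <= 1 by exact: le_trans (ltW de) e1.
  have := norm_cexp_quad (L w) D1; rewrite VL//.
  have -> : L w + D = L (w + h) by rewrite /D addrC subrK.
  by rewrite VL// (addrC w h) addrK.
have D0 := cn_ge0 D.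
have E2 : cn w * cn D <= 2 * cn h.
  have : cn w * cn D <= cn h + cn (h - w * D).
    by rewrite -normcM; apply: le_trans (le_cnB _ _); rewrite opprB addrCA subrr addr0.
  have : K * cn D ^+ 2 <= cn w / 2 * cn D.
    rewrite expr2 mulrA ler_wpM2r// (le_trans _ eK)//.
    by apply: ler_wpM2l; exact: ltW.
  by move: E; lra.
have -> : D - w^-1 * h = - w^-1 * (h - w * D) by field.
rewrite normcM normcN normcV mulrC ler_pdivrMr//.
apply: le_trans E _.
have -> : 4 * K / cn w ^+ 3 * cn h ^+ 2 * cn w = K * ((2 * cn h) ^+ 2 / cn w ^+ 2).
  by field; rewrite gt_eqF.
apply: ler_wpM2l; first exact: ltW.
rewrite ler_pdivlMr ?exprn_gt0// -exprMn mulrC.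
by apply: lerXn2r; rewrite // nnegrE mulr_ge0// ?cn_ge0.
Qed.

Lemma continuous_lipschitz (g : T -> R) : (forall v w, `|g v - g w| <= cn (v - w)) ->
  continuous g.
Proof.
move=> gl w; apply/(@cvgrPdist_lt _ _ _ _ (nbhs_filter (w : T))) => e e0.
have e0' : 0 < e%:C%C :> C by rewrite ltcR.
have := nbhsx_ballx (w : T) _ e0'.
by apply: filterS => v; rewrite -ball_normE /= normcC ltcR; exact: le_lt_trans.
Qed.

Lemma continuous_ReIm (f : T -> T) w :
  {for w, continuous (fun v => complex.Re (f v))} ->
  {for w, continuous (fun v => complex.Im (f v))} -> {for w, continuous f}.
Proof.
move=> cr ci; apply/(@cvgrPdist_lt _ _ _ _ (nbhs_filter (w : T))) => e e0.
have eE : e = (complex.Re e)%:C%C by rewrite RRe_real// gtr0_real.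
have e2 : 0 < complex.Re e / 2 by rewrite divr_gt0// -ltcR -eE.
have /cvgrPdist_lt/(_ _ e2) := cr; have /cvgrPdist_lt/(_ _ e2) := ci.
apply: filterS2 => v hi hr; rewrite normcC eE ltcR.
have -> : f w - f v = ((complex.Re (f w) - complex.Re (f v))
   +i* (complex.Im (f w) - complex.Im (f v)))%C by case: (f w); case: (f v).
by apply: le_lt_trans (cn_le_ReIm _ _) _; rewrite [ltRHS]splitr ltrD.
Qed.

Lemma cexp_halfplane (x y : R) : 0 < x ->
  cexp (ln (cn (x +i* y)%C) +i* atan (y / x))%C = (x +i* y)%C.
Proof.
move=> x0; have n0 : 0 < cn (x +i* y)%C by rewrite cn_gt0 eq_complex negb_and /= gt_eqF.
rewrite /Defs.cexp lnK//.
have c0 : cos (atan (y / x)) != 0 by rewrite cos_atan invr_eq0 gt_eqF// sqrtr_gt0 ltr_wpDr ?sqr_ge0.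
have -> : sin (atan (y / x)) = y / x * cos (atan (y / x)).
  by rewrite -{2}(atanK (y / x)) /tan divfK.
rewrite cos_atan.
have -> : cn (x +i* y)%C = x * Num.sqrt (1 + (y / x) ^+ 2).
  transitivity (Num.sqrt (x ^+ 2) * Num.sqrt (1 + (y / x) ^+ 2)); last first.
    by rewrite sqrtr_sqr gtr0_norm.
  rewrite -sqrtrM ?sqr_ge0//; congr Num.sqrt.
  by field; rewrite gt_eqF.
have s0 : 0 < Num.sqrt (1 + (y / x) ^+ 2) by rewrite sqrtr_gt0 ltr_wpDr ?sqr_ge0.
apply/eqP; rewrite eq_complex /=; apply/andP.
by split; apply/eqP; field; rewrite ?gt_eqF.
Qed.

Lemma cexp_pihalf : cexp (0 +i* (pi / 2))%C = 'i%C.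
Proof. by rewrite /Defs.cexp expR0 cos_pihalf sin_pihalf !mul1r. Qed.

(** Quarter turns bring every nonzero number into the right half-plane, where the arctangent gives
    the argument. *)
Lemma cexp_onto w : w != 0 -> exists z, cexp z = w.
Proof.
suff right_half (x y : R) : x != 0 -> exists z, cexp z = (x +i* y)%C.
  case: w => x y; have [->|x0] := eqVneq x 0; last by move=> _; exact: right_half.
  rewrite eq_complex eqxx /= => y0.
  have [z zE] := right_half y 0 y0; exists (z + (0 +i* (pi / 2))%C).
  by rewrite cexpD zE cexp_pihalf; apply/eqP; rewrite eq_complex /=; apply/andP;
    split; apply/eqP; ring.
move=> x0; have [xp|xn] := ltP 0 x; first by eexists; exact: cexp_halfplane.
have xp : 0 < - x by rewrite oppr_gt0 lt_neqAle x0.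
exists ((ln (cn (- x +i* - y)%C) +i* atan (- y / - x))%C
   + (0 +i* (pi / 2))%C + (0 +i* (pi / 2))%C).
rewrite !cexpD cexp_halfplane// cexp_pihalf.
by apply/eqP; rewrite eq_complex /=; apply/andP; split; apply/eqP; ring.
Qed.

(** On the disc of radius |w0| around w0 the quotient w / w0 has positive real part, so its
    principal logarithm is continuous; a fixed logarithm of w0 is added to it. *)
Lemma log_branch w0 : w0 != 0 -> exists (V : set T) (L : T -> T),
  [/\ open V, V w0, forall w, V w -> w != 0, forall w, V w -> cexp (L w) = w &
      forall w, V w -> cder L w (w^-1 : C)].
Proof.
move=> w00; have [l0 lE] := cexp_onto w00.
have c0 : 0 < cn w0 by rewrite cn_gt0.
pose V : set T := [set w | cn (w - w0) < cn w0].
have Vo : open V by exact: open_cn_ball.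
pose q (w : T) : C := w / w0.
pose L (w : T) : T := l0 + (ln (cn (q w)) +i* atan (complex.Im (q w) / complex.Re (q w)))%C.
have V0 w : V w -> 0 < complex.Re (q w).
  rewrite /V /= => Vw; have : cn (q w - 1) < 1.
    have -> : q w - 1 = (w - w0) / w0 by rewrite /q; field.
    by rewrite normcM normcV ltr_pdivrMr// mul1r.
  move=> h; have := le_lt_trans (Re_le_cn _) h.
  by rewrite complexReD /= ltr_norml => /andP[]; lra.
have Vn w : V w -> w != 0.
  by move=> /V0; apply: contraTneq => ->; rewrite /q mul0r ltxx.
have VL w : V w -> cexp (L w) = w.
  move=> Vw; rewrite /L cexpD lE; have := V0 w Vw; rewrite /q.
  case E : (w / w0) => [x y] x0.
  rewrite [X in _ * X](_ : _ = (x +i* y)%C); last exact: cexp_halfplane.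
  rewrite -E.
  by field.
have cq : continuous (q : T -> T).
  move=> w; apply: (@cder_continuous _ _ _ (w0^-1 : C)).
  by apply: cder_eq (cderM (cder_id w) (cder_cst _ w)) _; rewrite mul1r mulr0 addr0.
have ccn : continuous (cn : T -> R).
  have h (v w : C) : cn v - cn w <= cn (v - w).
    by rewrite lerBlDr; apply: le_trans (le_normcD _ _); rewrite subrK.
  apply: continuous_lipschitz => v w; rewrite ler_norml h andbT lerNl opprB.
  by rewrite -(normcN (v - w)) opprB h.
have cRe : continuous (@complex.Re R : T -> R).
  by apply: continuous_lipschitz => v w; apply: le_trans (Re_le_cn _); case: v; case: w.
have cIm : continuous (@complex.Im R : T -> R).
  by apply: continuous_lipschitz => v w; apply: le_trans (Im_le_cn _); case: v; case: w.
have Vw0 : cn (w0 - w0) < cn w0 by rewrite subrr normc0.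
exists V, L; split => //.
move=> w Vw; have rw0 := V0 _ Vw; apply: cder_log Vo Vw (Vn _ Vw) VL _.
apply: continuous_ReIm.
- have -> : (fun v => complex.Re (L v)) = (fun v => complex.Re l0 + ln (cn (q v))).
    by apply/funext => v; rewrite /L complexReD.
  apply: (@continuousD R R T (fun=> complex.Re l0) (fun v => ln (cn (q v))) w).
    exact: cst_continuous.
  apply: (@continuous_comp T R R (fun v : T => cn (q v)) (@ln R) w).
    by apply: (@continuous_comp T T R q cn w); [exact: cq|exact: ccn].
  apply: continuous_ln; rewrite cn_gt0; apply: contraTneq rw0 => ->; by rewrite ltxx.
- have -> : (fun v => complex.Im (L v)) = (fun v => complex.Im l0 +
      atan (complex.Im (q v) / complex.Re (q v))).
    by apply/funext => v; rewrite /L complexImD.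
  apply: (@continuousD R R T (fun=> complex.Im l0)
    (fun v => atan (complex.Im (q v) / complex.Re (q v))) w).
    exact: cst_continuous.
  apply: (@continuous_comp T R R (fun v : T => complex.Im (q v) / complex.Re (q v)) (@atan R) w).
    apply: (@continuousM R T (fun v => complex.Im (q v)) (fun v => (complex.Re (q v))^-1) w).
      by apply: (@continuous_comp T T R q (@complex.Im R) w); [exact: cq|exact: cIm].
    apply: (@continuousV R T (fun v => complex.Re (q v)) w); first by rewrite gt_eqF.
    by apply: (@continuous_comp T T R q (@complex.Re R) w); [exact: cq|exact: cRe].
  exact: continuous_atan.
Qed.

End ComplexExponential.

(** * Derivatives of the transformed functions *)

Section ChainRule.
Variable R : realType.
Local Notation C := (R[i]).
Local Notation T := (C^o).
Local Notation cexp := (@cexp R).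
Implicit Types (E : hgeq R) (f : ratfun R).

(** [hgp] and [hgq] are the coefficients p and q of the equation in the form y'' + p y' + q y =
    0. *)
Definition hgp E (x : C) : C := hgC E / x + (hgA E + hgB E + 1 - hgC E) / (x - 1).
Definition hgq E (x : C) : C := hgA E * hgB E / (x * (x - 1)).

Lemma hg_normalized E (x y y1 y2 : C) : x != 0 -> x != 1 ->
  (x * (1 - x) * y2 + (hgC E - (hgA E + hgB E + 1) * x) * y1 - hgA E * hgB E * y = 0)
  <-> y2 = - hgp E x * y1 - hgq E x * y.
Proof.
move=> x0 x1; have x1' : x - 1 != 0 by rewrite subr_eq0.
have x1'' : 1 - x != 0 by rewrite subr_eq0 eq_sym.
have -> : x * (1 - x) * y2 + (hgC E - (hgA E + hgB E + 1) * x) * y1 - hgA E * hgB E * y =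
  x * (1 - x) * (y2 - (- hgp E x * y1 - hgq E x * y)).
  by rewrite /hgp /hgq; field; rewrite x0 x1'.
split=> [/eqP|->]; last by rewrite subrr mulr0.
by rewrite !mulf_eq0 (negPf x0) (negPf x1'') /= subr_eq0 => /eqP.
Qed.

Section Product.
Variables (U V : set T) (E1 : hgeq R) (y th phi phi1 phi2 eta eta1 : T -> T).
Hypotheses (Vo : open V) (sol : hg_solution E1 U y) (VU : forall x, V x -> U (phi x)).
Hypotheses (d_phi : forall x, V x -> cder phi x (phi1 x))
  (d_phi1 : forall x, V x -> cder phi1 x (phi2 x))
  (d_eta : forall x, V x -> cder eta x (eta1 x))
  (d_th : forall x, V x -> cder th x (eta x * th x)).
Let Y x := th x * y (phi x).

Lemma cder_pullback x : V x ->
  cder Y x (th x * (eta x * y (phi x) + phi1 x * 'D_1 y (phi x))).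
Proof.
move=> Vx; case: sol => _ _ hy _ _.
have dy := derivable_cder (hy _ (VU Vx)).
apply: cder_eq (cderM (d_th Vx) (cder_comp (d_phi Vx) dy)) _; ring.
Qed.

(** [eta] is the logarithmic derivative of [th]. The equation of [E1] eliminates y'', leaving the
    values of y and y' at phi(x), which can be prescribed. *)
Lemma cder2_pullback x : V x ->
  cder (fun w => 'D_1 Y w) x
    (th x * ((eta1 x + eta x ^+ 2 - phi1 x ^+ 2 * hgq E1 (phi x)) * y (phi x)
     + (2 * eta x * phi1 x + phi2 x - phi1 x ^+ 2 * hgp E1 (phi x)) * 'D_1 y (phi x))).
Proof.
move=> Vx; have [_ U01 hy hy' eqn] := sol.
have near_Y : \forall w \near (x : T),
    th w * (eta w * y (phi w) + phi1 w * 'D_1 y (phi w)) = 'D_1 Y w.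
  have : nbhs (x : T) V by exact: open_nbhs_nbhs.
  by apply: filterS => w Vw; rewrite (cder_derive (cder_pullback Vw)).
apply: cder_near near_Y _.
have dy := derivable_cder (hy _ (VU Vx)).
have dy' := derivable_cder (hy' _ (VU Vx)).
have [p0 p1] := U01 _ (VU Vx).
apply: cder_eq (cderM (d_th Vx) (cderD
  (cderM (d_eta Vx) (cder_comp (d_phi Vx) dy))
  (cderM (d_phi1 Vx) (cder_comp (d_phi Vx) dy')))) _.
rewrite ((hg_normalized _ _ _ _ p0 p1).1 (eqn _ (VU Vx))); ring.
Qed.

End Product.

Definition rderiv f (x : C) : C :=
  ((rnum f)^`().[x] * (rden f).[x] - (rnum f).[x] * (rden f)^`().[x]) / (rden f).[x] ^+ 2.

Definition rlogderiv f (x : C) : C :=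
  (rnum f)^`().[x] / (rnum f).[x] - (rden f)^`().[x] / (rden f).[x].

Lemma cder_reval f (x : C) : (rden f).[x] != 0 ->
  cder (reval f : T -> T) x (rderiv f x).
Proof.
move=> d0; apply: cder_eq (cderM (cder_poly (rnum f) (x : T)) (cderV d0 (cder_poly (rden f) (x : T)))) _.
by rewrite /rderiv; field.
Qed.

Lemma rderiv_logderiv f (x : C) : (rden f).[x] != 0 -> (rnum f).[x] != 0 ->
  rderiv f x = reval f x * rlogderiv f x.
Proof.
by move=> d0 n0; rewrite /rderiv /rlogderiv /reval; field; rewrite d0 n0.
Qed.

Lemma cder_prod_log (I : Type) (s : seq I) (g : I -> C) (h : I -> T -> T) (x : T) :
  (forall i, cder (h i) x (g i * h i x)) ->
  cder (fun w => \prod_(i <- s) h i w) x ((\sum_(i <- s) g i) * \prod_(i <- s) h i x).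
Proof.
move=> H; elim: s => [|i s IH].
  rewrite !big_nil mul0r; apply: cder_ext (cder_cst 1 x) => w; by rewrite big_nil.
rewrite !big_cons; apply: cder_ext (cder_eq (cderM (H i) IH) _) => [w|].
  by rewrite big_cons.
ring.
Qed.

(** Differentiating [cexp (L i) = r i] shows that the logarithmic derivative of a branch is a
    rational function independent of the chosen logarithms. *)
Lemma cder_branch n (r : 'I_n -> ratfun R) (a : 'I_n -> C) (V : set T) (th : T -> T) :
  open V -> power_product_branch r a V th -> forall x, V x ->
  cder th x ((\sum_(i < n) a i * rlogderiv (r i) x) * th x) /\
  forall i, (rden (r i)).[x] != 0 /\ (rnum (r i)).[x] != 0.
Proof.
move=> Vo [L [hL cL thE]] x Vx.
have Vn : nbhs (x : T) V by exact: open_nbhs_nbhs.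
have nz i : (rden (r i)).[x] != 0 /\ (rnum (r i)).[x] != 0.
  have [d0 e] := cL i x Vx; split=> //.
  by have := cexp_neq0 (L i x); rewrite e /reval mulf_eq0 negb_or => /andP[].
split=> //.
have dL i : cder (L i) x (rlogderiv (r i) x).
  have [d0 n0] := nz i.
  have dLi := derivable_cder (hL i x Vx).
  apply: (cder_eq dLi).
  have h1 := cder_comp dLi (cder_cexp (L i x)).
  have h2 := cder_reval d0.
  have near_r : \forall w \near (x : T), reval (r i) w = cexp (L i w).
    by apply: filterS Vn => w Vw; have [_ ->] := cL i w Vw.
  have := cder_derive (cder_near near_r h2); rewrite (cder_derive h1).
  have [_ e] := cL i x Vx.
  rewrite rderiv_logderiv// -e; exact: mulfI (cexp_neq0 _) _ _.
have near_th : \forall w \near (x : T), \prod_(i < n) cexp (a i * L i w) = th w.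
  by apply: filterS Vn => w Vw; rewrite thE.
apply: cder_near near_th _; rewrite thE//.
apply: cder_prod_log => i.
apply: cder_eq (cder_comp (cderM (cder_cst (a i) x) (dL i)) (cder_cexp (a i * L i x))) _.
ring.
Qed.

Lemma near_poly_neq0 (p : {poly C}) (x0 : T) : p.[x0] != 0 ->
  \forall x \near x0, p.[x] != 0.
Proof.
move=> p0; pose B : set T := [set z | normc (z - p.[x0]) < normc p.[x0]].
have Bn : nbhs (p.[x0] : T) B.
  apply: open_nbhs_nbhs; split; first exact: open_cn_ball.
  have : normc (p.[x0] - p.[x0]) < normc p.[x0] by rewrite subrr normc0 cn_gt0.
  by [].
have h : nbhs x0 (horner p @^-1` B) := cder_continuous (cder_poly p x0) Bn.
apply: filterS h => x; rewrite /B /= => h; apply: contraTneq h => ->.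
by rewrite sub0r normcN ltxx.
Qed.

Lemma branch_exists n (r : 'I_n -> ratfun R) (a : 'I_n -> C) (x0 : T) (P : T -> Prop) :
  (\forall x \near x0, P x) ->
  (forall i, (rden (r i)).[x0] != 0) -> (forall i, (rnum (r i)).[x0] != 0) ->
  exists (V : set T) (th : T -> T),
    [/\ open V, V x0, forall x, V x -> P x, power_product_branch r a V th & th x0 != 0].
Proof.
move=> Px0 d0 n0.
have r0 i : reval (r i) x0 != 0 by rewrite mulf_neq0// invr_eq0.
have [Vl HV] := choice (fun i => log_branch (r0 i)); have [L HL] := choice HV.
have cr i : {for x0, continuous (reval (r i) : T -> T)} := cder_continuous (cder_reval (d0 i)).
have near_r i : \forall x \near x0, (rden (r i)).[x] != 0 /\ Vl i (reval (r i) x).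
  have [Vo V0 _ _ _] := HL i.
  have nd := near_poly_neq0 (d0 i).
  have nV : nbhs x0 [set x : T | Vl i (reval (r i) x)].
    by apply: (cr i (Vl i)); exact: open_nbhs_nbhs.
  exact: filterS2 nd nV.
have near0 : nbhs x0 [set x | P x /\ forall i, (rden (r i)).[x] != 0 /\ Vl i (reval (r i) x)].
  exact: (filterI Px0 (filter_forall _ near_r)).
move: near0; rewrite nbhsE => -[V [Vo V0] VP].
pose Lr i x := L i (reval (r i) x).
exists V, (fun x => \prod_(i < n) cexp (a i * Lr i x)); split=> //.
- by move=> x /VP[].
- exists Lr; split=> // i x /VP[_ /(_ i)[dx Vx]]; have [_ _ _ cL dL] := HL i.
    exact: cder_derivable (cder_comp (cder_reval dx) (dL _ Vx)).
  by split=> //; exact: cL.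
- by apply/prodf_neq0 => i _; exact: cexp_neq0.
Qed.

End ChainRule.

(** In characteristic zero the natural numbers supply more roots of [p * D] than its size
    permits. *)
Lemma poly_eq0_of_generic (K : numFieldType) (D p : {poly K}) : D != 0 ->
  (forall x, D.[x] != 0 -> p.[x] = 0) -> p = 0.
Proof.
move=> D0 H; apply/eqP; rewrite -[_ == 0]/(p == 0); apply: contraT => p0.
have q0 : p * D != 0 by rewrite mulf_neq0.
have := @max_poly_roots _ (p * D) [seq (i%:R : K) | i <- iota 0 (size (p * D))] q0.
rewrite size_map size_iota ltnn => ->//; last first.
  by rewrite map_inj_uniq ?iota_uniq// => i j /eqP; rewrite eqr_nat => /eqP.
apply/allP => x _; rewrite rootE hornerM mulf_eq0.
by have [//|/H->] := eqVneq D.[x] 0; rewrite ?eqxx ?orbT.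
Qed.

Definition wronskian (K : nzRingType) (F G : {poly K}) : {poly K} := F^`() * G - F * G^`().

(** If the Wronskian vanishes, [G] divides its own derivative by coprimality. Degrees give G' = 0,
    then F' = 0, and both are constant. *)
Lemma wronskian_neq0 (K : numFieldType) (F G : {poly K}) : coprimep F G -> G != 0 ->
  (0 < maxn (size F).-1 (size G).-1)%N -> wronskian F G != 0.
Proof.
move=> cFG G0 sz; apply: contraTneq sz => /eqP; rewrite subr_eq0 => /eqP WE.
have GdG' : G %| G^`().
  by move: cFG; rewrite coprimep_sym => cGF; rewrite -(Gauss_dvdpr _ cGF) -WE dvdp_mulIr.
have deriv0 (p : {poly K}) : p^`() = 0 -> (size p).-1 = 0%N.
  move=> p0; apply/eqP; rewrite -leqn0 leqNgt; apply/negP => sp.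
  have pE : p^`()`_(size p).-2 = 0 by rewrite p0 coef0.
  move/eqP: pE; rewrite coef_deriv prednK//.
  rewrite -mulr_natr mulf_eq0 pnatr_eq0 -lead_coefE lead_coef_eq0.
  by move: sp; case: (eqVneq p 0) => [->|_]; rewrite ?size_poly0//=; case: (size p) => [|[|]].
have G'0 : G^`() = 0.
  apply/eqP; apply: contraLR isT => G'0.
  by have := dvdp_leq G'0 GdG'; rewrite leqNgt lt_size_deriv.
have F'0 : F^`() = 0.
  by move/eqP: WE; rewrite G'0 mulr0 mulf_eq0 (negPf G0) orbF => /eqP.
by rewrite (deriv0 _ G'0) (deriv0 _ F'0).
Qed.

(** * The pull-back criterion *)

Section PullIdentity.
Variable R : realType.
Local Notation C := (R[i]).
Local Notation T := (C^o).
Implicit Types (E : hgeq R) (F G : {poly C}) (x : C).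

(** [hgC] and [hgc1] are the residues of [hgp] at 0 and 1. [hgcoo] equals 2 - [hgC] - [hgc1], the
    factor of G'/G in the logarithmic term; the 2 comes from phi' = W / G^2. *)
Definition hgc1 E : C := hgA E + hgB E + 1 - hgC E.
Definition hgcoo E : C := 1 - hgA E - hgB E.

(* pull_num / pull_den is minus the coefficient of the first derivative of Y in
   the equation satisfied by the Y = y o (F / G). *)
Definition pull_den F G := F * G * (F - G) * wronskian F G.
Definition pull_num E F G := let W := wronskian F G in
  hgC E *: (F^`() * G * (F - G) * W) + hgc1 E *: ((F - G)^`() * F * G * W)
  + hgcoo E *: (G^`() * F * (F - G) * W) - W^`() * F * G * (F - G).
(** [pull_lhs] and [pull_rhs] are the numerators of 2 N' + N^2 - 4 Q for the two equations, over
    [pull_den F G ^+ 2] and x^2 (x - 1)^2. *)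
Definition pull_lhs E F G :=
  let M := pull_num E F G in let K := pull_den F G in
  2 *: (M^`() * K - M * K^`()) + M ^+ 2
  - (4 * (hgA E * hgB E)) *: (F * (F - G) * wronskian F G ^+ 4).
Definition pull_rhs E : {poly C} :=
  (hgC E ^+ 2 - 2 * hgC E) *: ('X - 1%:P) ^+ 2 + (hgc1 E ^+ 2 - 2 * hgc1 E) *: 'X ^+ 2
  + (2 * hgC E * hgc1 E - 4 * (hgA E * hgB E)) *: ('X * ('X - 1%:P)).

(* Equality of the two equations after removing the terms of first order, with
   denominators cleared. *)
Definition pull_identity E1 E2 F G :=
  'X ^+ 2 * ('X - 1%:P) ^+ 2 * pull_lhs E1 F G = pull_den F G ^+ 2 * pull_rhs E2.

Definition pull_log E F G x : C := (pull_num E F G).[x] / (pull_den F G).[x].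
Definition pull_log1 E F G x : C :=
  ((pull_num E F G)^`().[x] * (pull_den F G).[x]
   - (pull_num E F G).[x] * (pull_den F G)^`().[x]) / (pull_den F G).[x] ^+ 2.
Definition hgp1 E x : C := - hgC E / x ^+ 2 - hgc1 E / (x - 1) ^+ 2.

Lemma hgpE E x : hgp E x = hgC E / x + hgc1 E / (x - 1).
Proof. by []. Qed.

Lemma cder_hgp E x : x != 0 -> x != 1 -> cder (hgp E : T -> T) x (hgp1 E x).
Proof.
move=> x0 x1; have x1' : x - 1 != 0 by rewrite subr_eq0.
have d1 := cderD (cder_id (x : T)) (cder_cst (-1 : T) (x : T)).
have := cderD (cderM (cder_cst (hgC E : T) (x : T)) (@cderV _ (fun y : T => y) _ _ x0 (cder_id (x : T))))
  (cderM (cder_cst (hgc1 E : T) (x : T)) (@cderV _ (fun y : T => y + (-1)) _ _ x1' d1)).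
move=> h; apply: cder_ext (cder_eq h _) => //.
by rewrite /hgp1; field; rewrite x0 x1'.
Qed.

Lemma cder_pull_log E F G x : (pull_den F G).[x] != 0 ->
  cder (pull_log E F G : T -> T) x (pull_log1 E F G x).
Proof.
move=> k0; apply: cder_eq (cderM (cder_poly (pull_num E F G) (x : T))
  (cderV k0 (cder_poly (pull_den F G) (x : T)))) _.
by rewrite /pull_log1; field.
Qed.

Section Pointwise.
Variables (E1 E2 : hgeq R) (F G : {poly C}) (x : C).
Hypotheses (F0 : F.[x] != 0) (G0 : G.[x] != 0) (H0 : (F - G).[x] != 0)
  (W0 : (wronskian F G).[x] != 0) (x0 : x != 0) (x1 : x != 1).

Definition pull_phi1 : C := (wronskian F G).[x] / G.[x] ^+ 2.
Definition pull_phi2 : C :=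
  (wronskian F G)^`().[x] / G.[x] ^+ 2 - 2 * (wronskian F G).[x] * G^`().[x] / G.[x] ^+ 3.

Lemma pull_den_neq0 : (pull_den F G).[x] != 0.
Proof. by rewrite /pull_den !hornerM !mulf_neq0. Qed.

Lemma pull_first_order :
  pull_phi2 - pull_phi1 ^+ 2 * hgp E1 (F.[x] / G.[x]) = - pull_phi1 * pull_log E1 F G x.
Proof.
rewrite /pull_phi1 /pull_phi2 /pull_log /pull_num /pull_den /hgp /hgc1 /hgcoo.
rewrite (derivB F G) !(hornerD, hornerN, hornerM, hornerZ).
set w' := (wronskian F G)^`().[x].
have wE : (wronskian F G).[x] = F^`().[x] * G.[x] - F.[x] * G^`().[x].
  by rewrite /wronskian !(hornerD, hornerN, hornerM).
move: W0 H0; rewrite wE hornerD hornerN; move: F0 G0.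
move: (F.[x]) (G.[x]) (F^`().[x]) (G^`().[x]) => f g f' g' f0 g0 w0 h0.
by field; rewrite w0 f0 g0 h0.
Qed.

(** The left-hand side is the coefficient of y in the transformed equation once the logarithmic
    derivative of theta is replaced by (N - p2) / 2, the value forced by the coefficient of y'. *)
Lemma pull_identity_pointwise :
  (pull_log1 E1 F G x - hgp1 E2 x) / 2 + ((pull_log E1 F G x - hgp E2 x) / 2) ^+ 2
   - pull_phi1 ^+ 2 * hgq E1 (F.[x] / G.[x])
   + hgp E2 x * ((pull_log E1 F G x - hgp E2 x) / 2) + hgq E2 x =
  ('X ^+ 2 * ('X - 1%:P) ^+ 2 * pull_lhs E1 F G - pull_den F G ^+ 2 * pull_rhs E2).[x]
   / (4 * (x ^+ 2 * (x - 1) ^+ 2 * (pull_den F G).[x] ^+ 2)).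
Proof.
have x1' : x - 1 != 0 by rewrite subr_eq0.
rewrite /pull_log1 /pull_log /pull_phi1 /hgp1 !hgpE /hgq /pull_lhs /pull_rhs.
have kE : (pull_den F G).[x] = F.[x] * G.[x] * (F.[x] - G.[x]) * (wronskian F G).[x].
  by rewrite /pull_den !(hornerM, hornerD, hornerN).
cbv zeta; move: (pull_den F G) (pull_num E1 F G) (wronskian F G) kE W0 H0 => K M W.
rewrite !(hornerM, hornerD, hornerN, horner_exp, hornerZ, hornerX, hornerC) => -> w0.
move: F0 G0; move: (F.[x]) (G.[x]) (W.[x]) w0 (M.[x]) (M^`().[x]) (K^`().[x]).
move=> f g w w0 m m' k' f0 g0 h0.
by field; rewrite f0 g0 w0 h0 x0 x1'.
Qed.

End Pointwise.

Lemma reval_poly_neq01 (phi : ratfun R) x : (rden phi).[x] != 0 ->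
  (reval phi x != 0) = ((rnum phi).[x] != 0) /\
  (reval phi x != 1) = ((rnum phi - rden phi).[x] != 0).
Proof.
move=> d0; rewrite /reval mulf_eq0 invr_eq0 (negPf d0) orbF; split=> //.
by rewrite -(inj_eq (mulIf d0)) mulfVK// mul1r hornerD hornerN subr_eq0.
Qed.

Lemma rderivE (phi : ratfun R) x : (rden phi).[x] != 0 ->
  rderiv phi x = pull_phi1 (rnum phi) (rden phi) x.
Proof. by move=> d0; rewrite /rderiv /pull_phi1 /wronskian !hornerE. Qed.

Lemma cder_rderiv (phi : ratfun R) x : (rden phi).[x] != 0 ->
  cder (rderiv phi : T -> T) x (pull_phi2 (rnum phi) (rden phi) x).
Proof.
move=> d0; have d20 : (rden phi).[x] ^+ 2 != 0 by rewrite expf_neq0.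
pose W := wronskian (rnum phi) (rden phi).
pose D := rden phi * rden phi.
have e : (fun x : T => W.[x] * D.[x]^-1) =1 rderiv phi.
  by move=> y; rewrite /rderiv /W /wronskian /D !(hornerD, hornerN, hornerM).
have d2 : D.[x] != 0 by rewrite hornerM.
apply: cder_ext e _; apply: cder_eq
  (cderM (cder_poly W (x : T)) (cderV d2 (cder_poly D (x : T)))) _.
rewrite /pull_phi2 -/W /D derivM !(hornerD, hornerM).
by field.
Qed.

Lemma derivable_rlogderiv (f : ratfun R) x : (rden f).[x] != 0 -> (rnum f).[x] != 0 ->
  exists l, cder (rlogderiv f : T -> T) x l.
Proof.
move=> d0 n0; eexists.
apply: cder_ext (cderD (cderM (cder_poly (rnum f)^`() (x : T)) (cderV n0 (cder_poly (rnum f) (x : T))))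
  (cderM (cder_cst (-1 : T) (x : T)) (cderM (cder_poly (rden f)^`() (x : T)) (cderV d0 (cder_poly
      (rden f) (x : T)))))).
by move=> y; rewrite /rlogderiv mulN1r.
Qed.

Lemma derivable_sum_rlogderiv n (r : 'I_n -> ratfun R) (a : 'I_n -> C) x :
  (forall i, (rden (r i)).[x] != 0 /\ (rnum (r i)).[x] != 0) ->
  exists l, cder (fun x : T => \sum_(i < n) a i * rlogderiv (r i) x : T) x l.
Proof.
move=> H; have [l Hl] := choice (fun i => derivable_rlogderiv (H i).1 (H i).2).
exists (\sum_(i < n) a i * l i).
elim: (index_enum _) => [|i s IH].
  by rewrite big_nil; apply: cder_ext (cder_cst 0 (x : T)) => y; rewrite big_nil.
rewrite big_cons; apply: cder_ext (cder_eq (cderD (cderM (cder_cst (a i : T) (x : T)) (Hl i)) IH) _).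
  by move=> y; rewrite big_cons.
by rewrite mul0r add0r.
Qed.

End PullIdentity.

Section PullbackCriterion.
Variable R : realType.
Local Notation C := (R[i]).
Local Notation T := (C^o).
Implicit Types (E : hgeq R) (phi : ratfun R) (x : C).

Lemma rdegree_gt0_wronskian phi : (0 < rdegree phi)%N -> wronskian (rnum phi) (rden phi) != 0.
Proof. by apply: wronskian_neq0; [exact: rcoprime|exact: rden_neq0]. Qed.

Lemma wronskianBl (K : comNzRingType) (F G : {poly K}) : wronskian (F - G) G = wronskian F G.
Proof. by rewrite /wronskian derivB; ring. Qed.

Lemma wronskian_neq0_num (K : comNzRingType) (F G : {poly K}) : wronskian F G != 0 ->
  (F != 0) && (F - G != 0).
Proof.
move=> W0; apply/andP; split; apply: contraNneq W0 => e.
  by rewrite e /wronskian deriv0 !mul0r subrr.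
by rewrite -wronskianBl e /wronskian deriv0 !mul0r subrr.
Qed.

(** The coefficients of y' and of y vanish separately: solutions with initial values (0, 1) and (1,
    0) at phi(x) are inserted, together with a branch of theta near x. *)
Lemma pullback_coefs phi E1 E2 n (r : 'I_n -> ratfun R) (a : 'I_n -> C) x :
  (forall (U V : set T) (y th : T -> T),
      hg_solution E1 U y -> open V -> (forall x, V x -> x != 0 /\ x != 1) ->
      (forall x, V x -> (rden phi).[x] != 0 /\ U (reval phi x)) ->
      power_product_branch r a V th ->
      hg_solution E2 V (fun x => th x * y (reval phi x))) ->
  x != 0 -> x != 1 -> (rden phi).[x] != 0 -> (rnum phi).[x] != 0 ->
  (rnum phi - rden phi).[x] != 0 ->
  (forall i, (rden (r i)).[x] != 0 /\ (rnum (r i)).[x] != 0) ->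
  let eta x := \sum_(i < n) a i * rlogderiv (r i) x in
  2 * eta x * rderiv phi x + pull_phi2 (rnum phi) (rden phi) x
    - rderiv phi x ^+ 2 * hgp E1 (reval phi x) + hgp E2 x * rderiv phi x = 0 /\
  'D_1 (eta : T -> T) x + eta x ^+ 2 - rderiv phi x ^+ 2 * hgq E1 (reval phi x)
    + hgp E2 x * eta x + hgq E2 x = 0.
Proof.
move=> pb x0 x1 d0 n0 h0 r0 eta.
have [e0 e1] := reval_poly_neq01 d0.
have p0 : reval phi x != 0 by rewrite e0.
have p1 : reval phi x != 1 by rewrite e1.
suff eqn (y0 y1 : C) : ('D_1 (eta : T -> T) x + eta x ^+ 2
     - rderiv phi x ^+ 2 * hgq E1 (reval phi x)) * y0
   + (2 * eta x * rderiv phi x + pull_phi2 (rnum phi) (rden phi) x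
     - rderiv phi x ^+ 2 * hgp E1 (reval phi x)) * y1 =
   - hgp E2 x * (eta x * y0 + rderiv phi x * y1) - hgq E2 x * y0.
  split; [have := eqn 0 1|have := eqn 1 0]; rewrite !(mulr0, mulr1, addr0, add0r) ?subr0 => ->; ring.
have [U [y [Ux sol yx y'x]]] := local_solution E1 y0 y1 p0 p1.
pose P (w : T) := [/\ w != 0, w != 1, (rden phi).[w] != 0 & U (reval phi w)].
have nearP : \forall w \near (x : T), P w.
  have Uo : open U by case: sol.
  have n1 : \forall w \near (x : T), w != 0.
    have := @near_poly_neq0 _ 'X (x : T); rewrite hornerX => /(_ x0).
    by apply: filterS => w; rewrite hornerX.
  have n2 : \forall w \near (x : T), w != 1.
    have := @near_poly_neq0 _ ('X - 1%:P) (x : T); rewrite !hornerE subr_eq0 => /(_ x1).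
    by apply: filterS => w; rewrite !hornerE subr_eq0.
  have n3 := near_poly_neq0 d0.
  have n4 : nbhs (x : T) [set w : T | U (reval phi w)].
    by apply: (cder_continuous (cder_reval d0)); exact: open_nbhs_nbhs.
  by apply: filterS2 (filterI n1 n2) (filterI n3 n4) => w [? ?] [].
have [V [th [Vo Vx VP br th0]]] := @branch_exists _ _ r a (x : T) P nearP
  (fun i => (r0 i).1) (fun i => (r0 i).2).
have [_ _ _ _ sol2] : hg_solution E2 V (fun x => th x * y (reval phi x)).
  apply: (pb U V y th) => // w /VP[] //.
have dphi w : V w -> cder (reval phi : T -> T) w (rderiv phi w).
  by case/VP => *; exact: cder_reval.
have dphi1 w : V w -> cder (rderiv phi : T -> T) w (pull_phi2 (rnum phi) (rden phi) w).
  by case/VP => *; exact: cder_rderiv.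
have dth w : V w -> cder th w (eta w * th w).
  by move=> Vw; have [] := cder_branch Vo br Vw.
have deta w : V w -> cder (eta : T -> T) w ('D_1 (eta : T -> T) w).
  move=> Vw; have [_ nz] := cder_branch Vo br Vw.
  have [l dl] := derivable_sum_rlogderiv a nz.
  by rewrite /eta (cder_derive dl).
have VU w : V w -> U (reval phi w) by case/VP.
have D1 := cder_derive (cder_pullback sol VU dphi dth Vx).
have D2 := cder_derive (cder2_pullback Vo sol VU dphi dphi1 deta dth Vx).
have := (hg_normalized _ _ _ _ x0 x1).1 (sol2 x Vx).
rewrite D1 D2 yx y'x => eqn; apply: (mulfI th0); rewrite [LHS]eqn; ring.
Qed.

Lemma pullback_pull_identity phi E1 E2 : pullback phi E1 E2 ->
  pull_identity E1 E2 (rnum phi) (rden phi).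
Proof.
case=> deg [n [r [a [r0 pb]]]].
have W0 := rdegree_gt0_wronskian deg.
have /andP[F0 H0] := wronskian_neq0_num W0.
have G0 := rden_neq0 phi.
pose D := 'X * ('X - 1%:P) * rnum phi * rden phi * (rnum phi - rden phi)
  * wronskian (rnum phi) (rden phi) * \prod_(i < n) (rden (r i) * rnum (r i)).
have D0 : D != 0.
  rewrite /D !mulf_neq0 ?polyX_eq0 ?polyXsubC_eq0//.
  by apply/prodf_neq0 => i _; rewrite mulf_neq0// rden_neq0.
pose generic x := [/\ x != 0, x != 1, (rnum phi).[x] != 0, (rden phi).[x] != 0 &
  [/\ (rnum phi - rden phi).[x] != 0, (wronskian (rnum phi) (rden phi)).[x] != 0 &
   forall i, (rden (r i)).[x] != 0 /\ (rnum (r i)).[x] != 0]].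
have gen x : D.[x] != 0 -> generic x.
  rewrite /D !(hornerM _ _ x) horner_prod hornerX hornerXsubC !mulf_eq0 !negb_or.
  case/andP=> /andP[/andP[/andP[/andP[/andP[? h1] ?] ?] ?] ?] /prodf_neq0 h.
  split=> //; first by rewrite -subr_eq0.
  by split=> // i; have := h i isT; rewrite hornerM mulf_eq0 negb_or => /andP[].
pose eta (x : T) : T := \sum_(i < n) a i * rlogderiv (r i) x.
have key x : D.[x] != 0 -> eta x = (pull_log E1 (rnum phi) (rden phi) x - hgp E2 x) / 2 /\
   'D_1 eta x + eta x ^+ 2 - rderiv phi x ^+ 2 * hgq E1 (reval phi x)
    + hgp E2 x * eta x + hgq E2 x = 0.
  move/gen => [x0 x1 fx gx [hx wx rx]].
  have [e1 e2] := pullback_coefs pb x0 x1 gx fx hx rx; split=> //.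
  have := pull_first_order E1 fx gx hx wx; rewrite -rderivE// => fo.
  have p10 : rderiv phi x != 0 by rewrite rderivE// mulf_neq0// invr_eq0 expf_neq0.
  apply: (mulfI p10); move: e1; rewrite -/(eta x) -[_ / _]/(reval phi x) in fo *.
  set l := pull_log _ _ _ _ in fo *; set p := hgp E2 x => e1.
  have {}fo : pull_phi2 (rnum phi) (rden phi) x - rderiv phi x ^+ 2 * hgp E1 (reval phi x)
    = - rderiv phi x * l by [].
  have : 2 * (rderiv phi x * eta x) = rderiv phi x * (l - p).
    have a2E := esym (subrK (rderiv phi x ^+ 2 * hgp E1 (reval phi x))
      (pull_phi2 (rnum phi) (rden phi) x)).
    rewrite fo in a2E; rewrite a2E in e1.
    by apply/eqP; rewrite -subr_eq0; apply/eqP; rewrite -[RHS]e1; ring.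
  by move=> h; rewrite mulrA -h; field.
rewrite /pull_identity; apply/eqP; rewrite -subr_eq0; apply/eqP.
apply: (poly_eq0_of_generic D0) => x Dx; have [x0 x1 fx gx [hx wx _]] := gen x Dx.
have kx := pull_den_neq0 fx gx hx wx.
(* The formula for [eta] holds at every point near x, so it may be differentiated. *)
have deta : 'D_1 eta x = (pull_log1 E1 (rnum phi) (rden phi) x - hgp1 E2 x) / 2.
  have near_eta : \forall w \near (x : T),
      (pull_log E1 (rnum phi) (rden phi) w - hgp E2 w) / 2 = eta w.
    have := near_poly_neq0 Dx; by apply: filterS => w /key[].
  have dl := cder_pull_log E1 kx; have dp := cder_hgp E2 x0 x1.
  have d := cderM (cderD dl (cderM (cder_cst (-1 : T) (x : T)) dp)) (cder_cst (2^-1 : T) (x : T)).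
  have e (w : T) : (pull_log E1 (rnum phi) (rden phi) w + -1 * hgp E2 w) * 2^-1 =
     (pull_log E1 (rnum phi) (rden phi) w - hgp E2 w) / 2 by rewrite mulN1r.
  by rewrite (cder_derive (cder_near near_eta (cder_ext e d))); ring.
have [etaE e2] := key x Dx.
move: e2; rewrite deta etaE rderivE// [reval _ _]/reval.
rewrite (pull_identity_pointwise E1 E2 fx gx hx wx x0 x1) => /eqP.
rewrite mulf_eq0 invr_eq0 => /orP[/eqP //|].
by rewrite !mulf_eq0 (negPf x0) (negPf kx) subr_eq0 (negPf x1) pnatr_eq0.
Qed.

Definition poly_ratfun (p : {poly C}) : ratfun R :=
  @RatFun R p 1 (oner_neq0 _) (coprimep1 p).

Lemma rlogderiv_poly p x : rlogderiv (poly_ratfun p) x = p^`().[x] / p.[x].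
Proof. by rewrite /rlogderiv /= derivC horner0 mul0r subr0. Qed.

Lemma pull_identity_pullback phi E1 E2 : (0 < rdegree phi)%N ->
  pull_identity E1 E2 (rnum phi) (rden phi) -> pullback phi E1 E2.
Proof.
move=> deg idt; have W0 := rdegree_gt0_wronskian deg.
have /andP[F0 H0] := wronskian_neq0_num W0.
have G0 := rden_neq0 phi.
pose F := rnum phi; pose G := rden phi.
(* theta is the product of these polynomials to the powers [cs], which are the factors of their
   logarithmic derivatives in (N - p2) / 2. *)
pose ps : seq {poly C} := [:: F; G; F - G; wronskian F G; 'X; 'X - 1%:P].
pose cs : seq C := [:: hgC E1 / 2; hgcoo E1 / 2; hgc1 E1 / 2; - 2^-1; - hgC E2 / 2; - hgc1 E2 / 2].
split=> //; exists 6, (fun i : 'I_6 => poly_ratfun ps`_i), (fun i : 'I_6 => cs`_i); split.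
  move=> i /=; have : (i < size ps)%N by [].
  move=> ip; have := mem_nth 0 ip; rewrite !inE.
  by do ![case/orP]; move/eqP => -> //; rewrite ?polyX_eq0 ?polyXsubC_eq0.
move=> U V y th sol Vo V01 VU br.
pose eta (x : T) : T := \sum_(i < 6) cs`_i * rlogderiv (poly_ratfun ps`_i) x.
have nz x : V x -> [/\ F.[x] != 0, G.[x] != 0, (F - G).[x] != 0 & (wronskian F G).[x] != 0].
  move=> Vx; have [_ nz] := cder_branch Vo br Vx.
  have n i (hi : (i < 6)%N) : (ps`_i).[x] != 0 by have [] := nz (Ordinal hi).
  by split; [exact: (n 0%N)|exact: (n 1%N)|exact: (n 2%N)|exact: (n 3%N)].
have etaE x : V x -> eta x = (pull_log E1 F G x - hgp E2 x) / 2.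
  move=> Vx; have [fx gx hx wx] := nz x Vx; have [x0 x1] := V01 x Vx.
  have x1' : x - 1 != 0 by rewrite subr_eq0.
  rewrite /eta !big_ord_recl big_ord0 !rlogderiv_poly /=.
  rewrite derivX derivXsubC (derivB F G) hornerXsubC hornerX hornerC.
  rewrite /pull_log /pull_num /pull_den hgpE (derivB F G).
  cbv zeta; move: (wronskian F G) wx => W.
  move: hx fx gx; rewrite !(hornerD, hornerN, hornerM, hornerZ).
  move: W^`().[x] W.[x] F.[x] G.[x] => w' w f g h0 f0 g0 w0.
  by field; rewrite w0 f0 g0 h0 x0 x1'.
pose eta1 (x : T) : T := (pull_log1 E1 F G x - hgp1 E2 x) / 2.
have deta x : V x -> cder eta x (eta1 x).
  move=> Vx; have [fx gx hx wx] := nz x Vx; have [x0 x1] := V01 x Vx.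
  have kx := pull_den_neq0 fx gx hx wx.
  have near_eta : \forall w \near (x : T), (pull_log E1 F G w - hgp E2 w) / 2 = eta w.
    have : nbhs (x : T) V by exact: open_nbhs_nbhs.
    by apply: filterS => w Vw; rewrite etaE.
  have dl := cder_pull_log E1 kx; have dp := cder_hgp E2 x0 x1.
  have d := cderM (cderD dl (cderM (cder_cst (-1 : T) (x : T)) dp)) (cder_cst (2^-1 : T) (x : T)).
  have e (w : T) : (pull_log E1 F G w + -1 * hgp E2 w) * 2^-1 =
     (pull_log E1 F G w - hgp E2 w) / 2 by rewrite mulN1r.
  apply: cder_eq (cder_near near_eta (cder_ext e d)) _; rewrite /eta1; ring.
have dphi x : V x -> cder (reval phi : T -> T) x (rderiv phi x).
  by move=> Vx; apply: cder_reval; case: (nz x Vx).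
have dphi1 x : V x -> cder (rderiv phi : T -> T) x (pull_phi2 F G x).
  by move=> Vx; apply: cder_rderiv; case: (nz x Vx).
have dth x : V x -> cder th x (eta x * th x).
  by move=> Vx; have [] := cder_branch Vo br Vx.
have VU' x : V x -> U (reval phi x) by case/VU.
have D1 x (Vx : V x) := cder_pullback sol VU' dphi dth Vx.
have D2 x (Vx : V x) := cder2_pullback Vo sol VU' dphi dphi1 deta dth Vx.
split=> // [x Vx|x Vx|x Vx].
- exact: cder_derivable (D1 x Vx).
- exact: cder_derivable (D2 x Vx).
have [fx gx hx wx] := nz x Vx; have [x0 x1] := V01 x Vx.
have gx' : (rden phi).[x] != 0 by [].
apply/(hg_normalized _ _ _ _ x0 x1).
rewrite (cder_derive (D1 x Vx)) (cder_derive (D2 x Vx)).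
have fo := pull_first_order E1 fx gx hx wx.
have pw := pull_identity_pointwise E1 E2 fx gx hx wx x0 x1.
rewrite idt subrr horner0 mul0r -/(eta1 x) in pw.
rewrite rderivE// -/F -/G [reval phi x]/reval -/F -/G etaE//.
set a1 := pull_phi1 F G x in fo pw *; set a2 := pull_phi2 F G x in fo *.
set p1 := hgp E1 _ in fo *; set q1 := hgq E1 _ in pw *.
set N := pull_log E1 F G x in fo pw *; set p2 := hgp E2 x in pw *; set q2 := hgq E2 x in pw *.
have -> : eta1 x = - (((N - p2) / 2) ^+ 2 - a1 ^+ 2 * q1 + p2 * ((N - p2) / 2) + q2).
  by apply/eqP; rewrite -subr_eq0; apply/eqP; rewrite -[RHS]pw; ring.
have -> : a2 = a1 ^+ 2 * p1 - a1 * N.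
  by apply/eqP; rewrite -subr_eq0; apply/eqP; move/eqP: fo; rewrite -subr_eq0 => /eqP <-; ring.
by field.
Qed.

End PullbackCriterion.

(** * Local analysis of the pulled-back equation *)

Section LocalCore.
Variable K : fieldType.
Variables (c0 c1 c2 p : K).
Implicit Types (F G H W : {poly K}).

(** The pull-back expressions with F - G and the Wronskian as independent letters, so that each of
    the four can be replaced by its own factorisation at a point. *)
Definition core_den F G H W := F * G * H * W.
Definition core_num F G H W := c0 *: (F^`() * G * H * W) + c1 *: (H^`() * F * G * W)
  + c2 *: (G^`() * F * H * W) - W^`() * F * G * H.
Definition core_lhs F G H W :=
  let M := core_num F G H W in let D := core_den F G H W in
  2 *: (M^`() * D - M * D^`()) + M ^+ 2 - p *: (F * H * W ^+ 4).

Lemma deriv_XsubC_exp (z : K) n : ('X - z%:P) * (('X - z%:P) ^+ n)^`() =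
  n%:R *: ('X - z%:P) ^+ n.
Proof.
elim: n => [|n IH]; first by rewrite expr0 derivC mulr0 scale0r.
rewrite exprS derivM derivXsubC mul1r mulrDr mulrCA IH -natr1 scalerDl scale1r.
by rewrite addrC -scalerAr.
Qed.

(* The Euler operator t d/dt acts on t^n q as n + t d/dt on q. *)
Lemma euler_mul (z : K) n (q : {poly K}) : let t := 'X - z%:P in
  t * (t ^+ n * q)^`() = t ^+ n * (n%:R *: q + t * q^`()).
Proof.
move=> t; rewrite derivM mulrDr mulrA deriv_XsubC_exp mulrDr.
by rewrite -scalerAl -scalerAr mulrCA.
Qed.

(** [nu] is the residue of N at z. Near z, 2 N' + N^2 behaves like (nu^2 - 2 nu) / t^2, and [rho]
    carries the contribution of the remaining term. *)
Lemma core_local (z : K) F G H W (a b c w s : nat) (f g h om rho : {poly K}) :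
  let t := 'X - z%:P in
  F = t ^+ a * f -> G = t ^+ b * g -> H = t ^+ c * h -> W = t ^+ w * om ->
  s = (a + b + c + w)%N -> F * H * W ^+ 4 * t ^+ 2 = t ^+ (2 * s) * rho ->
  let nu := c0 * a%:R + c1 * c%:R + c2 * b%:R - w%:R in
  let k := f.[z] * g.[z] * h.[z] * om.[z] in
  exists2 q, t ^+ 2 * core_lhs F G H W = t ^+ (2 * s) * q &
    q.[z] = (nu ^+ 2 - 2 * nu) * k ^+ 2 - p * rho.[z].
Proof.
move=> t FE GE HE WE sE rhoE nu k.
pose kap := f * g * h * om.
pose mu := c0 *: ((a%:R *: f + t * f^`()) * g * h * om)
  + c1 *: ((c%:R *: h + t * h^`()) * f * g * om)
  + c2 *: ((b%:R *: g + t * g^`()) * f * h * om)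
  - (w%:R *: om + t * om^`()) * f * g * h.
have tX n (q q' : {poly K}) : q = t ^+ n * q' -> t * q^`() = t ^+ n * (n%:R *: q' + t * q'^`()).
  by move=> ->; exact: euler_mul.
have DE : core_den F G H W = t ^+ s * kap.
  by rewrite /core_den FE GE HE WE sE /kap !exprD; ring.
have ME : t * core_num F G H W = t ^+ s * mu.
  have -> : t * core_num F G H W = c0 *: ((t * F^`()) * G * H * W)
     + c1 *: ((t * H^`()) * F * G * W) + c2 *: ((t * G^`()) * F * H * W)
     - (t * W^`()) * F * G * H.
    by rewrite /core_num -!mul_polyC; ring.
  rewrite (tX _ _ _ FE) (tX _ _ _ GE) (tX _ _ _ HE) (tX _ _ _ WE) FE GE HE WE sE /mu !exprD -!mul_polyC.
  ring.
have tz : t.[z] = 0 by rewrite hornerXsubC subrr.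
exists (2 *: (t * mu^`() * kap - mu * kap - t * mu * kap^`()) + mu ^+ 2 - p *: rho).
  have -> : t ^+ (2 * s) = t ^+ s * t ^+ s by rewrite -exprD mul2n addnn.
  rewrite mul2n -addnn exprD in rhoE.
  have tD := tX _ _ _ DE; have tM := tX _ _ _ ME.
  rewrite derivM derivXsubC mul1r in tM.
  set M := core_num F G H W in ME tM *; set D := core_den F G H W in DE tD *.
  rewrite /core_lhs -/M -/D; cbv zeta.
  have -> : t ^+ 2 * (2 *: (M^`() * D - M * D^`()) + M ^+ 2 - p *: (F * H * W ^+ 4)) =
    2%:P * ((t * (M + t * M^`()) - t * M) * D - (t * M) * (t * D^`())) + (t * M) ^+ 2
     - p%:P * (F * H * W ^+ 4 * t ^+ 2).
    by rewrite -!mul_polyC; ring.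
  rewrite tM tD ME DE rhoE -!mul_polyC.
  ring.
have muz : mu.[z] = nu * k.
  rewrite /mu !(tz, hornerD, hornerN, hornerM, hornerZ) /nu /k; ring.
have kapz : kap.[z] = k by rewrite /kap !hornerM.
by rewrite !(tz, muz, kapz, hornerD, hornerN, hornerM, hornerZ, horner_exp); ring.
Qed.

(** Behaviour at infinity relative to a prescribed degree. As [x] may be 0, the notion survives
    cancellation in sums. *)
Definition has_top n (q : {poly K}) (x : K) := (size q <= n.+1)%N /\ q`_n = x.

Lemma has_topD n q r x y : has_top n q x -> has_top n r y -> has_top n (q + r) (x + y).
Proof.
move=> [sq <-] [sr <-]; split; last by rewrite coefD.
by apply: leq_trans (size_polyD _ _) _; rewrite geq_max sq sr.
Qed.

Lemma has_topZ n q x y : has_top n q x -> has_top n (y *: q) (y * x).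
Proof.
move=> [sq <-]; split; last by rewrite coefZ.
exact: leq_trans (size_scale_leq _ _) sq.
Qed.

Lemma has_topN n q x : has_top n q x -> has_top n (- q) (- x).
Proof. by move=> [sq <-]; split; rewrite ?size_polyN ?coefN. Qed.

Lemma has_topM m n q r x y : has_top m q x -> has_top n r y ->
  has_top (m + n) (q * r) (x * y).
Proof.
move=> [sq <-] [sr <-]; split.
  apply: leq_trans (size_polyMleq _ _) _.
  by move: sq sr; case: (size q) => [|i]; case: (size r) => [|j]; lia.
rewrite coefM (bigD1 (inord m)) //= inordK ?ltnS ?leq_addr//.
rewrite addnC addnK big1 ?addr0// => i im.
have im' : (i : nat) != m by apply: contraNneq im => e; apply/eqP/val_inj; rewrite /= inordK ?ltnS ?leq_addl.
have [lt|ge] := ltnP m i.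
  by rewrite nth_default ?mul0r// (leq_trans sq).
rewrite (nth_default _ (leq_trans sr _)) ?mulr0//.
by have := ltn_ord i; lia.
Qed.

Lemma has_topX1 : has_top 1 'X (1 : K).
Proof. by split; rewrite ?size_polyX// coefX. Qed.

Lemma has_top_euler n q x : has_top n q x -> has_top n ('X * q^`()) (n%:R * x).
Proof.
move=> [sq <-]; split.
  apply/leq_sizeP => j nj; rewrite coefXM; case: j nj => // j nj.
  by rewrite coef_deriv (leq_sizeP _ _ sq)// mul0rn.
by rewrite coefXM; case: (n) => [|k]; rewrite ?mul0r//= coef_deriv mulr_natl.
Qed.

Lemma has_topX n k q x : has_top n q x -> has_top (n * k) (q ^+ k) (x ^+ k).
Proof.
move=> tq; elim: k => [|k IH].
  by rewrite muln0 !expr0; split; rewrite ?size_poly1// coef1.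
by rewrite mulnS !exprS; exact: has_topM.
Qed.

(** The residue computation at infinity: X d/dX multiplies a top coefficient by the degree, just as
    t d/dt multiplies a lowest one by the order. *)
Lemma core_infinity F G H W (a b c w s : nat) (f g h om rho : K) :
  has_top a F f -> has_top b G g -> has_top c H h -> has_top w W om ->
  s = (a + b + c + w)%N -> has_top (2 * s) (F * H * W ^+ 4 * 'X ^+ 2) rho ->
  let nu := c0 * a%:R + c1 * c%:R + c2 * b%:R - w%:R in
  let k := f * g * h * om in
  has_top s (core_den F G H W) k /\
  has_top (2 * s) ('X ^+ 2 * core_lhs F G H W) ((nu ^+ 2 - 2 * nu) * k ^+ 2 - p * rho).
Proof.
move=> tF tG tH tW sE trho nu k.
have tD : has_top s (core_den F G H W) k.
  by rewrite sE; do ![apply: has_topM].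
have tM : has_top s ('X * core_num F G H W) (nu * k).
  have -> : 'X * core_num F G H W = c0 *: (('X * F^`()) * G * H * W)
     + c1 *: (('X * H^`()) * F * G * W) + c2 *: (('X * G^`()) * F * H * W)
     - ('X * W^`()) * F * G * H.
    by rewrite /core_num -!mul_polyC; ring.
  have -> : nu * k = c0 * (a%:R * f * g * h * om) + c1 * (c%:R * h * f * g * om)
    + c2 * (b%:R * g * f * h * om) - w%:R * om * f * g * h by rewrite /nu /k; ring.
  apply: has_topD; [apply: has_topD; [apply: has_topD|]|apply: has_topN]; try apply: has_topZ.
  - by rewrite sE; do ![apply: has_topM] => //; exact: has_top_euler.
  - have -> : s = (c + a + b + w)%N by lia.
    by do ![apply: has_topM] => //; exact: has_top_euler.
  - have -> : s = (b + a + c + w)%N by lia.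
    by do ![apply: has_topM] => //; exact: has_top_euler.
  - have -> : s = (w + a + b + c)%N by lia.
    by do ![apply: has_topM] => //; exact: has_top_euler.
split=> //.
set M := core_num F G H W in tM *; set D := core_den F G H W in tD *.
rewrite /core_lhs -/M -/D; cbv zeta.
have -> : 'X ^+ 2 * (2 *: (M^`() * D - M * D^`()) + M ^+ 2 - p *: (F * H * W ^+ 4)) =
    2 *: (('X * ('X * M)^`() - 'X * M) * D - ('X * M) * ('X * D^`())) + ('X * M) * ('X * M)
     - p *: (F * H * W ^+ 4 * 'X ^+ 2).
  by rewrite derivM derivX -!mul_polyC; ring.
have -> : (nu ^+ 2 - 2 * nu) * k ^+ 2 - p * rho = 2 * ((s%:R * (nu * k) - nu * k) * k
    - (nu * k) * (s%:R * k)) + (nu * k) * (nu * k) - p * rho by ring.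
have e2 : (2 * s)%N = (s + s)%N by rewrite mul2n addnn.
apply: has_topD; last by apply: has_topN; exact: has_topZ.
rewrite e2; apply: has_topD; last exact: has_topM.
apply: has_topZ; apply: has_topD; last by apply/has_topN/has_topM => //; exact: has_top_euler.
apply: has_topM => //; apply: has_topD; last exact: has_topN.
exact: has_top_euler.
Qed.

End LocalCore.

(** Above 0 or 1 the term with the product of the parameters keeps an additional factor t^e and does
    not reach the double pole. Above infinity, in the next lemma, that factor is absent. *)
Lemma zero_order_identity (A : comNzRingType) (t f g om : A) e : (0 < e)%N ->
  t ^+ e * f * g * (t ^+ e.-1 * om) ^+ 4 * t ^+ 2 =
  t ^+ (2 * (e + e.-1)) * (t ^+ e * (f * g * om ^+ 4)).
Proof.
case: e => // n _ /=; have -> : (2 * (n.+1 + n) = n * 4 + 2)%N by lia.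
by rewrite exprMn -exprM (exprD _ (n * 4)); move: (t ^+ (n * 4)) (t ^+ n.+1) => u v; ring.
Qed.

Lemma pole_order_identity (A : comNzRingType) (t f g om : A) e : (0 < e)%N ->
  f * g * (t ^+ e.-1 * om) ^+ 4 * t ^+ 2 = t ^+ (2 * (e + e.-1)) * (f * g * om ^+ 4).
Proof.
case: e => // n _ /=; have -> : (2 * (n.+1 + n) = n * 4 + 2)%N by lia.
by rewrite exprMn -exprM (exprD _ (n * 4)); move: (t ^+ (n * 4)) => u; ring.
Qed.

Section PointTypes.
Variable R : realType.
Local Notation C := (R[i]).
Variables (E1 E2 : hgeq R) (F G : {poly C}).
Hypothesis (cFG : coprimep F G) (idt : pull_identity E1 E2 F G).
Hypothesis (W0 : wronskian F G != 0) (G0 : G != 0).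
Local Notation H := (F - G).
Local Notation W := (wronskian F G).

Definition sqexp0 (E : hgeq R) : C := (1 - hgC E) ^+ 2.
Definition sqexp1 (E : hgeq R) : C := (hgC E - hgA E - hgB E) ^+ 2.
Definition sqexpoo (E : hgeq R) : C := (hgA E - hgB E) ^+ 2.

(* Orders at a point of the numerator, of its difference with the denominator
   and of the denominator; e is the ramification index and t the square of the
   exponent difference of the transformed equation. *)
Definition point_type (t : C) (oF oH oG e : nat) : Prop := (0 < e)%N /\
  [\/ [/\ oF = e, oH = 0%N, oG = 0%N & e%:R ^+ 2 * sqexp0 E1 = t],
      [/\ oF = 0%N, oH = e, oG = 0%N & e%:R ^+ 2 * sqexp1 E1 = t],
      [/\ oF = 0%N, oH = 0%N, oG = e & e%:R ^+ 2 * sqexpoo E1 = t] |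
      [/\ oF = 0%N, oH = 0%N, oG = 0%N & e%:R ^+ 2 = t]].

(** A regular point has exponents 0 and 1, hence difference 1. *)
Definition target (z : C) : C := if z == 0 then sqexp0 E2 else if z == 1 then sqexp1 E2 else 1.

Lemma mu_factor (p : {poly C}) z : p != 0 ->
  exists2 q, p = ('X - z%:P) ^+ (\mu_z p) * q & q.[z] != 0.
Proof. by case/(mu_spec z) => q rq pE; exists q; [rewrite mulrC|]. Qed.

Lemma mu_unique (p q : {poly C}) z n : p = ('X - z%:P) ^+ n * q -> q.[z] != 0 -> \mu_z p = n.
Proof.
move=> pE qz; have q0 : q != 0 by apply: contraNneq qz => ->; rewrite horner0.
rewrite pE mu_mul ?mulf_neq0 ?expf_neq0 ?polyXsubC_eq0//.
by rewrite mu_exp mu_XsubC mul1n (@muNroot _ q) ?addn0// rootE.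
Qed.

Lemma local_equation z (a b c w s : nat) (f g h om rho : {poly C}) :
  let t := 'X - z%:P in
  F = t ^+ a * f -> G = t ^+ b * g -> H = t ^+ c * h -> W = t ^+ w * om ->
  s = (a + b + c + w)%N -> F * H * W ^+ 4 * t ^+ 2 = t ^+ (2 * s) * rho ->
  let nu := hgC E1 * a%:R + hgc1 E1 * c%:R + hgcoo E1 * b%:R - w%:R in
  let k := f.[z] * g.[z] * h.[z] * om.[z] in
  (nu ^+ 2 - 2 * nu) * k ^+ 2 - 4 * (hgA E1 * hgB E1) * rho.[z] = k ^+ 2 * (target z - 1).
Proof.
move=> t FE GE HE WE sE rhoE nu k.
have [q qE <-] := core_local (hgC E1) (hgc1 E1) (hgcoo E1) (4 * (hgA E1 * hgB E1))
  FE GE HE WE sE rhoE.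
have t0 n : t ^+ n != 0 by rewrite expf_neq0 ?polyXsubC_eq0.
pose kap := f * g * h * om.
have DE : pull_den F G = t ^+ s * kap.
  rewrite /pull_den; move: WE HE; move: (wronskian F G) (F - G) => W1 H1 WE HE.
  by rewrite FE GE HE WE sE /kap !exprD; ring.
have kz : kap.[z] = k by rewrite /kap !hornerM.
have idt2 : 'X ^+ 2 * ('X - 1%:P) ^+ 2 * q = t ^+ 2 * kap ^+ 2 * pull_rhs E2.
  apply: (mulfI (t0 (2 * s)%N)).
  have -> : t ^+ (2 * s) * ('X ^+ 2 * ('X - 1%:P) ^+ 2 * q) =
    'X ^+ 2 * ('X - 1%:P) ^+ 2 * (t ^+ (2 * s) * q) by ring.
  rewrite -[t ^+ (2 * s) * q]qE.
  have -> : t ^+ (2 * s) * (t ^+ 2 * kap ^+ 2 * pull_rhs E2) =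
     t ^+ 2 * (pull_den F G ^+ 2 * pull_rhs E2).
    by rewrite DE mul2n -addnn exprD; ring.
  rewrite -[pull_den F G ^+ 2 * _]idt; set A := 'X ^+ 2 * _; rewrite mulrCA; congr (_ * _).
have hz := congr1 (horner^~ z) idt2.
(* At 0 and 1 the factor t^2 cancels against X^2 or (X - 1)^2 before evaluation. Elsewhere it
   remains and makes [q] vanish at z. *)
rewrite /target; have [z0|z0] := eqVneq z 0; [|have [z1|z1] := eqVneq z 1].
- have X0 : ('X : {poly C}) ^+ 2 != 0 by rewrite expf_neq0 ?polyX_eq0.
  have e : ('X - 1%:P) ^+ 2 * q = kap ^+ 2 * pull_rhs E2.
    apply: (mulfI X0); rewrite mulrA [LHS]idt2 /t z0 subr0; ring.
  have := congr1 (horner^~ z) e.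
  rewrite /= !(kz, hornerM, horner_exp).
  rewrite /pull_rhs !(hornerD, hornerN, hornerM, hornerZ, horner_exp, hornerX, hornerC) z0 /sqexp0.
  move=> /eqP; rewrite -subr_eq0 => /eqP E.
  by apply/eqP; rewrite -subr_eq0; apply/eqP; rewrite -[RHS]E; ring.
- have X0 : ('X - 1%:P : {poly C}) ^+ 2 != 0 by rewrite expf_neq0 ?polyXsubC_eq0.
  have e : 'X ^+ 2 * q = kap ^+ 2 * pull_rhs E2.
    apply: (mulfI X0); rewrite mulrA (mulrC (('X - 1%:P) ^+ 2)) [LHS]idt2 /t z1; ring.
  have := congr1 (horner^~ z) e.
  rewrite /= !(kz, hornerM, horner_exp).
  rewrite /pull_rhs !(hornerD, hornerN, hornerM, hornerZ, horner_exp, hornerX, hornerC) z1 /sqexp1 /hgc1.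
  move=> /eqP; rewrite -subr_eq0 => /eqP E.
  by apply/eqP; rewrite -subr_eq0; apply/eqP; rewrite -[RHS]E; ring.
- move: hz; rewrite /= !(hornerM, horner_exp, hornerXsubC) hornerX subrr !(expr0n, mul0r, mulr0) /=.
  move=> /eqP; rewrite !mulf_eq0 (negPf z0) subr_eq0 (negPf z1) /= => /eqP ->.
  by rewrite subrr mulr0.
Qed.

Lemma wronskian_order (P Q : {poly C}) z e f : (0 < e)%N -> P = ('X - z%:P) ^+ e * f ->
  exists2 om, wronskian P Q = ('X - z%:P) ^+ e.-1 * om & om.[z] = e%:R * f.[z] * Q.[z].
Proof.
move=> e0 PE; set t := 'X - z%:P in PE *.
exists (e%:R *: f * Q + t * (f^`() * Q - f * Q^`())); last first.
  by rewrite hornerD (hornerM t) hornerXsubC subrr mul0r addr0 hornerM hornerZ.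
have t0 : t != 0 by rewrite polyXsubC_eq0.
apply: (mulfI t0); rewrite mulrA -exprS prednK//.
have -> : t * wronskian P Q = (t * P^`()) * Q - P * (t * Q^`()) by rewrite /wronskian; ring.
by rewrite {1}PE euler_mul PE -/t -!mul_polyC; ring.
Qed.

Lemma horner_XsubC_exp (z : C) (q : {poly C}) e : (0 < e)%N ->
  (('X - z%:P) ^+ e * q).[z] = 0.
Proof.
by move=> e0; rewrite hornerM horner_exp hornerXsubC subrr expr0n eqn0Ngt e0 mul0r.
Qed.

Lemma pred_natr e : (0 < e)%N -> e.-1%:R = e%:R - 1 :> C.
Proof. by case: e => // n _; rewrite -natr1 addrK. Qed.

Lemma nonroot_coprime z : F.[z] = 0 -> G.[z] != 0.
Proof. by move=> /eqP Fz; exact: (coprimep_root cFG Fz). Qed.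

Lemma square_completion (nu k S : C) : k != 0 -> (nu ^+ 2 - 2 * nu) * k ^+ 2 = k ^+ 2 * (S - 1) ->
  (nu - 1) ^+ 2 = S.
Proof.
move=> k0; rewrite mulrC => e0; have e := mulfI (expf_neq0 2 k0) e0.
by rewrite sqrrB1 -[RHS](subrK 1) -e; ring.
Qed.

(** At order e above 0 the residue is nu = C e - (e - 1), so nu - 1 = - e (1 - C): ramification
    multiplies the exponent difference by e. The same holds above 1. Above infinity nu - 1 = - e (A
    + B), and the extra term - 4 A B e^2 turns the square into e^2 (A - B)^2. *)
Lemma finite_type z : point_type (target z) (\mu_z F) (\mu_z H) (\mu_z G) (\mu_z W).+1.
Proof.
have /andP[F0 H0] := wronskian_neq0_num W0.
have root0 (p : {poly C}) : p.[z] != 0 -> \mu_z p = 0%N by move=> pz; exact: muNroot.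
have tr (p : {poly C}) : p = ('X - z%:P) ^+ 0 * p by rewrite expr0 mul1r.
have mupos (p : {poly C}) : p != 0 -> p.[z] = 0 -> (0 < \mu_z p)%N.
  by move=> p0 pz; rewrite mu_gt0// rootE pz.
split=> //; have [Fz|Fz] := eqVneq F.[z] 0.
  have Gz := nonroot_coprime Fz.
  have Hz : H.[z] != 0 by rewrite hornerD hornerN Fz sub0r oppr_eq0.
  have e0 := mupos _ F0 Fz; have [f fE fz] := mu_factor z F0.
  have [om WE omz] := wronskian_order G e0 fE.
  have omz0 : om.[z] != 0 by rewrite omz !mulf_neq0// pnatr_eq0 -lt0n.
  have eE : (\mu_z W).+1 = \mu_z F by rewrite (mu_unique WE omz0) prednK.
  rewrite eE; apply: Or41; rewrite (root0 _ Gz) (root0 _ Hz); split=> //.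
  set e := \mu_z F in e0 fE WE eE *.
  have rhoE : F * H * W ^+ 4 * ('X - z%:P) ^+ 2 =
      ('X - z%:P) ^+ (2 * (e + e.-1)) * (('X - z%:P) ^+ e * (f * H * om ^+ 4)).
    by rewrite WE {1}fE; exact: zero_order_identity.
  have sE : (e + e.-1 = e + 0 + 0 + e.-1)%N by rewrite !addn0.
  have := local_equation fE (tr _) (tr _) WE sE rhoE.
  rewrite (horner_XsubC_exp _ _ e0) [4 * _ * 0]mulr0; cbv zeta; rewrite ?(subr0 (_ * _ ^+ 2)).
  move=> /square_completion <-; last by rewrite !mulf_neq0.
  rewrite /sqexp0 (pred_natr e0); ring.
have [Gz|Gz] := eqVneq G.[z] 0.
  have Hz : H.[z] != 0 by rewrite hornerD hornerN Gz subr0.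
  have e0 := mupos _ G0 Gz; have [g gE gz] := mu_factor z G0.
  have [om WE0 omz0] := wronskian_order F e0 gE.
  have WE : W = ('X - z%:P) ^+ (\mu_z G).-1 * (- om).
    by rewrite mulrN -WE0 /wronskian; ring.
  have {omz0} omz : (- om).[z] = - ((\mu_z G)%:R * g.[z] * F.[z]) by rewrite hornerN omz0.
  move: (- om) WE omz => {WE0}om WE omz.
  have omz0 : om.[z] != 0 by rewrite omz oppr_eq0 !mulf_neq0// pnatr_eq0 -lt0n.
  have eE : (\mu_z W).+1 = \mu_z G by rewrite (mu_unique WE omz0) prednK.
  rewrite eE; apply: Or43; rewrite (root0 _ Fz) (root0 _ Hz); split=> //.
  set e := \mu_z G in e0 gE WE eE omz *.
  have rhoE : F * H * W ^+ 4 * ('X - z%:P) ^+ 2 =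
      ('X - z%:P) ^+ (2 * (e + e.-1)) * (F * H * om ^+ 4).
    by rewrite WE; exact: pole_order_identity.
  have sE : (e + e.-1 = 0 + e + 0 + e.-1)%N by rewrite !addn0.
  have := local_equation (tr _) gE (tr _) WE sE rhoE.
  set k := F.[z] * _ * _ * _.
  have k0 : k != 0 by rewrite !mulf_neq0.
  have -> : (F * H * om ^+ 4).[z] = e%:R ^+ 2 * k ^+ 2.
    have HFz : H.[z] = F.[z] by rewrite hornerD hornerN Gz subr0.
    by rewrite /k !(HFz, omz, hornerM, horner_exp); ring.
  cbv zeta => E0; pose nu := hgcoo E1 * e%:R - e.-1%:R.
  have E : nu ^+ 2 - 2 * nu - 4 * (hgA E1 * hgB E1) * e%:R ^+ 2 = target z - 1.
    by apply: (mulfI (expf_neq0 2 k0)); rewrite -E0 /nu; ring.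
  rewrite -[RHS](subrK 1) -E /nu /sqexpoo /hgcoo.
  rewrite (pred_natr e0); ring.
have [Hz|Hz] := eqVneq H.[z] 0.
  have e0 := mupos _ H0 Hz; have [h hE hz] := mu_factor z H0.
  have [om WE omz] := wronskian_order G e0 hE; rewrite wronskianBl in WE.
  have omz0 : om.[z] != 0 by rewrite omz !mulf_neq0// pnatr_eq0 -lt0n.
  have eE : (\mu_z W).+1 = \mu_z H by rewrite (mu_unique WE omz0) prednK.
  rewrite eE; apply: Or42; rewrite (root0 _ Gz) (root0 _ Fz); split=> //.
  set e := \mu_z H in e0 hE WE eE *.
  have rhoE : F * H * W ^+ 4 * ('X - z%:P) ^+ 2 =
      ('X - z%:P) ^+ (2 * (e + e.-1)) * (('X - z%:P) ^+ e * (h * F * om ^+ 4)).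
    by rewrite WE (mulrC F) {1}hE; exact: zero_order_identity.
  have sE : (e + e.-1 = 0 + 0 + e + e.-1)%N by [].
  have := local_equation (tr _) (tr _) hE WE sE rhoE.
  rewrite (horner_XsubC_exp _ _ e0) [4 * _ * 0]mulr0; cbv zeta; rewrite ?(subr0 (_ * _ ^+ 2)).
  move=> /square_completion <-; last by rewrite !mulf_neq0.
  rewrite /sqexp1 /hgc1 (pred_natr e0); ring.
apply: Or44; rewrite (root0 _ Fz) (root0 _ Gz) (root0 _ Hz); split=> //.
have [om WE omz] := mu_factor z W0; set w := \mu_z W in WE *.
have rhoE : F * H * W ^+ 4 * ('X - z%:P) ^+ 2 =
    ('X - z%:P) ^+ (2 * w) * (('X - z%:P) ^+ (2 * w + 2) * (F * H * om ^+ 4)).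
  rewrite WE; move: (F - G) => H'; rewrite exprMn -exprM.
  have -> : (w * 4 = 2 * w + 2 * w)%N by rewrite -mulnDl mulnC.
  by rewrite !(exprD _ (2 * w)); move: (('X - z%:P) ^+ (2 * w)) => u; ring.
have sE : (w = 0 + 0 + 0 + w)%N by [].
have := local_equation (tr _) (tr _) (tr _) WE sE rhoE.
rewrite horner_XsubC_exp ?addn2// [4 * _ * 0]mulr0; cbv zeta; rewrite ?(subr0 (_ * _ ^+ 2)).
move=> /square_completion <-; last by rewrite !mulf_neq0.
by rewrite -natr1; ring.
Qed.

Lemma has_top_inj n (q : {poly C}) x y : has_top n q x -> has_top n q y -> x = y.
Proof. by move=> [_ <-] [_ <-]. Qed.

Lemma has_top_deg (q : {poly C}) : has_top (size q).-1 q (lead_coef q).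
Proof. by split=> //; case: (size q). Qed.

Lemma has_top_size n (q : {poly C}) x : has_top n q x -> x != 0 -> (size q).-1 = n.
Proof.
move=> [sq qx] x0; suff -> : size q = n.+1 by [].
apply/eqP; rewrite eqn_leq sq ltnNge; apply: contra x0 => qn.
by rewrite -qx nth_default.
Qed.

Lemma has_top_lt n m (q : {poly C}) x : (n < m)%N -> has_top n q x -> has_top m q 0.
Proof.
move=> nm [sq _]; split; last by rewrite nth_default// (leq_trans sq).
by rewrite (leq_trans sq)// ltnS ltnW.
Qed.

Lemma has_top_Xcancel n (q : {poly C}) x : has_top n.+1 ('X * q) x -> has_top n q x.
Proof.
move=> [sq qx]; rewrite coefXM in qx; split=> //.
have [->|q0] := eqVneq q 0; first by rewrite size_poly0.
by move: sq; rewrite mulrC size_mulX.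
Qed.

Lemma has_top_wronskian m n (P Q : {poly C}) x y : has_top m P x -> has_top n Q y ->
  (0 < m + n)%N -> has_top (m + n).-1 (wronskian P Q) ((m%:R - n%:R) * x * y).
Proof.
move=> tP tQ mn0; apply: has_top_Xcancel; rewrite prednK//.
have -> : 'X * wronskian P Q = ('X * P^`()) * Q - P * ('X * Q^`()) by rewrite /wronskian; ring.
have -> : (m%:R - n%:R) * x * y = (m%:R * x) * y - x * (n%:R * y) by ring.
by apply: has_topD; [|apply: has_topN]; apply: has_topM => //; exact: has_top_euler.
Qed.

Lemma infinity_equation (a b c w s : nat) (f g h om rho : C) :
  has_top a F f -> has_top b G g -> has_top c H h -> has_top w W om ->
  s = (a + b + c + w)%N -> has_top (2 * s) (F * H * W ^+ 4 * 'X ^+ 2) rho ->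
  let nu := hgC E1 * a%:R + hgc1 E1 * c%:R + hgcoo E1 * b%:R - w%:R in
  let k := f * g * h * om in
  (nu ^+ 2 - 2 * nu) * k ^+ 2 - 4 * (hgA E1 * hgB E1) * rho = k ^+ 2 * (sqexpoo E2 - 1).
Proof.
move=> tF tG tH tW sE trho nu k.
have [tD tL] := core_infinity (hgC E1) (hgc1 E1) (hgcoo E1) (4 * (hgA E1 * hgB E1))
  tF tG tH tW sE trho.
have tX1 : has_top 1 ('X - 1%:P : {poly C}) 1.
  by rewrite -[X in has_top _ _ X]subr0; apply: has_topD; [exact: has_topX1|];
    split; rewrite ?size_polyN ?size_polyC ?coefN ?coefC ?oppr0//; case: eqP.
have tR : has_top 2 (pull_rhs E2) (sqexpoo E2 - 1).
  have -> : sqexpoo E2 - 1 = (hgC E2 ^+ 2 - 2 * hgC E2) * 1 ^+ 2 + (hgc1 E2 ^+ 2 - 2 * hgc1 E2) * 1 ^+ 2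
      + (2 * hgC E2 * hgc1 E2 - 4 * (hgA E2 * hgB E2)) * (1 * 1).
    by rewrite /sqexpoo /hgc1; ring.
  apply: has_topD; [apply: has_topD|]; apply: has_topZ.
  - exact: (has_topX 2 tX1).
  - exact: (has_topX 2 (has_topX1 _)).
  - exact: (has_topM (has_topX1 _) tX1).
have t1 := has_topM (has_topX 2 tX1) tL.
have t2 := has_topM (has_topX 2 tD) tR.
have e : ('X - 1%:P) ^+ 2 * ('X ^+ 2 * core_lhs (hgC E1) (hgc1 E1) (hgcoo E1)
   (4 * (hgA E1 * hgB E1)) F G H W) = core_den F G H W ^+ 2 * pull_rhs E2.
  by rewrite [LHS]mulrA [X in X * _ = _]mulrC; exact: idt.
rewrite e in t1; have e2 : (1 * 2 + 2 * s = s * 2 + 2)%N by rewrite mul1n addnC mulnC.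
by rewrite e2 in t1; have := has_top_inj t1 t2; rewrite expr1n mul1r.
Qed.

Lemma has_top_rho (a c w : nat) (f h om : C) : has_top a F f -> has_top c H h -> has_top w W om ->
  has_top (a + c + w * 4 + 2) (F * H * W ^+ 4 * 'X ^+ 2) (f * h * om ^+ 4).
Proof.
move=> tF tH tW; have -> : f * h * om ^+ 4 = f * h * om ^+ 4 * 1 ^+ 2 by rewrite expr1n mulr1.
by apply: has_topM; [apply: has_topM; [exact: has_topM|exact: has_topX]|exact: (has_topX 2 (has_topX1 _))].
Qed.

(** The index e at infinity is tied to the degree of the Wronskian by deg W + (e - 1) = 2 d - 2, so
    the Riemann-Hurwitz formula is part of the statement. Comparing the degrees of F, G and F - G
    tells which fibre contains infinity. *)
Lemma infinity_type : let d := maxn (size F).-1 (size G).-1 in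
  exists e, ((size W).-1 + e).+1 = (2 * d)%N /\
  point_type (sqexpoo E2) (d - (size F).-1) (d - (size H).-1) (d - (size G).-1) e.
Proof.
move=> d; have /andP[F0 H0] := wronskian_neq0_num W0.
have lF : lead_coef F != 0 by rewrite lead_coef_eq0.
have lG : lead_coef G != 0 by rewrite lead_coef_eq0.
have lH : lead_coef H != 0 by rewrite lead_coef_eq0.
have tF := has_top_deg F; have tG := has_top_deg G; have tH := has_top_deg H.
have tW := has_top_deg W; have lW : lead_coef W != 0 by rewrite lead_coef_eq0.
move: (lead_coef F) (lead_coef G) (lead_coef W) lF lG lW tF tG tW => f g om0 f0 g0 om0n tF tG tW.
rewrite /d; move: (size F).-1 (size G).-1 tF tG => a b tF tG {d}.
have nz (m n : nat) : m != n -> m%:R - n%:R != 0 :> C by rewrite subr_eq0 eqr_nat.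
have [ab|ba|ab] := ltngtP a b.
- have tH' : has_top b H (- g).
    by rewrite -[- g]add0r; apply: has_topD; [exact: has_top_lt ab tF|exact: has_topN].
  have dH : (size H).-1 = b by rewrite (has_top_size tH') ?oppr_eq0.
  have tW' := has_top_wronskian tF tG (leq_trans (leq_ltn_trans (leq0n _) ab) (leq_addl a b)).
  have om0' : (a%:R - b%:R) * f * g != 0 by rewrite !mulf_neq0// nz// ltn_eqF.
  rewrite (has_top_size tW' om0') dH; exists (b - a)%N; split; first by clear -ab; lia.
  have trho := has_top_rho tF tH' tW'.
  have lt : (a + b + (a + b).-1 * 4 + 2 < 2 * (a + b + b + (a + b).-1))%N by clear -ab; lia.
  have {}trho := has_top_lt lt trho.
  have := infinity_equation tF tG tH' tW' erefl trho.
  cbv zeta; rewrite [4 * _ * 0]mulr0 subr0 => /square_completion.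
  rewrite !mulf_neq0 ?oppr_eq0//; last by rewrite nz// ltn_eqF.
  move=> /(_ isT) E.
  have aE : a%:R = b%:R - (b - a)%:R :> C by rewrite natrB ?(ltnW ab)//; ring.
  split; first by rewrite subn_gt0.
  apply: Or41; rewrite subnn; split=> //; rewrite -E pred_natr ?natrD ?aE; last by clear -ab; lia.
  by rewrite /sqexp0 /hgc1 /hgcoo; ring.
- have tH' : has_top a H f.
    by rewrite -[f]addr0; apply: has_topD => //; rewrite -oppr0; apply/has_topN/(has_top_lt ba tG).
  have dH : (size H).-1 = a by rewrite (has_top_size tH').
  have tW' := has_top_wronskian tF tG (leq_trans (leq_ltn_trans (leq0n _) ba) (leq_addr b a)).
  have om0' : (a%:R - b%:R) * f * g != 0 by rewrite !mulf_neq0// nz// gtn_eqF.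
  rewrite (has_top_size tW' om0') dH; exists (a - b)%N; split; first by clear -ba; lia.
  have trho := has_top_rho tF tH' tW'.
  have sE : (a + a + (a + b).-1 * 4 + 2 = 2 * (a + b + a + (a + b).-1))%N by clear -ba; lia.
  rewrite sE in trho.
  have := infinity_equation tF tG tH' tW' erefl trho.
  cbv zeta => E0.
  have aE : b%:R = a%:R - (a - b)%:R :> C by rewrite natrB ?(ltnW ba)//; ring.
  split; first by rewrite subn_gt0.
  apply: Or43; rewrite subnn; split=> //.
  have k0 : f ^+ 3 * g ^+ 2 * (a%:R - b%:R) != 0.
    by rewrite !mulf_neq0 ?expf_neq0// nz// gtn_eqF.
  have e0 : (0 < a + b)%N by clear -ba; lia.
  rewrite (pred_natr e0) natrD in E0.
  have E : (a - b)%:R ^+ 2 * sqexpoo E1 - sqexpoo E2 = 0.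
    apply: (mulfI (expf_neq0 2 k0)); rewrite mulr0 mulrBr.
    move/eqP: E0; rewrite -subr_eq0 => /eqP <-; rewrite aE /sqexpoo /hgc1 /hgcoo; ring.
  by apply/eqP; rewrite -subr_eq0 E.
subst b.
have a0 : (0 < a)%N.
  rewrite lt0n; apply: contra W0 => /eqP a0; move: tF tG; rewrite a0 => -[sF _] [sG _].
  by rewrite /wronskian (size1_polyC sF) (size1_polyC sG) !derivC mul0r mulr0 subr0.
have sH : ((size H).-1 <= a)%N.
  have [] : has_top a H (f - g) by apply: has_topD => //; exact: has_topN.
  by case: (size H).
have {}tH := tH.
move: (lead_coef H) lH tH sH; move: (size H).-1 => c h h0 tH.
rewrite leq_eqVlt => /orP[/eqP ca|ca].
  subst c; move: tW; move: (size W).-1 => w tW.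
  have [sW] := has_top_wronskian tF tG (leq_trans a0 (leq_addr a a)).
  rewrite subrr !mul0r => Wn.
  (* For equal degrees the leading terms of F' G and F G' cancel. *)
  have ws : (w < (a + a).-1)%N.
    rewrite ltnNge; apply: contra om0n => ge; case: tW => _ <-.
    have [->|lt] := eqVneq w (a + a).-1; first by rewrite Wn.
    by rewrite nth_default// (leq_trans sW)// ltn_neqAle eq_sym lt.
  exists (2 * a - w).-1; split; first by clear -ws a0; lia.
  have trho := has_top_rho tF tH tW.
  have lt : (a + a + w * 4 + 2 < 2 * (a + a + a + w))%N by clear -ws a0; lia.
  have {}trho := has_top_lt lt trho.
  have := infinity_equation tF tG tH tW erefl trho.
  cbv zeta; rewrite [4 * _ * 0]mulr0 subr0 => /square_completion.
  rewrite !mulf_neq0// => /(_ isT) E.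
  split; first by clear -ws a0; lia.
  apply: Or44; rewrite subnn; split=> //; rewrite -E pred_natr; last by clear -ws a0; lia.
  by rewrite natrB ?natrM /hgc1 /hgcoo; [ring|clear -ws a0; lia].
have fg : f = g.
  apply/eqP; rewrite -subr_eq0; apply/eqP; have [_ <-] : has_top a H (f - g).
    by apply: has_topD => //; exact: has_topN.
  by case: tH => sH _; rewrite nth_default// (leq_trans sH).
subst g.
have := has_top_wronskian tH tG (leq_trans a0 (leq_addl c a)); rewrite wronskianBl => tW'.
have om0' : (c%:R - a%:R) * h * f != 0 by rewrite !mulf_neq0// nz// ltn_eqF.
rewrite (has_top_size tW' om0'); exists (a - c)%N; split; first by clear -ca a0; lia.
have trho := has_top_rho tF tH tW'.
have lt : (a + c + (c + a).-1 * 4 + 2 < 2 * (a + a + c + (c + a).-1))%N by clear -ca a0; lia.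
have {}trho := has_top_lt lt trho.
have := infinity_equation tF tG tH tW' erefl trho.
cbv zeta; rewrite [4 * _ * 0]mulr0 subr0 => /square_completion.
rewrite !mulf_neq0//; last by rewrite nz// ltn_eqF.
move=> /(_ isT) E.
have aE : c%:R = a%:R - (a - c)%:R :> C by rewrite natrB ?(ltnW ca)//; ring.
split; first by rewrite subn_gt0.
apply: Or42; rewrite subnn; split=> //; rewrite -E pred_natr ?natrD ?aE; last by clear -ca a0; lia.
by rewrite /sqexp1 /hgc1 /hgcoo; ring.
Qed.

End PointTypes.

(** * Coverings as families of fibres *)

Section Cover.
Variable K : fieldType.

(* None is the point at infinity; pform p is a linear form vanishing at p. *)
Definition pform (p : option K) (x y : K) : K := if p is Some z then x - z * y else y.

(* A fibre of a covering of the line: the points of fspec have their own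
   ramification indices, those of fpts all have index fk, and fc is the leading
   coefficient of the corresponding form. *)
Record fibre := Fibre {
  fk : nat; fc : K; fspec : seq (option K * nat); fpts : seq (option K) }.

Definition fibre_tuple f := (fk f, fc f, fspec f, fpts f).
Lemma fibre_tupleK :
  cancel fibre_tuple (fun t => let: (k, c, s, q) := t in Fibre k c s q).
Proof. by case. Qed.
HB.instance Definition _ := Equality.copy fibre (can_type fibre_tupleK).

Definition fval f x y : K := fc f * \prod_(s <- fspec f) pform s.1 x y ^+ s.2
  * (\prod_(q <- fpts f) pform q x y) ^+ fk f.
Definition fpoints f := [seq s.1 | s <- fspec f] ++ fpts f.
Definition fdeg f := (sumn [seq s.2 | s <- fspec f] + fk f * size (fpts f))%N.

(** A vanishing sum of forms is symmetric in the fibres and in their points, so both can be permuted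
    and any three points can be used as coordinates. [cover_size] and [cover_hurwitz] record the
    outcome of the count: three special points and d - 1 ordinary ones. *)
Record fcover (d : nat) (fs : seq fibre) : Prop := FCover {
  cover_sum : forall x y, \sum_(f <- fs) fval f x y = 0;
  cover_lead : all (fun f => fc f != 0) fs;
  cover_uniq : uniq (flatten [seq fpoints f | f <- fs]);
  cover_deg : all (fun f => fdeg f == d) fs;
  cover_pos : all (fun f => all (fun s => 0 < s.2)%N (fspec f)) fs;
  cover_size : size (flatten [seq fspec f | f <- fs]) = 3;
  cover_hurwitz : (sumn [seq size (fpts f) | f <- fs]).+1 = d }.

Lemma fcover_perm d fs fs' : perm_eq fs fs' -> fcover d fs -> fcover d fs'.
Proof.
move=> pe [h1 h2 h3 h4 h5 h6 h7]; split.
- by move=> x y; rewrite -(perm_big _ pe).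
- by rewrite -(perm_all _ pe).
- by rewrite -(perm_uniq (perm_flatten (perm_map _ pe))).
- by rewrite -(perm_all _ pe).
- by rewrite -(perm_all _ pe).
- by rewrite -(perm_size (perm_flatten (perm_map _ pe))).
- by rewrite -h7 !sumnE -(perm_big _ (perm_map (fun f => size (fpts f)) pe)).
Qed.

Lemma mu_prod_XsubC (r : seq K) z : \mu_z (\prod_(w <- r) ('X - w%:P)) = count_mem z r.
Proof.
elim: r => [|w r IH]; first by rewrite big_nil muNroot// rootE hornerC oner_neq0.
rewrite big_cons mu_mul ?mulf_neq0 ?polyXsubC_eq0 ?monic_neq0 ?monic_prod_XsubC//.
rewrite IH /=; congr (_ + _)%N; have [->|wz] := eqVneq w z; first by rewrite mu_XsubC.
by rewrite muNroot// root_XsubC eq_sym.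
Qed.

End Cover.

(** [S] may contain points that are not roots; this allows 0 and 1 to be listed in all cases. *)
Lemma closed_factor (K : closedFieldType) (P : {poly K}) (S : seq K) : P != 0 ->
  uniq S -> (forall z, root P z -> z \in S) ->
  P = lead_coef P *: \prod_(z <- S) ('X - z%:P) ^+ (\mu_z P) /\
  (size P).-1 = (\sum_(z <- S) \mu_z P)%N.
Proof.
move=> P0 uS rS; have [r rE] := closed_field_poly_normal P.
have l0 : lead_coef P != 0 by rewrite lead_coef_eq0.
have muE z : \mu_z P = count_mem z r by rewrite rE mu_mulC// mu_prod_XsubC.
have rootr z : root P z = (z \in r) by rewrite rE rootZ// root_prod_XsubC.
have prodE : \prod_(z <- S) ('X - z%:P) ^+ (\mu_z P) = \prod_(z <- r) ('X - z%:P) :> {poly K}.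
  rewrite -[RHS](prodr_undup_exp_count r xpredT (fun z => 'X - z%:P)).

  rewrite (bigID (mem r)) /= [X in _ * X]big1 ?mulr1; last first.
    by move=> z zr; rewrite muE (count_memPn zr).
  rewrite -big_filter; under eq_bigr do rewrite muE.
  apply: perm_big; apply: uniq_perm; rewrite ?filter_uniq ?undup_uniq// => z.
  rewrite mem_filter mem_undup andb_idr// => zr; by apply: rS; rewrite rootr.
split; first by rewrite prodE.
rewrite [in LHS]rE size_scale// -prodE size_prod_seq; last first.
  by move=> z _; rewrite expf_neq0// polyXsubC_eq0.
under eq_bigr do rewrite size_exp_XsubC.
have -> : (\sum_(z <- S) (\mu_z P).+1 = \sum_(z <- S) \mu_z P + size S)%N.
  by under eq_bigr do rewrite -addn1; rewrite big_split /= sum1_size.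
by rewrite -addSn addnK.
Qed.

Section FibreOf.
Variable K : closedFieldType.
Implicit Types (P : {poly K}).

Definition plain_roots P : seq K :=
  undup [seq z <- sval (closed_field_poly_normal P) | (z != 0) && (z != 1)].

Lemma mem_plain_roots P z : P != 0 ->
  (z \in plain_roots P) = [&& root P z, z != 0 & z != 1].
Proof.
move=> P0; rewrite /plain_roots; case: closed_field_poly_normal => r rE /=.
by rewrite mem_undup mem_filter rE rootZ ?lead_coef_eq0// root_prod_XsubC andbC.
Qed.

(** [c] is the sign of P in the relation F - (F - G) - G = 0. Entries of order 0 are filtered out
    because a fibre lists its own points only. *)
Definition fibre_of (k d : nat) (c : K) P := Fibre k (c * lead_coef P)
  [seq s <- [:: (Some (0 : K), \mu_0 P); (Some 1, \mu_1 P); (None, d - (size P).-1)%N] | (0 < s.2)%N]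
  [seq Some z | z <- plain_roots P].

Lemma plain_uniq P : uniq [:: 0, 1 & plain_roots P].
Proof.
rewrite /= !inE negb_or (eq_sym 0) oner_eq0 /plain_roots undup_uniq andbT !mem_undup !mem_filter.
by rewrite !eqxx /= andbF.
Qed.

Lemma plain_factor P k : P != 0 -> (forall z, z \in plain_roots P -> \mu_z P = k) ->
  P = lead_coef P *: ('X ^+ (\mu_0 P) * ('X - 1%:P) ^+ (\mu_1 P)
      * (\prod_(z <- plain_roots P) ('X - z%:P)) ^+ k) /\
  (size P).-1 = (\mu_0 P + \mu_1 P + k * size (plain_roots P))%N.
Proof.
move=> P0 mk; have [|PE sE] := closed_factor P0 (plain_uniq P).
  move=> z rz; rewrite !inE mem_plain_roots// rz /=.
  by case: (z == 0); case: (z == 1).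
split; rewrite ?sE; last first.
  rewrite !big_cons addnA; congr (_ + _)%N; rewrite (eq_big_seq (fun=> k)) ?big_const_seq//.
  by rewrite count_predT iter_addn_0.
rewrite [LHS]PE !big_cons subr0 mulrA -prodrXl; congr (_ *: (_ * _)).
by apply: eq_big_seq => z /mk ->.
Qed.

Lemma fibre_of_deg k d c P : P != 0 -> ((size P).-1 <= d)%N ->
  (forall z, z \in plain_roots P -> \mu_z P = k) -> fdeg (fibre_of k d c P) = d.
Proof.
move=> P0 Pd mk; have [_ sE] := plain_factor P0 mk.
rewrite /fdeg /= size_map.
have -> : sumn [seq s.2 | s <- [seq s <- [:: (Some (0 : K), \mu_0 P); (Some 1, \mu_1 P);
    (None, d - (size P).-1)%N] | (0 < s.2)%N]] = (\mu_0 P + \mu_1 P + (d - (size P).-1))%N.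
  by rewrite /=; do 3![case: (posnP) => ?] => /=; lia.
by rewrite addnAC -sE subnKC.
Qed.

Lemma fibre_of_val k d c P x y : P != 0 -> ((size P).-1 <= d)%N ->
  (forall z, z \in plain_roots P -> \mu_z P = k) -> y != 0 ->
  fval (fibre_of k d c P) x y = c * (y ^+ d * P.[x / y]).
Proof.
move=> P0 Pd mk y0; have [PE sE] := plain_factor P0 mk.
rewrite [P in P.[_]]PE /fval /=.
have -> : \prod_(s <- [seq s <- [:: (Some (0 : K), \mu_0 P); (Some 1, \mu_1 P);
    (None, d - (size P).-1)%N] | (0 < s.2)%N]) pform s.1 x y ^+ s.2 =
  x ^+ \mu_0 P * (x - y) ^+ \mu_1 P * y ^+ (d - (size P).-1).
  rewrite big_filter big_mkcond !big_cons big_nil /= mul0r subr0 mul1r mulr1 mulrA.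
  by congr (_ * _ * _); case: posnP => [->|//]; rewrite expr0.
rewrite big_map.
have lin z : y * (x / y - z) = x - z * y by field.
rewrite !(hornerZ, hornerM, horner_exp, hornerX, hornerXsubC) horner_prod.
under [in RHS]eq_bigr do rewrite hornerXsubC.
under eq_bigr => z _ do rewrite /= -lin.
rewrite big_split /= big_const_seq count_predT iter_mulr_1.
have -> : x ^+ \mu_0 P = y ^+ \mu_0 P * (x / y) ^+ \mu_0 P by rewrite -exprMn mulrC divfK.
have -> : (x - y) ^+ \mu_1 P = y ^+ \mu_1 P * (x / y - 1) ^+ \mu_1 P.
  by rewrite -exprMn lin mul1r.
have -> : y ^+ d = y ^+ \mu_0 P * y ^+ \mu_1 P * (y ^+ size (plain_roots P)) ^+ k * y ^+ (d - (size P).-1).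
  by rewrite -exprM -!exprD mulnC -sE subnKC.
rewrite [X in _ * X = _]exprMn; ring.
Qed.

End FibreOf.

Section SpecialPoints.
Variables (K : fieldType) (T : eqType) (P0 P1 P2 : T) (q0 q1 q2 : K).

Definition positive_spec (a b c : nat) : seq (T * nat) :=
  [seq s <- [:: (P0, a); (P1, b); (P2, c)] | (0 < s.2)%N].

Definition in_fibre (t : K) (a b c e : nat) : Prop :=
  [\/ [/\ a = e.+1, b = 0%N, c = 0%N & e.+1%:R ^+ 2 * q0 = t],
      [/\ a = 0%N, b = e.+1, c = 0%N & e.+1%:R ^+ 2 * q1 = t] |
      [/\ a = 0%N, b = 0%N, c = e.+1 & e.+1%:R ^+ 2 * q2 = t]].

Lemma special_points (LF LH LG : seq T) (t0 t1 t2 : K) a0 b0 c0 a1 b1 c1 a2 b2 c2 u0 u1 u2 :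
  in_fibre t0 a0 b0 c0 u0 -> in_fibre t1 a1 b1 c1 u1 -> in_fibre t2 a2 b2 c2 u2 ->
  let sF := positive_spec a0 a1 a2 in
  let sH := positive_spec b0 b1 b2 in
  let sG := positive_spec c0 c1 c2 in
  [/\ perm_eq ([seq s.1 | s <- sF] ++ LF ++ [seq s.1 | s <- sH] ++ LH ++ [seq s.1 | s <- sG] ++ LG)
       ([:: P0; P1; P2] ++ LF ++ LH ++ LG),
     (size sF + (size sH + size sG) = 3)%N &
     perm_eq ([seq s.2%:R ^+ 2 * q0 | s <- sF] ++ [seq s.2%:R ^+ 2 * q1 | s <- sH]
       ++ [seq s.2%:R ^+ 2 * q2 | s <- sG]) [:: t0; t1; t2]].
Proof.
by case=> -[-> -> -> <-]; case=> -[-> -> -> <-]; case=> -[-> -> -> <-]; split=> //;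
  apply/permP => p; rewrite /positive_spec; do ![rewrite /= ?count_cat]; ring.
Qed.

End SpecialPoints.

Section HurwitzCount.
Local Open Scope nat_scope.
(** The three degree equations and Riemann-Hurwitz give n0 + n1 + n2 >= d - 1, with equality only if
    0, 1 and infinity all lie in the three fibres. The opposite bound n0 + n1 + n2 < d forces this
    equality. *)
Lemma hurwitz_count (d a0 b0 c0 a1 b1 c1 m0 m1 x0 x1 x2 n0 n1 n2 dF dH dG w e : nat) :
  dF <= d -> dH <= d -> dG <= d ->
  dF = a0 + a1 + (x0 + n0) -> dH = b0 + b1 + (x1 + n1) -> dG = c0 + c1 + (x2 + n2) ->
  w = m0 + m1 + (x0 + (x1 + x2)) -> (w + e).+1 = 2 * d -> n0 + n1 + n2 < d ->
  a0 + b0 + c0 <= m0.+1 -> a1 + b1 + c1 <= m1.+1 ->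
  (d - dF) + (d - dH) + (d - dG) <= e ->
  [/\ (n0 + (n1 + (n2 + 0))).+1 = d, a0 + b0 + c0 = m0.+1, a1 + b1 + c1 = m1.+1 &
    (d - dF) + (d - dH) + (d - dG) = e].
Proof. by move=> *; split; lia. Qed.
End HurwitzCount.

Section CoverOfIdentity.
Variable R : realType.
Local Notation C := (R[i]).
Variables (E1 E2 : hgeq R) (F G : {poly C}) (k0 k1 k2 : nat).
Hypothesis (cFG : coprimep F G) (idt : pull_identity E1 E2 F G).
Hypothesis (W0 : wronskian F G != 0) (G0 : G != 0).
Hypotheses (k0_gt0 : (0 < k0)%N) (k1_gt0 : (0 < k1)%N) (k2_gt0 : (0 < k2)%N).
Hypothesis hyp : (k0 * k1 + k0 * k2 + k1 * k2 < k0 * k1 * k2)%N.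
Hypotheses (e0 : sqexp0 E1 = k0%:R^-1 ^+ 2) (e1 : sqexp1 E1 = k1%:R^-1 ^+ 2)
  (e2 : sqexpoo E1 = k2%:R^-1 ^+ 2).
Local Notation H := (F - G).
Local Notation W := (wronskian F G).
Let d := maxn (size F).-1 (size G).-1.

Lemma inv_square_index (e k : nat) : (0 < k)%N -> e%:R ^+ 2 * k%:R^-1 ^+ 2 = 1 :> C -> e = k.
Proof.
move=> k_gt0; have kn : k%:R != 0 :> C by rewrite pnatr_eq0 -lt0n.
rewrite -exprMn => /(congr1 ( *%R^~ (k%:R ^+ 2))); rewrite -exprMn divfK// mul1r -!natrX.
by move/eqP; rewrite eqr_nat eqn_exp2r// => /eqP.
Qed.

Lemma square_nat1 (e : nat) : e%:R ^+ 2 = 1 :> C -> e = 1%N.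
Proof. by rewrite -natrX => /eqP; rewrite pnatr_eq1 -(exp1n 2) eqn_exp2r// => /eqP. Qed.

Lemma plain_type z : z != 0 -> z != 1 ->
  [\/ [/\ \mu_z F = k0, \mu_z H = 0%N, \mu_z G = 0%N & (\mu_z W).+1 = k0],
      [/\ \mu_z F = 0%N, \mu_z H = k1, \mu_z G = 0%N & (\mu_z W).+1 = k1],
      [/\ \mu_z F = 0%N, \mu_z H = 0%N, \mu_z G = k2 & (\mu_z W).+1 = k2] |
      [/\ \mu_z F = 0%N, \mu_z H = 0%N, \mu_z G = 0%N & \mu_z W = 0%N]].
Proof.
move=> z0 z1; have [_] := finite_type cFG idt W0 G0 z.
rewrite /target (negPf z0) (negPf z1) e0 e1 e2.
by case=> -[-> -> ->] E; [apply: Or41|apply: Or42|apply: Or43|apply: Or44];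
  rewrite ?(inv_square_index _ E)//; split=> //; have [] := square_nat1 E.
Qed.

Lemma mem_plain z (P : {poly C}) : P != 0 -> z \in plain_roots P ->
  [/\ z != 0, z != 1 & (0 < \mu_z P)%N].
Proof. by move=> P0; rewrite mem_plain_roots// => /and3P[rz -> ->]; rewrite mu_gt0. Qed.

Lemma plain_data : [/\ forall z, z \in plain_roots F -> \mu_z F = k0,
  forall z, z \in plain_roots H -> \mu_z H = k1 &
  forall z, z \in plain_roots G -> \mu_z G = k2].
Proof.
have /andP[F0 H0] := wronskian_neq0_num W0.
by split=> z /mem_plain-/(_ ltac:(assumption))[z0 z1 m]; move: m;
  case: (plain_type z0 z1) => -[a b c w]; rewrite ?a ?b ?c.
Qed.

Lemma plain_disjoint : uniq ([:: 0; 1] ++ plain_roots F ++ plain_roots H ++ plain_roots G).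
Proof.
have /andP[F0 H0] := wronskian_neq0_num W0.
have dis (P Q : {poly C}) : P != 0 -> Q != 0 ->
    (forall z, z != 0 -> z != 1 -> (0 < \mu_z P)%N -> \mu_z Q = 0%N) ->
    ~~ has (mem (plain_roots P)) (plain_roots Q).
  move=> P0 Q0 D; apply/hasPn => z /(mem_plain Q0)[z0 z1 mQ]; apply/negP.
  by move=> /(mem_plain P0)[_ _ mP]; rewrite (D z) in mQ.
have up (P : {poly C}) : uniq (plain_roots P) by exact: undup_uniq.
have u01 : uniq [:: 0; 1 : C] by rewrite /= inE eq_sym oner_eq0.
have d01 (P : {poly C}) : P != 0 -> ~~ has (mem [:: 0; 1]) (plain_roots P).
  move=> P0; apply/hasPn => z /(mem_plain P0)[z0 z1 _].
  by rewrite /= !inE (negPf z0) (negPf z1).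
rewrite !cat_uniq !has_cat !negb_or u01 !up !d01// !dis//.
all: by move=> z z0 z1; case: (plain_type z0 z1) => -[a b c w]; rewrite ?a ?b ?c.
Qed.

Lemma wronskian_degree : (size W).-1 = (\mu_0 W + \mu_1 W + (size (plain_roots F) * k0.-1 +
  (size (plain_roots H) * k1.-1 + size (plain_roots G) * k2.-1)))%N.
Proof.
have /andP[F0 H0] := wronskian_neq0_num W0.
have [|_ ->] := closed_factor W0 plain_disjoint.
  move=> z; rewrite -mu_gt0// => mz; rewrite !mem_cat !inE !mem_plain_roots//.
  have [//|z0] := eqVneq z 0; have [//|z1] := eqVneq z 1; rewrite /= !andbT -!mu_gt0//.
  by case: (plain_type z0 z1) mz => -[a b c w]; rewrite ?a ?b ?c ?w ?k0_gt0 ?k1_gt0 ?k2_gt0 ?orbT.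
have gen (f : C -> nat) (A B D : seq C) : (\sum_(z <- [:: 0%R; 1%R] ++ A ++ B ++ D) f z =
    f 0%R + f 1%R + (\sum_(z <- A) f z + (\sum_(z <- B) f z + \sum_(z <- D) f z)))%N.
  by rewrite !big_cat !big_cons big_nil /= addn0.
rewrite gen; congr (_ + _)%N.
have cst (P : {poly C}) k : (forall z, z \in plain_roots P -> \mu_z W = k) ->
    (\sum_(z <- plain_roots P) \mu_z W = size (plain_roots P) * k)%N.
  move=> kP; rewrite (eq_big_seq (fun=> k)) ?big_const_seq ?count_predT ?iter_addn_0 1?mulnC//.
congr (_ + (_ + _))%N; apply: cst => z;
 (move=> /(mem_plain F0)[] || move=> /(mem_plain H0)[] || move=> /(mem_plain G0)[]);
 move=> z0 z1 m; case: (plain_type z0 z1) => -[a b c w]; rewrite ?a ?b ?c // in m; by rewrite -w.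
Qed.

(** The sum is at most D (1/k0 + 1/k1 + 1/k2), which is less than D. *)
Lemma hyperbolic_count (n0 n1 n2 D : nat) : (k0 * n0 <= D)%N -> (k1 * n1 <= D)%N ->
  (k2 * n2 <= D)%N -> (0 < D)%N -> (n0 + n1 + n2 < D)%N.
Proof.
move: hyp k0_gt0 k1_gt0 k2_gt0; clear => hyp k0p k1p k2p h0 h1 h2 D0.
rewrite -(@ltn_pmul2l (k0 * k1 * k2)) ?muln_gt0 ?k0p ?k1p//.
apply: leq_ltn_trans (_ : (k0 * k1 + k0 * k2 + k1 * k2) * D < _)%N; last by rewrite ltn_pmul2r.
have -> : (k0 * k1 * k2 * (n0 + n1 + n2) = k0 * k1 * (k2 * n2) + k0 * k2 * (k1 * n1) + k1 * k2 * (k0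
    * n0))%N by ring.
by rewrite !mulnDl !leq_add// leq_mul.
Qed.

Lemma cover_of_identity : exists fs : seq (fibre C),
  [/\ fcover d fs, [seq fk f | f <- fs] = [:: k0; k1; k2] &
   perm_eq (flatten [seq [seq s.2%:R ^+ 2 * (fk f)%:R^-1 ^+ 2 | s <- fspec f] | f <- fs])
     [:: sqexp0 E2; sqexp1 E2; sqexpoo E2]].
Proof.
have /andP[F0 H0] := wronskian_neq0_num W0.
have [mF mH mG] := plain_data.
have Hd : ((size H).-1 <= d)%N.
  have : (size H <= maxn (size F) (size G))%N.
    by rewrite -(size_polyN G); exact: size_polyD.
  by rewrite /d; move: (size H) (size F) (size G) => a b c; clear; lia.
have Fd : ((size F).-1 <= d)%N by rewrite leq_maxl.
have Gd : ((size G).-1 <= d)%N by rewrite leq_maxr.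
have [_ sF] := plain_factor F0 mF; have [_ sH] := plain_factor H0 mH.
have [_ sG] := plain_factor G0 mG; have sW := wronskian_degree.
have [e [eW tyoo]] := infinity_type idt W0 G0; rewrite -/d in eW tyoo.
have ty0 := finite_type cFG idt W0 G0 0; have ty1 := finite_type cFG idt W0 G0 1.
rewrite /target eqxx in ty0; rewrite /target oner_eq0 eqxx in ty1.
pose fs := [:: fibre_of k0 d 1 F; fibre_of k1 d (-1) H; fibre_of k2 d (-1) G].
have sum0 x y : \sum_(f <- fs) fval f x y = 0.
  (* [fibre_of_val] divides by the second coordinate. The sum is a polynomial in it, so its
     vanishing away from 0 is enough. *)
  have sum1 y' : y' != 0 -> \sum_(f <- fs) fval f x y' = 0.
    move=> y0; rewrite !big_cons big_nil !fibre_of_val// hornerD hornerN; ring.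
  have pv (f : fibre C) : exists p : {poly C}, forall y, fval f x y = p.[y].
    pose L (q : option C) : {poly C} := if q is Some z then x%:P - z *: 'X else 'X.
    exists ((fc f)%:P * \prod_(s <- fspec f) L s.1 ^+ s.2 * (\prod_(q <- fpts f) L q) ^+ fk f).
    have LE q y' : pform q x y' = (L q).[y'].
      by case: q => [z|]; rewrite /= ?hornerX// hornerD hornerN hornerC hornerZ hornerX.
    move=> y'; rewrite !hornerM hornerC horner_exp !horner_prod /fval.
    by congr (_ * _ * _ ^+ _); apply: eq_bigr => i _; rewrite ?horner_exp LE.
  have [p pE] := choice pv.
  have : \sum_(f <- fs) p f = 0.
    have X0 : ('X : {poly C}) != 0 by rewrite polyX_eq0.
    apply: (poly_eq0_of_generic X0) => y'; rewrite hornerX => y0.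
    by rewrite horner_sum -[RHS](sum1 y' y0); apply: eq_bigr => f _; rewrite pE.
  move=> /(congr1 (horner^~ y)); rewrite horner_sum horner0 => s0.
  by rewrite -[RHS]s0; apply: eq_bigr => f _; rewrite pE.
have lead : all (fun f => fc f != 0) fs.
  by rewrite /= !mulf_neq0 ?oppr_eq0 ?oner_neq0 ?lead_coef_eq0.
have deg : all (fun f => fdeg f == d) fs by rewrite /= !fibre_of_deg ?eqxx.
have pos : all (fun f => all (fun s => 0 < s.2)%N (fspec f)) fs.
  by apply/allP => f; rewrite !inE => /or3P[]/eqP->; exact: filter_all.
have unq : uniq ([:: Some 0; Some 1; None] ++ [seq Some z | z <- plain_roots F]
    ++ [seq Some z | z <- plain_roots H] ++ [seq Some z | z <- plain_roots G]).
  have := plain_disjoint; rewrite -(@map_inj_uniq _ (option C) Some); last by move=> ? ? [].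
  rewrite !map_cat /= => /and3P[u1 u2 u3].
  rewrite inE in u1; rewrite !inE /= u3 andbT; move: u1 u2; rewrite !negb_or.
  move=> /andP[-> ->] -> /=; rewrite !mem_cat !negb_or.
  by apply/and3P; split; apply/mapP => -[].
pose n0 := size (plain_roots F); pose n1 := size (plain_roots H); pose n2 := size (plain_roots G).
rewrite -/n0 in sF sW; rewrite -/n1 in sH sW; rewrite -/n2 in sG sW.
have d0 : (0 < d)%N by clear -eW; lia.
have lt : (n0 + n1 + n2 < d)%N.
  apply: hyperbolic_count => //.
  - by apply: leq_trans Fd; rewrite sF leq_addl.
  - by apply: leq_trans Hd; rewrite sH leq_addl.
  - by apply: leq_trans Gd; rewrite sG leq_addl.
have le_e a b c t u : point_type E1 t a b c u -> (a + b + c <= u)%N.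
  by case=> _; case=> -[-> -> -> _]; rewrite ?addn0 ?add0n.
have [hur eq0 eq1 eqoo] : [/\ (n0 + (n1 + (n2 + 0))).+1 = d,
    (\mu_0 F + \mu_0 H + \mu_0 G = (\mu_0 W).+1)%N,
    (\mu_1 F + \mu_1 H + \mu_1 G = (\mu_1 W).+1)%N &
    ((d - (size F).-1) + (d - (size H).-1) + (d - (size G).-1) = e)%N].
  have kn n k : (0 < k)%N -> (k * n = n * k.-1 + n)%N by case: k => // k _; rewrite mulSn addnC mulnC.
  rewrite (kn n0 _ k0_gt0) in sF; rewrite (kn n1 _ k1_gt0) in sH; rewrite (kn n2 _ k2_gt0) in sG.
  exact: (hurwitz_count Fd Hd Gd sF sH sG sW eW lt (le_e _ _ _ _ _ ty0)
    (le_e _ _ _ _ _ ty1) (le_e _ _ _ _ _ tyoo)).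
have infib a b c t u : point_type E1 t a b c u.+1 -> (a + b + c = u.+1)%N ->
    in_fibre (sqexp0 E1) (sqexp1 E1) (sqexpoo E1) t a b c u.
  by case=> _; case=> -[-> -> -> E] // _; [apply: Or31|apply: Or32|apply: Or33].
have [u eu] : exists u, e = u.+1 by case: e {eW eqoo} tyoo => [[]//|u _]; exists u.
rewrite eu in tyoo eqoo.
have [pp sz pt] := special_points (Some 0) (Some 1) None [seq Some z | z <- plain_roots F]
  [seq Some z | z <- plain_roots H] [seq Some z | z <- plain_roots G]
  (infib _ _ _ _ _ ty0 eq0) (infib _ _ _ _ _ ty1 eq1) (infib _ _ _ _ _ tyoo eqoo).
exists fs; split=> //.
  split=> //.
  + by rewrite /= /fpoints /= cats0 -!catA (perm_uniq pp).
  + by rewrite /= cats0 !size_cat.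
  + by rewrite /= !size_map.
by rewrite /= cats0 -e0 -e1 -e2.
Qed.

End CoverOfIdentity.

(** * Exclusion of branching patterns *)

Section Normalisation.
Variable K : fieldType.
Implicit Types (p q r u w : option K) (fs : seq (fibre K)).

(** Homogeneous coordinates of the point at which [pform p] vanishes. *)
Definition pvec p : K * K := if p is Some z then (z, 1) else (1, 0).

Lemma pform_pvec p q : p != q -> pform p (pvec q).1 (pvec q).2 != 0.
Proof.
case: p q => [z|] [w|] //=; rewrite ?mulr1 ?mulr0 ?subr0 ?oner_neq0// => zw.
by rewrite subr_eq0; apply: contraNneq zw => ->.
Qed.

Lemma pform_pvec0 p : pform p (pvec p).1 (pvec p).2 = 0.
Proof. by case: p => [z|] //=; rewrite mulr1 subrr. Qed.

Lemma pformD p a b (v w : K * K) : pform p (a * v.1 + b * w.1) (a * v.2 + b * w.2) =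
  a * pform p v.1 v.2 + b * pform p w.1 w.2.
Proof. by case: p => [z|] /=; ring. Qed.

Lemma pform_common p q x y : p != q -> pform p x y = 0 -> pform q x y = 0 -> x = 0 /\ y = 0.
Proof.
case: p q => [z|] [w|] //= zw; rewrite -/(is_true _).
- move=> /eqP; rewrite subr_eq0 => /eqP -> /eqP; rewrite -mulrBl mulf_eq0 subr_eq0.
  case/orP => [/eqP e|/eqP ->]; last by rewrite mulr0.
  by rewrite e eqxx in zw.
- by move=> + y0; rewrite y0 mulr0 subr0.
- by move=> y0; rewrite y0 mulr0 subr0.
Qed.

(* The coordinate X sends p, q, r to 0, infinity, -1. *)
Definition lform p q r u : {poly K} :=
  (pform r (pvec p).1 (pvec p).2 * pform u (pvec q).1 (pvec q).2) *: 'X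
  + (pform r (pvec q).1 (pvec q).2 * pform u (pvec p).1 (pvec p).2)%:P.

Definition pval p q r (f : fibre K) : {poly K} := fc f *:
  (\prod_(s <- fspec f) lform p q r s.1 ^+ s.2 * (\prod_(u <- fpts f) lform p q r u) ^+ fk f).

Section Triple.
Variables p q r : option K.
Hypotheses (pq : p != q) (pr : p != r) (qr : q != r).
Local Notation lf := (lform p q r).

Let rp : pform r (pvec p).1 (pvec p).2 != 0. Proof. by apply: pform_pvec; rewrite eq_sym. Qed.
Let rq : pform r (pvec q).1 (pvec q).2 != 0. Proof. by apply: pform_pvec; rewrite eq_sym. Qed.

Lemma lform_eval u x : (lf u).[x] = pform u
  (pform r (pvec p).1 (pvec p).2 * x * (pvec q).1 + pform r (pvec q).1 (pvec q).2 * (pvec p).1)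
  (pform r (pvec p).1 (pvec p).2 * x * (pvec q).2 + pform r (pvec q).1 (pvec q).2 * (pvec p).2).
Proof. by rewrite pformD /lform hornerD hornerZ hornerX hornerC; ring. Qed.

Lemma lform_coprime u w x : u != w -> (lf u).[x] = 0 -> (lf w).[x] != 0.
Proof.
move=> uw; rewrite !lform_eval => h; apply/eqP => /(pform_common uw h)[].
set a := _ * x; set b := pform r (pvec q).1 _ => e1 e2.
have := pformD p a b (pvec q) (pvec p); have := pformD q a b (pvec q) (pvec p).
rewrite e1 e2 !pform_pvec0 !mulr0 addr0 add0r.
have -> (s : option K) : pform s 0 0 = 0 by case: s => [z|] //=; rewrite mulr0 subr0.
by move/esym/eqP; rewrite mulf_eq0 (negPf rq) /= (negPf (pform_pvec _)) // eq_sym.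
Qed.

Lemma lform_size u : u != q -> size (lf u) = 2%N.
Proof.
move=> uq; have c0 : pform r (pvec p).1 (pvec p).2 * pform u (pvec q).1 (pvec q).2 != 0.
  by rewrite mulf_neq0// pform_pvec.
rewrite /lform size_polyDl size_scale// size_polyX//.
by rewrite size_polyC; case: eqP.
Qed.

Lemma lform0 u : u != p -> (lf u).[0] != 0.
Proof.
move=> up; rewrite /lform hornerD hornerZ hornerX hornerC mulr0 add0r mulf_neq0//.
exact: pform_pvec.
Qed.

Lemma lform_zero : exists2 c, c != 0 & lf p = c *: 'X.
Proof.
exists (pform r (pvec p).1 (pvec p).2 * pform p (pvec q).1 (pvec q).2).
  by rewrite mulf_neq0// pform_pvec.
by rewrite /lform pform_pvec0 mulr0 addr0.
Qed.

Lemma lform_infinity : exists2 c, c != 0 & lf q = c%:P.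
Proof.
exists (pform r (pvec q).1 (pvec q).2 * pform q (pvec p).1 (pvec p).2).
  by rewrite mulf_neq0// pform_pvec// eq_sym.
by rewrite /lform pform_pvec0 mulr0 scale0r add0r.
Qed.

Lemma lform_minus1 : exists2 c, c != 0 & lf r = c *: ('X + 1).
Proof.
exists (pform r (pvec p).1 (pvec p).2 * pform r (pvec q).1 (pvec q).2).
  by rewrite mulf_neq0.
by rewrite /lform scalerDr alg_polyC (mulrC (pform r (pvec q).1 _)).
Qed.

Definition lprod (L : seq (option K)) : {poly K} := \prod_(u <- L) lf u.

Lemma lprod_size L : q \notin L -> size (lprod L) = (size L).+1.
Proof.
elim: L => [|u L IH]; first by rewrite /lprod big_nil size_poly1.
rewrite inE negb_or => /andP[qu /IH sL]; rewrite /lprod big_cons -/(lprod L).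
have su : size (lf u) = 2%N by rewrite lform_size// eq_sym.
by rewrite size_mul -?size_poly_eq0 ?su ?sL.
Qed.

Lemma lprod_root L x : (lprod L).[x] = 0 -> exists2 u, u \in L & (lf u).[x] = 0.
Proof.
rewrite /lprod horner_prod => /eqP; rewrite prodf_seq_eq0 => /hasP[u uL /= /eqP ux].
by exists u.
Qed.

Lemma lprod0 L : p \notin L -> (lprod L).[0] != 0.
Proof.
move=> pL; apply/eqP => /lprod_root[u uL]; apply/eqP/lform0.
by apply: contraNneq pL => <-.
Qed.

Lemma lprod_coprime L1 L2 x : ~~ has (mem L1) L2 -> (lprod L1).[x] = 0 -> (lprod L2).[x] != 0.
Proof.
move=> L12 /lprod_root[u uL ux]; apply/eqP => /lprod_root[w wL wx].
have uw : u != w by apply: contraNneq L12 => uw; apply/hasP; exists w => //; rewrite /= -uw.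
by have := lform_coprime uw ux; rewrite wx eqxx.
Qed.

End Triple.
End Normalisation.

Lemma pval_sum (K : numFieldType) (p q r : option K) fs :
  (forall x y, \sum_(f <- fs) fval f x y = 0) -> \sum_(f <- fs) pval p q r f = 0.
Proof.
move=> H; apply: (@poly_eq0_of_generic _ 1); first exact: oner_neq0.
move=> x _; rewrite horner_sum -[RHS](H
  (pform r (pvec p).1 (pvec p).2 * x * (pvec q).1 + pform r (pvec q).1 (pvec q).2 * (pvec p).1)
  (pform r (pvec p).1 (pvec p).2 * x * (pvec q).2 + pform r (pvec q).1 (pvec q).2 * (pvec p).2)).
apply: eq_bigr => f _; rewrite /pval /fval hornerZ hornerM horner_exp !horner_prod mulrA.
by congr (_ * _ * _ ^+ _); apply: eq_bigr => i _; rewrite ?horner_exp lform_eval.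
Qed.

Lemma coprimep_of_roots (K : closedFieldType) (A B : {poly K}) :
  (forall x, A.[x] = 0 -> B.[x] != 0) -> coprimep A B.
Proof.
by move=> H; apply: Pdiv.ClosedField.root_coprimep => x /rootP /H.
Qed.

(* If a b^2 and c d^2 add up to a multiple of a large power of a form, then one
   factor of their sum is divisible by the whole power. *)
Lemma no_squares_sum (K : closedFieldType) (A B S : {poly K}) (al be ga : K) (n m : nat) :
  al != 0 -> be != 0 -> ga != 0 -> S != 0 -> A.[0] != 0 ->
  (size A <= m.+1)%N -> (size B <= m.+1)%N -> (m < n)%N ->
  al *: A ^+ 2 + be *: B ^+ 2 + ga *: (S * 'X ^+ n) = 0 -> 2%:R != 0 :> K -> False.
Proof.
move=> al0 be0 ga0 S0 A0 sA sB mn E two.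
have sqrt (c : K) : exists x, x ^+ 2 = c.
  have [x xE] := solve_monicpoly (fun i => if i is 0%N then c else 0) (isT : (0 < 2)%N).
  by exists x; rewrite xE !big_ord_recl big_ord0 /= expr0 mulr1 mul0r !addr0.
have [a aE] := sqrt al; have [b bE] := sqrt (- be).
have a0 : a != 0 by apply: contraNneq al0 => a0; rewrite -aE a0 expr0n.
pose P := a *: A + b *: B; pose Q := a *: A - b *: B.
have PQ : P * Q = (- ga) *: (S * 'X ^+ n).
  have -> : P * Q = a ^+ 2 *: A ^+ 2 - b ^+ 2 *: B ^+ 2 by rewrite /P /Q -!mul_polyC; ring.
  by rewrite aE bE scaleNr opprK scaleNr; apply/eqP; rewrite -subr_eq0 opprK E.
have PQ0 : P * Q != 0 by rewrite PQ -mul_polyC !mulf_neq0 ?polyC_eq0 ?oppr_eq0// expf_neq0 ?polyX_eq0.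
have sP : (size P <= m.+1)%N.
  by apply: leq_trans (size_polyD _ _) _; rewrite geq_max !(leq_trans (size_scale_leq _ _)).
have sQ : (size Q <= m.+1)%N.
  apply: leq_trans (size_polyD _ _) _; rewrite size_polyN geq_max.
  by rewrite !(leq_trans (size_scale_leq _ _)).
have noX (P' Q' : {poly K}) : P' * Q' != 0 -> P'.[0] != 0 -> (size Q' <= m.+1)%N ->
    ('X ^+ n %| P' * Q') -> False.
  move=> /[dup] nz /[!mulf_eq0] /[!negb_or] /andP[_ Q'0] P'0 sQ'.
  rewrite Gauss_dvdpr; last first.
    by rewrite coprimep_expl// coprimep_sym coprimepX rootE.
  by move=> /(dvdp_leq Q'0); rewrite size_polyXn leqNgt ltnS (leq_trans sQ').
have dvd : 'X ^+ n %| P * Q by rewrite PQ scalerAl dvdp_mull.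
have [P0|P0] := eqVneq P.[0] 0; last exact: (noX P Q).
apply: (noX Q P) => //; rewrite 1?mulrC//; apply: contra A0 => /eqP Q0.
have : (P + Q).[0] = 0 by rewrite hornerD P0 Q0 addr0.
have -> : P + Q = (2%:R * a) *: A by rewrite /P /Q -!mul_polyC polyCM; ring.
by move=> /eqP; rewrite hornerZ !mulf_eq0 (negPf two) (negPf a0).
Qed.

Lemma mul_deriv_exp (K : comNzRingType) (p : {poly K}) e :
  p * (p ^+ e)^`() = e%:R * (p^`() * p ^+ e).
Proof.
case: e => [|k]; first by rewrite expr0 derivC mulr0 mul0r.
by rewrite deriv_exp exprS -mulr_natl /=; ring.
Qed.

(** * First-order equations for the polynomials A and B *)

Section Ode.
Variable K : numFieldType.
Variables (n e : nat) (A B l q : {poly K}) (al be ga : K).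
Hypotheses (n_gt0 : (0 < n)%N) (al0 : al != 0) (cAB : coprimep A B).
Hypotheses (A0 : A.[0] = 1) (B0 : B.[0] = 1) (l0 : l.[0] = 1) (q0 : q.[0] = 1).
Hypothesis eqn : al *: A ^+ 2 + be *: (l * B ^+ 3) + ga *: ('X ^+ n * q ^+ e) = 0.

(** X q times the logarithmic derivative of X^n q^e. *)
Definition ode_g : {poly K} := n%:R * q + e%:R * ('X * q^`()).
Definition ode_U : {poly K} := 2%:R * q * ('X * A^`()) - ode_g * A.
Definition ode_V : {poly K} :=
  3%:R * (q * l) * ('X * B^`()) + (q * ('X * l^`()) - ode_g * l) * B.
Hypothesis sU : (size ode_U <= size (B ^+ 2)%R)%N.

(* 'X q D - g annihilates 'X^n q^e; applied to the two other terms of the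
   equation it produces A U and B^2 V. *)
Lemma ode_relation : al *: (A * ode_U) + be *: (B ^+ 2 * ode_V) = 0.
Proof.
pose L (p : {poly K}) := q * ('X * p^`()) - ode_g * p.
have LD p r : L (p + r) = L p + L r by rewrite /L derivD; ring.
have LZ c p : L (c *: p) = c *: L p by rewrite /L derivZ -!mul_polyC; ring.
have LG : L ('X ^+ n * q ^+ e) = 0.
  rewrite /L derivM.
  have -> : q * ('X * (('X ^+ n)^`() * q ^+ e + 'X ^+ n * (q ^+ e)^`())) =
    q * ('X * ('X ^+ n)^`()) * q ^+ e + 'X * 'X ^+ n * (q * (q ^+ e)^`()) by ring.
  by rewrite !mul_deriv_exp derivX /ode_g; ring.
have LA : L (A ^+ 2) = A * ode_U.
  by rewrite /L /ode_U expr2 derivM; ring.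
have LB : L (l * B ^+ 3) = B ^+ 2 * ode_V.
  by rewrite /L /ode_V !exprS expr0 !derivM derivC; ring.
have := congr1 L eqn; rewrite !LD !LZ LG LA LB scaler0 addr0 => ->.
by rewrite /L deriv0 !mulr0 subr0.
Qed.

(** B^2 divides A U, hence U because A and B are coprime; the bound [sU] makes the quotient
    constant, and the values at 0 identify it as - n. *)
Lemma ode_equations : ode_U = - n%:R * B ^+ 2 /\ ode_V = - n%:R * A.
Proof.
have rel := ode_relation.
have be0 : be = - al.
  have := congr1 (horner^~ 0) eqn.
  rewrite /= !(hornerD, hornerZ, hornerM, horner_exp) horner0 hornerX A0 B0 l0 q0 !expr1n expr0n.
  by rewrite (gtn_eqF n_gt0) mulr0n mul0r mulr0 addr0 !mulr1 addrC => /eqP; rewrite addr_eq0 => /eqP.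
have AU : A * ode_U = B ^+ 2 * ode_V.
  apply: (scalerI al0); apply/eqP; rewrite -subr_eq0; apply/eqP.
  by rewrite -[RHS]rel be0 scaleNr.
have B20 : B ^+ 2 != 0.
  by rewrite expf_neq0//; apply/eqP => B00; move: B0; rewrite B00 horner0 => /eqP; rewrite eq_sym oner_eq0.
have dU : B ^+ 2 %| ode_U.
  rewrite -(@Gauss_dvdpr _ _ A) ?AU ?dvdp_mulIl//.
  by rewrite coprimep_sym coprimep_expr.
have [c cE] : exists c, ode_U = c%:P * B ^+ 2.
  have /dvdpP[r rE] := dU; have [U0|U0] := eqVneq ode_U 0; first by exists 0; rewrite mul0r.
  have r0 : r != 0 by apply: contraNneq U0 => r0; rewrite rE r0 mul0r.
  have sr : (size r <= 1)%N.
    have sB : (0 < size (B ^+ 2)%R)%N by rewrite size_poly_gt0.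
    move: sU; rewrite rE size_mul//.
    by case: (size (B ^+ 2)) sB => // k _; rewrite addnS /= -[k.+1]add1n leq_add2r.
  by exists r`_0; rewrite -size1_polyC.
have cn : c = - n%:R.
  have := congr1 (horner^~ 0) cE; rewrite /ode_U /ode_g /=.
  rewrite !(hornerD, hornerN, hornerM, horner_exp) -!polyC_natr !hornerC hornerX A0 B0 q0.
  by rewrite !mul0r !mulr0 !mulr1 addr0 add0r => ->.
have cP : c%:P = - n%:R :> {poly K} by rewrite cn polyCN polyC_natr.
split; first by rewrite cE cP.
by apply: (mulfI B20); rewrite -AU cE cP; ring.
Qed.

(** Multiplication by X^k on coefficients. The test is needed because the truncated index would give
    [f 0] below k. *)
Definition sh (k : nat) (f : nat -> K) (r : nat) : K := if (k <= r)%N then f (r - k)%N else 0.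

Lemma coef_cubic_mul (p0 p1 p2 p3 : K) (P : {poly K}) r :
  ((p0%:P + p1 *: 'X + p2 *: 'X^2 + p3 *: 'X^3) * P)`_r =
  p0 * P`_r + p1 * sh 1 (fun i => P`_i) r + p2 * sh 2 (fun i => P`_i) r
    + p3 * sh 3 (fun i => P`_i) r.
Proof.
have cX k : ('X^k * P)`_r = sh k (fun i => P`_i) r by rewrite coefXnM /sh ltnNge; case: leqP.
by rewrite !mulrDl !coefD coefCM -!scalerAl !coefZ !cX (_ : 'X = 'X^1) ?cX// expr1.
Qed.

Lemma coef_euler (P : {poly K}) r : ('X * P^`())`_r = r%:R * P`_r.
Proof. by rewrite coefXM; case: r => [|r] /=; rewrite ?mul0r// coef_deriv mulr_natl. Qed.

Variables (q1 q2 lam : K).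
Hypotheses (qE : q = 1 + q1 *: 'X + q2 *: 'X^2) (lE : l = 1 + lam *: 'X).

Lemma ode_recA r : (2 * r%:R - n%:R) * A`_r
    + q1 * (sh 1 (fun i => (2 * i%:R - n%:R - e%:R) * A`_i) r)
    + q2 * (sh 2 (fun i => (2 * i%:R - n%:R - 2 * e%:R) * A`_i) r) =
  - n%:R * \sum_(i < r.+1) B`_i * B`_(r - i).
Proof.
have [UE _] := ode_equations.
have := congr1 (fun p : {poly K} => p`_r) UE.
rewrite /=; have -> : - n%:R = (- n%:R)%:P :> {poly K} by rewrite polyCN polyC_natr.
rewrite coefCM expr2 coefM => <-.
have gE : ode_g = n%:R%:P + ((n%:R + e%:R) * q1) *: 'X + ((n%:R + 2 * e%:R) * q2) *: 'X^2 + 0 *: 'X^3.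
  rewrite /ode_g qE !derivD derivC !derivZ derivX derivXn -!polyC_natr -!mul_polyC.
  rewrite /=; ring.
have q2E : 2%:R * q = 2%:P + (2 * q1) *: 'X + (2 * q2) *: 'X^2 + 0 *: 'X^3.
  by rewrite qE -!polyC_natr -!mul_polyC !polyCM; ring.
rewrite /ode_U gE q2E coefB !coef_cubic_mul /sh !coef_euler.
case: r => [|[|[|r]]] /=; rewrite ?subn1 ?subn2 ?subn3 /=; ring.
Qed.

Lemma ode_recB r : (3 * r%:R - n%:R) * B`_r
    + sh 1 (fun i => (q1 * (3 * i%:R - n%:R - e%:R) + lam * (3 * i%:R + 1 - n%:R)) * B`_i) r
    + sh 2 (fun i => (q2 * (3 * i%:R - n%:R - 2 * e%:R) + lam * q1 * (3 * i%:R + 1 - n%:R - e%:R)) * B`_i) r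
    + sh 3 (fun i => lam * q2 * (3 * i%:R + 1 - n%:R - 2 * e%:R) * B`_i) r =
  - n%:R * A`_r.
Proof.
have [_ VE] := ode_equations.
have := congr1 (fun p : {poly K} => p`_r) VE.
rewrite /=; have -> : - n%:R = (- n%:R)%:P :> {poly K} by rewrite polyCN polyC_natr.
rewrite coefCM => <-.
have Q3 : 3%:R * (q * l) = 3%:P + (3 * (q1 + lam)) *: 'X + (3 * (q2 + lam * q1)) *: 'X^2
    + (3 * (lam * q2)) *: 'X^3.
  by rewrite qE lE -!polyC_natr -!mul_polyC !(polyCM, polyCD); ring.
have R3 : q * ('X * l^`()) - ode_g * l = (- n%:R)%:P
    + (lam * (1 - n%:R) - (n%:R + e%:R) * q1) *: 'X
    + (lam * q1 * (1 - n%:R - e%:R) - (n%:R + 2 * e%:R) * q2) *: 'X^2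
    + (lam * q2 * (1 - n%:R - 2 * e%:R)) *: 'X^3.
  rewrite /ode_g qE lE !derivD derivC !derivZ derivX derivXn -!polyC_natr -!mul_polyC.
  rewrite /=; ring.
rewrite /ode_V Q3 R3 coefD !coef_cubic_mul /sh !coef_euler.
case: r => [|[|[|r]]] /=; rewrite ?coef_euler ?subn1 ?subn2 ?subn3 /=; ring.
Qed.

End Ode.

Section Recursion.
Variable K : numFieldType.
Implicit Types a b : nat -> K.

(* The recursions of [ode_recA] and [ode_recB]. *)
Definition ode_rec n e (q1 q2 lam : K) a b : Prop :=
  [/\ a 0%N = 1, b 0%N = 1,
    forall r, (2 * r%:R - n%:R) * a r
      + q1 * sh 1 (fun i => (2 * i%:R - n%:R - e%:R) * a i) r
      + q2 * sh 2 (fun i => (2 * i%:R - n%:R - 2 * e%:R) * a i) r =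
      - n%:R * \sum_(i < r.+1) b i * b (r - i)%N
  & forall r, (3 * r%:R - n%:R) * b r
      + sh 1 (fun i => (q1 * (3 * i%:R - n%:R - e%:R) + lam * (3 * i%:R + 1 - n%:R)) * b i) r
      + sh 2 (fun i => (q2 * (3 * i%:R - n%:R - 2 * e%:R)
                        + lam * q1 * (3 * i%:R + 1 - n%:R - e%:R)) * b i) r
      + sh 3 (fun i => lam * q2 * (3 * i%:R + 1 - n%:R - 2 * e%:R) * b i) r =
      - n%:R * a r].

(** Solving equations becomes checking an identity: [c1] and [c2] are precomputed cofactors
    expressing x - v through the two given relations. The large constants below are such cofactors
    or solved coefficients, with integers split into factors or blocks of three digits. *)
Lemma linear_elim (x v l1 r1 l2 r2 c1 c2 : K) : l1 = r1 -> l2 = r2 ->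
  x - v = c1 * (l1 - r1) + c2 * (l2 - r2) -> x = v.
Proof. by move=> -> -> /eqP; rewrite !subrr !mulr0 addr0 subr_eq0 => /eqP. Qed.

Ltac rec_norm := rewrite /sh /= !big_ord_recr big_ord0 /= ?subSS ?subn0 ?subnn.

(** For B quadratic this reads B = (1 + q1 X) (1 + q1 X / 9): it shares the root of q. *)
Lemma ode_rec_3_2 (q1 : K) a b : ode_rec 3 2 q1 0 0 a b -> b 1%N = 10 / 9 * q1 /\ b 2%N = q1 ^+ 2 / 9.
Proof.
move=> [a0 b0 HA HB].
have b1E : b 1%N = (10/(9)*q1).
  by apply: (linear_elim (c1 := (1/(6))) (c2 := (1/(18))) (HA 1%N) (HB 1%N)); rec_norm;
    rewrite ?(a0,b0); field.
have a1E : a 1%N = (5/(3)*q1).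
  by apply: (linear_elim (c1 := (0)) (c2 := (1/(3))) (HA 1%N) (HB 1%N)); rec_norm;
    rewrite ?(a0,b0); field.
have b2E : b 2%N = (1/(9)*q1^+2).
  by apply: (linear_elim (c1 := (1/(5))) (c2 := ( - 1/(15))) (HA 2%N) (HB 2%N)); rec_norm;
    rewrite ?(a0,b0,b1E,a1E); field.
by rewrite b1E b2E; split; field.
Qed.

(* b_2 and b_3 are computed from both ends of the recursion. *)
Lemma ode_rec_7_1 (q1 q2 : K) a b : ode_rec 7 1 q1 q2 0 a b ->
  (forall r, (6 < r)%N -> a r = 0) -> (forall r, (4 < r)%N -> b r = 0) -> b 4%N != 0 -> q2 = 0.
Proof.
move=> [a0 b0 HA HB].
move=> a_0 b_0 b40; apply/eqP; apply: contraT => q20.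
have b1E : b 1%N = (16/(13)*q1).
  by apply: (linear_elim (c1 := (7/(78))) (c2 := (5/(78))) (HA 1%N) (HB 1%N)); rec_norm;
    rewrite ?(a0,b0); field.
have a1E : a 1%N = (24/(13)*q1).
  by apply: (linear_elim (c1 := (2/(39))) (c2 := (7/(39))) (HA 1%N) (HB 1%N)); rec_norm;
    rewrite ?(a0,b0); field.
have b2E : b 2%N = (736/(169*19)*q1^+2 + 18/(19)*q2).
  by apply: (linear_elim (c1 := (7/(95))) (c2 := (3/(95))) (HA 2%N) (HB 2%N)); rec_norm;
    rewrite ?(a0,b0,b1E,a1E); field.
have a2E : a 2%N = ((2*1000+928)/(169*19)*q1^+2 + 27/(19)*q2).
  by apply: (linear_elim (c1 := (1/(95))) (c2 := (14/(95))) (HA 2%N) (HB 2%N)); rec_norm;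
    rewrite ?(a0,b0,b1E,a1E); field.
have b3E : b 3%N = ( - (3*1000+456)/(845*247)*q1^+3 + 24/(95)*q1*q2).
  by apply: (linear_elim (c1 := (7/(100))) (c2 := (1/(100))) (HA 3%N) (HB 3%N)); rec_norm;
    rewrite ?(a0,b0,b1E,a1E,b2E,a2E); field.
have a3E : a 3%N = ((14*1000+656)/(845*247)*q1^+3 + (1*1000+548)/(65*19)*q1*q2).
  by apply: (linear_elim (c1 := ( - 1/(50))) (c2 := (7/(50))) (HA 3%N) (HB 3%N)); rec_norm;
    rewrite ?(a0,b0,b1E,a1E,b2E,a2E); field.
have za7 : a 7%N = 0 by exact: a_0.
have za8 : a 8%N = 0 by exact: a_0.
have zb5 : b 5%N = 0 by exact: b_0.
have zb6 : b 6%N = 0 by exact: b_0.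
have zb7 : b 7%N = 0 by exact: b_0.
have zb8 : b 8%N = 0 by exact: b_0.
have a6E : a 6%N = - 3/7 * q2 * b 4%N.
  by apply: (linear_elim (c1 := (0)) (c2 := (1/7)) (HA 6%N) (HB 6%N)); rec_norm;
    rewrite ?(za7,za8,zb5,zb6,zb7,zb8); field.
have b4E : b 4%N = 9/49 * q2 ^+ 2.
  (* In row 8 only b_4^2 and q2 a_6 survive, and a_6 is a multiple of b_4, so one factor b_4
     cancels. *)
  apply: (mulfI b40); have := HA 8%N.
  rec_norm; rewrite za7 za8 zb5 zb6 zb7 zb8 a6E => h.
  by apply: (linear_elim (c1 := 1/7) (c2 := 0) h (erefl 0)); field.
have tb3E : b 3%N = (8/(49)*q1*q2).
  by apply: (linear_elim (c1 := (7/(18)*q2^-2)) (c2 := ( - 1/(18)*q2^-1)) (HA 7%N) (HB 5%N)); rec_norm;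
    rewrite ?(za7,za8,zb5,zb6,zb7,zb8,b4E,a6E); field.
have ta5E : a 5%N = ( - 36/(343)*q1*q2^+2).
  by apply: (linear_elim (c1 := 0) (c2 := (1/(7))) (HA 7%N) (HB 5%N)); rec_norm;
    rewrite ?(za7,za8,zb5,zb6,zb7,zb8,b4E,a6E); field.
have tb2E : b 2%N = (6/(49)*q2).
  by apply: (linear_elim (c1 := (7/(15)*q2^-2)) (c2 := (1/(15)*q2^-1)) (HA 6%N) (HB 4%N)); rec_norm;
    rewrite ?(za7,za8,zb5,zb6,zb7,zb8,b4E,a6E,ta5E,tb3E); field.
have ta4E : a 4%N = ( - 8/(343)*q1^+2*q2 - 27/(343)*q2^+2).
  by apply: (linear_elim (c1 := (1/(5)*q2^-1)) (c2 := (6/(35))) (HA 6%N) (HB 4%N)); rec_norm;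
    rewrite ?(za7,za8,zb5,zb6,zb7,zb8,b4E,a6E,ta5E,tb3E); field.
have e2 : b 2%N - b 2%N = (736/(169*19)*q1^+2 + 768/(931)*q2) by rewrite {1}b2E tb2E; field.
have e3 : b 3%N - b 3%N = ( - (3*1000+456)/(845*247)*q1^+3 + 416/(245*19)*q1*q2) by rewrite {1}b3E
    tb3E; field.
rewrite subrr in e2; rewrite subrr in e3.
have q1q2 : q1 * q2 = 0.
  by apply: (linear_elim (c1 := ( - (1*1000+323)/(88*31)*q1)) (c2 := ( - (73*1000+255)/(352*31))) e2
      e3); field.
have q10 : q1 = 0 by move: q1q2 => /eqP; rewrite mulf_eq0 (negPf q20) orbF => /eqP.
move: e2; rewrite q10 expr0n /= mulr0 add0r => /esym/eqP; rewrite mulf_eq0 (negPf q20) orbF => /eqP h.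
have : (1 : K) = 0 by apply: (linear_elim (c1 := (931/(768))) (c2 := 0) h (erefl 0)); field.
by move/eqP; rewrite oner_eq0.
Qed.

(* There are genuine solutions, which come from coverings of degrees 8 and 10; for
   them q and B have a common root. *)
Lemma ode_rec_7_2 (q1 q2 : K) a b : ode_rec 7 2 q1 q2 0 a b ->
  (forall r, (6 < r)%N -> a r = 0) -> (forall r, (4 < r)%N -> b r = 0) -> b 4%N != 0 -> q2 != 0 ->
  let q x := 1 + q1 * x + q2 * x ^+ 2 in
  let B x := 1 + b 1%N * x + b 2%N * x ^+ 2 + b 3%N * x ^+ 3 + b 4%N * x ^+ 4 in
  (forall x, q x = 0 -> B x = 0) \/ exists2 x, q x = 0 & B x = 0.
Proof.
move=> [a0 b0 HA HB].
move=> a_0 b_0 b40 q20 q B.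
have b1E : b 1%N = (18/(13)*q1).
  by apply: (linear_elim (c1 := (7/(78))) (c2 := (5/(78))) (HA 1%N) (HB 1%N)); rec_norm;
    rewrite ?(a0,b0); field.
have a1E : a 1%N = (27/(13)*q1).
  by apply: (linear_elim (c1 := (2/(39))) (c2 := (7/(39))) (HA 1%N) (HB 1%N)); rec_norm;
    rewrite ?(a0,b0); field.
have b2E : b 2%N = ((1*1000+107)/(169*19)*q1^+2 + 22/(19)*q2).
  by apply: (linear_elim (c1 := (7/(95))) (c2 := (3/(95))) (HA 2%N) (HB 2%N)); rec_norm;
    rewrite ?(a0,b0,b1E,a1E); field.
have a2E : a 2%N = ((3*1000+969)/(169*19)*q1^+2 + 33/(19)*q2).
  by apply: (linear_elim (c1 := (1/(95))) (c2 := (14/(95))) (HA 2%N) (HB 2%N)); rec_norm;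
    rewrite ?(a0,b0,b1E,a1E); field.
have b3E : b 3%N = ( - (5*1000+184)/(845*247)*q1^+3 + 606/(65*19)*q1*q2).
  by apply: (linear_elim (c1 := (7/(100))) (c2 := (1/(100))) (HA 3%N) (HB 3%N)); rec_norm;
    rewrite ?(a0,b0,b1E,a1E,b2E,a2E); field.
have a3E : a 3%N = ((1*1000+701)/(845*13)*q1^+3 + 126/(65)*q1*q2).
  by apply: (linear_elim (c1 := ( - 1/(50))) (c2 := (7/(50))) (HA 3%N) (HB 3%N)); rec_norm;
    rewrite ?(a0,b0,b1E,a1E,b2E,a2E); field.
have b4E : b 4%N = (((13*1000+716)*1000+864)/(845*169*361*31)*q1^+4 -
    (625*1000+536)/(845*361*31)*q1^+2*q2 + (1*1000+639)/(361*31)*q2^+2).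
  by apply: (linear_elim (c1 := (7/(93))) (c2 := ( - 1/(93))) (HA 4%N) (HB 4%N)); rec_norm;
    rewrite ?(a0,b0,b1E,a1E,b2E,a2E,b3E,a3E); field.
have za7 : a 7%N = 0 by exact: a_0.
have za8 : a 8%N = 0 by exact: a_0.
have zb5 : b 5%N = 0 by exact: b_0.
have zb6 : b 6%N = 0 by exact: b_0.
have zb7 : b 7%N = 0 by exact: b_0.
have zb8 : b 8%N = 0 by exact: b_0.
have a6E : a 6%N = ( - 1/(7)*q2) * b 4%N.
  by apply: (linear_elim (c1 := (0)) (c2 := (1/(7))) (HA 6%N) (HB 6%N)); rec_norm;
    rewrite ?(za7,za8,zb5,zb6,zb7,zb8); field.
have tb4E : b 4%N = (1/(49)*q2^+2).
  apply: (mulfI b40); have := HA 8%N.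
  rec_norm; rewrite za7 za8 zb5 zb6 zb7 zb8 a6E => h.
  by apply: (linear_elim (c1 := (1/(7))) (c2 := 0) h (erefl 0)); field.
have e4 : b 4%N - b 4%N = (((13*1000+716)*1000+864)/(845*169*361*31)*q1^+4 -
    (625*1000+536)/(845*361*31)*q1^+2*q2 + (69*1000+120)/(931*589)*q2^+2) by rewrite {1}b4E tb4E;
    field.
rewrite subrr in e4.
(* Equating the two values of b_4 gives a quadratic equation in q1^2 over q2; it splits over the
   rationals. *)
have q1E : q1 ^+ 2 - 169/49 * q2 = 0 \/ q1 ^+ 2 - (16*1000+900)/(63*63) * q2 = 0.
  have : (q1 ^+ 2 - 169/49 * q2) * (q1 ^+ 2 - (16*1000+900)/(63*63) * q2) = 0.
    by apply: (linear_elim (c1 := ( - (((1*1000+598)*1000+130)*1000+755)/(384*729*49))) (c2 := 0) e4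
        (erefl 0)); field.
  by move/eqP; rewrite mulf_eq0 => /orP[] /eqP; [left | right].
case: q1E => q1E; [left | right].
  (* With q1 = 13 w and q2 = 49 w^2 one has B = q (1 + 5 w x + w^2 x^2), so every root of q is a
     root of B. *)
  pose w := q1 / 13; have q1w : q1 = 13 * w by rewrite /w; field.
  have q2w : q2 = 49 * w ^+ 2 by apply: (linear_elim (c1 := -49/169) (c2 := 0) q1E (erefl 0));
      rewrite q1w; field.
  move=> x; rewrite /q /B b1E b2E b3E b4E q1w q2w => qx.
  by apply: (linear_elim (c1 :=  1 + 5*(w*x) + (w*x)^+2) (c2 := 0) qx (erefl 0)); field.
pose w := q1 / 130; have q1w : q1 = 130 * w by rewrite /w; field.
have q2w : q2 = 63 ^+ 2 * w ^+ 2.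
  by apply: (linear_elim (c1 := -(63*63)/(16*1000+900)) (c2 := 0) q1E (erefl 0)); rewrite q1w; field.
have w0 : w != 0 by apply: contraNneq q20 => w0; rewrite q2w w0 expr0n mulr0.
(* Here q = (1 + 49 w x) (1 + 81 w x); B vanishes at the root of the second factor. *)
by exists (- (81 * w)^-1); rewrite /q /B ?b1E ?b2E ?b3E ?b4E q1w q2w; field.
Qed.

(** The first relation eliminates q and leaves two binary cubic forms in x and s. They are coprime,
    so their ideal contains all forms of degree 5 = 3 + 3 - 1; the cofactors exhibit x^5 and s^5. *)
Lemma cubic_forms_coprime (x s q : K) : (1*1000+333)*x^+2 + 250*x*s - 98*s^+2 + (4*1000+752)*q = 0
    -> 4*x^+3 + 23*x*q - 6*q*s = 0 ->
  (-((5*1000+333)*1000+827))*x^+2*s + (((1*1000+723)*1000+688))*x*s^+2 +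
      (-((250*1000+282)*1000+926))*x*q + (-(643*1000+468))*s^+3 + (-((35*1000+559)*1000+0))*q*s = 0
      -> x = 0 /\ s = 0.
Proof.
move=> hM hN hH.
have qE : q = ( - (1*1000+333)/(432*11)*x^+2 - 125/(216*11)*x*s + 49/(216*11)*s^+2).
  by apply: (linear_elim (c1 := 1/(99*48)) (c2 := 0) hM (erefl 0)); field.
have x5 : x ^+ 5 = 0.
  by apply: (linear_elim (c1 :=
      ((((((282*1000+390)*1000+767)*1000+935)*1000+389)*1000+328)/(455*169*169*247*703*251*(5*1000+639))*x^+2
      +
      (((((113*1000+24)*1000+918)*1000+271)*1000+428)*1000+348)/(455*169*169*247*703*251*(5*1000+639))*x*s
      - ((((388*1000+381)*1000+801)*1000+450)*1000+608)/(845*169*169*361*37*251*(5*1000+639))*s^+2))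
      (c2 :=
      (((((1*1000+494)*1000+530)*1000+230)*1000+192)/(945*169*169*169*361*37*251*(5*1000+639))*x^+2
      - (((107*1000+963)*1000+711)*1000+26)/(315*169*169*169*361*37*251*(5*1000+639))*x*s +
      ((34*1000+905)*1000+164)/(845*169*169*361*37*251*(5*1000+639))*s^+2)) hN hH); rewrite qE;
      field.
have s5 : s ^+ 5 = 0.
  by apply: (linear_elim (c1 :=
      ((((((((4*1000+288)*1000+295)*1000+698)*1000+698)*1000+381)*1000+525)*1000+667)/(490*169*169*169*361*37*251*(5*1000+639))*x^+2
      +
      ((((((196*1000+751)*1000+445)*1000+370)*1000+915)*1000+928)*1000+769)/(637*169*169*247*703*251*(5*1000+639))*x*s
      +
      ((((((104*1000+787)*1000+822)*1000+112)*1000+595)*1000+899)*1000+384)/(245*169*169*169*361*37*251*(5*1000+639))*s^+2))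
      (c2 :=
      ((((((8*1000+86)*1000+867)*1000+240)*1000+847)*1000+921)/(540*637*169*169*247*703*251*(5*1000+639))*x^+2
      + ((((4*1000+939)*1000+261)*1000+939)*1000+918)/(189*91*169*169*247*703*251*(5*1000+639))*x*s
      -
      ((((230*1000+903)*1000+470)*1000+42)*1000+793)/(315*91*169*169*247*703*251*(5*1000+639))*s^+2))
      hN hH); rewrite qE; field.
have z (y : K) : y ^+ 5 = 0 -> y = 0 by move/eqP; rewrite expf_eq0 => /andP[_ /eqP].
by split; apply: z.
Qed.

(* The two computations of b_1, ..., b_4 are exchanged by the inversion of the
   coordinate; the combinations hM, hN, hH are the invariant ones, homogeneous of
   weights 2, 3, 3 in q1, 1 + q2, q2 of weights 1, 1, 2. *)
Lemma no_ode_rec_7_1_1 (q1 q2 : K) a b : ode_rec 7 1 q1 q2 1 a b ->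
  (forall r, (8 < r)%N -> a r = 0) -> (forall r, (5 < r)%N -> b r = 0) -> b 5%N != 0 -> q2 != 0 -> False.
Proof.
move=> [a0 b0 HA HB].
move=> a_0 b_0 b50 q20.
have b1E : b 1%N = (16/(13)*q1 + 5/(13)).
  by apply: (linear_elim (c1 := (7/(78))) (c2 := (5/(78))) (HA 1%N) (HB 1%N)); rec_norm;
    rewrite ?(a0,b0); field.
have a1E : a 1%N = (24/(13)*q1 + 14/(13)).
  by apply: (linear_elim (c1 := (2/(39))) (c2 := (7/(39))) (HA 1%N) (HB 1%N)); rec_norm;
    rewrite ?(a0,b0); field.
have b2E : b 2%N = (736/(169*19)*q1^+2 + (1*1000+240)/(169*19)*q1 + 18/(19)*q2 - 128/(169*19)).
  by apply: (linear_elim (c1 := (7/(95))) (c2 := (3/(95))) (HA 2%N) (HB 2%N)); rec_norm;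
    rewrite ?(a0,b0,b1E,a1E); field.
have a2E : a 2%N = ((2*1000+928)/(169*19)*q1^+2 + (5*1000+964)/(169*19)*q1 + 27/(19)*q2 + 511/(169*19)).
  by apply: (linear_elim (c1 := (1/(95))) (c2 := (14/(95))) (HA 2%N) (HB 2%N)); rec_norm;
    rewrite ?(a0,b0,b1E,a1E); field.
have b3E : b 3%N = ( - (3*1000+456)/(845*247)*q1^+3 + (5*1000+184)/(845*247)*q1^+2 + 24/(95)*q1*q2 -
    (1*1000+600)/(169*247)*q1 + 26/(95)*q2 + (3*1000+136)/(845*247)).
  by apply: (linear_elim (c1 := (7/(100))) (c2 := (1/(100))) (HA 3%N) (HB 3%N)); rec_norm;
    rewrite ?(a0,b0,b1E,a1E,b2E,a2E); field.
have a3E : a 3%N = ((14*1000+656)/(845*247)*q1^+3 + (168*1000+336)/(845*247)*q1^+2 +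
    (1*1000+548)/(65*19)*q1*q2 + (9*1000+156)/(169*247)*q1 + (1*1000+722)/(65*19)*q2 -
    896/(845*247)).
  by apply: (linear_elim (c1 := ( - 1/(50))) (c2 := (7/(50))) (HA 3%N) (HB 3%N)); rec_norm;
    rewrite ?(a0,b0,b1E,a1E,b2E,a2E); field.
have b4E : b 4%N = (((6*1000+690)*1000+816)/(845*169*361*31)*q1^+4 -
    (150*1000+336)/(845*169*361*31)*q1^+3 - (276*1000+912)/(845*361*31)*q1^+2*q2 -
    (70*1000+912)/(845*169*361*31)*q1^+2 - (110*1000+384)/(845*361*31)*q1*q2 +
    ((17*1000+542)*1000+784)/(845*169*361*31)*q1 + 351/(361*31)*q2^+2 -
    (206*1000+144)/(845*361*31)*q2 - ((10*1000+295)*1000+488)/(845*169*361*31)).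
  by apply: (linear_elim (c1 := (7/(93))) (c2 := ( - 1/(93))) (HA 4%N) (HB 4%N)); rec_norm;
    rewrite ?(a0,b0,b1E,a1E,b2E,a2E,b3E,a3E); field.
have za9 : a 9%N = 0 by exact: a_0.
have za10 : a 10%N = 0 by exact: a_0.
have zb6 : b 6%N = 0 by exact: b_0.
have zb7 : b 7%N = 0 by exact: b_0.
have zb8 : b 8%N = 0 by exact: b_0.
have zb9 : b 9%N = 0 by exact: b_0.
have zb10 : b 10%N = 0 by exact: b_0.
have a8E : a 8%N = - q2 * b 5%N.
  by apply: (linear_elim (c1 := (0)) (c2 := (1/7)) (HA 8%N) (HB 8%N)); rec_norm;
    rewrite ?(za9,za10,zb6,zb7,zb8,zb9,zb10); field.
have b5E : b 5%N = q2 ^+ 2.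
  apply: (mulfI b50); have := HA 10%N.
  rec_norm; rewrite za9 za10 zb6 zb7 zb8 zb9 zb10 a8E => h.
  by apply: (linear_elim (c1 := 1/7) (c2 := 0) h (erefl 0)); field.
have tb4E : b 4%N = (16/(13)*q1*q2 + 5/(13)*q2^+2).
  by apply: (linear_elim (c1 := (7/(78)*q2^-2)) (c2 := ( - 5/(78)*q2^-1)) (HA 9%N) (HB 7%N)); rec_norm;
    rewrite ?(za9,za10,zb6,zb7,zb8,zb9,zb10,b5E,a8E); field.
have ta7E : a 7%N = ( - 24/(13)*q1*q2^+2 - 14/(13)*q2^+3).
  by apply: (linear_elim (c1 := ( - 2/(39)*q2^-1)) (c2 := (7/(39))) (HA 9%N) (HB 7%N)); rec_norm;
    rewrite ?(za9,za10,zb6,zb7,zb8,zb9,zb10,b5E,a8E); field.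
have tb3E : b 3%N = (736/(169*19)*q1^+2 + (1*1000+240)/(169*19)*q1*q2 - 128/(169*19)*q2^+2 + 18/(19)*q2).
  by apply: (linear_elim (c1 := (7/(95)*q2^-2)) (c2 := ( - 3/(95)*q2^-1)) (HA 8%N) (HB 6%N)); rec_norm;
    rewrite ?(za9,za10,zb6,zb7,zb8,zb9,zb10,b5E,a8E,ta7E,tb4E); field.
have ta6E : a 6%N = ( - (2*1000+928)/(169*19)*q1^+2*q2 - (5*1000+964)/(169*19)*q1*q2^+2 -
    511/(169*19)*q2^+3 - 27/(19)*q2^+2).
  by apply: (linear_elim (c1 := ( - 1/(95)*q2^-1)) (c2 := (14/(95))) (HA 8%N) (HB 6%N)); rec_norm;
    rewrite ?(za9,za10,zb6,zb7,zb8,zb9,zb10,b5E,a8E,ta7E,tb4E); field.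
have tb2E : b 2%N = ( - (3*1000+456)/(845*247)*q1^+3*q2^-1 + (5*1000+184)/(845*247)*q1^+2 -
    (1*1000+600)/(169*247)*q1*q2 + 24/(95)*q1 + (3*1000+136)/(845*247)*q2^+2 + 26/(95)*q2).
  by apply: (linear_elim (c1 := (7/(100)*q2^-2)) (c2 := ( - 1/(100)*q2^-1)) (HA 7%N) (HB 5%N)); rec_norm;
    rewrite ?(za9,za10,zb6,zb7,zb8,zb9,zb10,b5E,a8E,ta7E,tb4E,ta6E,tb3E); field.
have ta5E : a 5%N = ( - (14*1000+656)/(845*247)*q1^+3 - (168*1000+336)/(845*247)*q1^+2*q2 -
    (9*1000+156)/(169*247)*q1*q2^+2 - (1*1000+548)/(65*19)*q1*q2 + 896/(845*247)*q2^+3 -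
    (1*1000+722)/(65*19)*q2^+2).
  by apply: (linear_elim (c1 := (1/(50)*q2^-1)) (c2 := (7/(50))) (HA 7%N) (HB 5%N)); rec_norm;
    rewrite ?(za9,za10,zb6,zb7,zb8,zb9,zb10,b5E,a8E,ta7E,tb4E,ta6E,tb3E); field.
have tb1E : b 1%N = (((6*1000+690)*1000+816)/(845*169*361*31)*q1^+4*q2^-2 -
    (150*1000+336)/(845*169*361*31)*q1^+3*q2^-1 - (70*1000+912)/(845*169*361*31)*q1^+2 -
    (276*1000+912)/(845*361*31)*q1^+2*q2^-1 + ((17*1000+542)*1000+784)/(845*169*361*31)*q1*q2 -
    (110*1000+384)/(845*361*31)*q1 - ((10*1000+295)*1000+488)/(845*169*361*31)*q2^+2 -
    (206*1000+144)/(845*361*31)*q2 + 351/(361*31)).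
  by apply: (linear_elim (c1 := (7/(93)*q2^-2)) (c2 := (1/(93)*q2^-1)) (HA 6%N) (HB 4%N)); rec_norm;
    rewrite ?(za9,za10,zb6,zb7,zb8,zb9,zb10,b5E,a8E,ta7E,tb4E,ta6E,tb3E,ta5E,tb2E); field.
clear -b1E tb1E b2E tb2E b3E tb3E b4E tb4E q20.
have e1 : q2 ^+ 2 * b 1%N - q2 ^+ 2 * b 1%N = ( - ((6*1000+690)*1000+816)/(845*169*361*31)*q1^+4 +
    (150*1000+336)/(845*169*361*31)*q1^+3*q2 + (70*1000+912)/(845*169*361*31)*q1^+2*q2^+2 +
    (276*1000+912)/(845*361*31)*q1^+2*q2 - ((17*1000+542)*1000+784)/(845*169*361*31)*q1*q2^+3 +
    ((11*1000+749)*1000+24)/(845*361*31)*q1*q2^+2 + ((10*1000+295)*1000+488)/(845*169*361*31)*q2^+4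
    + (206*1000+144)/(845*361*31)*q2^+3 + (51*1000+392)/(247*589)*q2^+2) by rewrite {1}b1E tb1E;
    field.
rewrite subrr in e1.
have e2 : q2 * b 2%N - q2 * b 2%N = ((3*1000+456)/(845*247)*q1^+3 + (42*1000+656)/(845*247)*q1^+2*q2
    + (1*1000+600)/(169*247)*q1*q2^+2 + (2*1000+144)/(845*19)*q1*q2 - (3*1000+136)/(845*247)*q2^+3 +
    64/(95)*q2^+2 - 128/(169*19)*q2) by rewrite {1}b2E tb2E; field.
rewrite subrr in e2.
have e3 : b 3%N - b 3%N = ( - (3*1000+456)/(845*247)*q1^+3 - (42*1000+656)/(845*247)*q1^+2 -
    (2*1000+144)/(845*19)*q1*q2 - (1*1000+600)/(169*247)*q1 + 128/(169*19)*q2^+2 - 64/(95)*q2 +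
    (3*1000+136)/(845*247)) by rewrite {1}b3E tb3E; field.
rewrite subrr in e3.
have e4 : b 4%N - b 4%N = (((6*1000+690)*1000+816)/(845*169*361*31)*q1^+4 -
    (150*1000+336)/(845*169*361*31)*q1^+3 - (276*1000+912)/(845*361*31)*q1^+2*q2 -
    (70*1000+912)/(845*169*361*31)*q1^+2 - ((11*1000+749)*1000+24)/(845*361*31)*q1*q2 +
    ((17*1000+542)*1000+784)/(845*169*361*31)*q1 - (51*1000+392)/(247*589)*q2^+2 -
    (206*1000+144)/(845*361*31)*q2 - ((10*1000+295)*1000+488)/(845*169*361*31)) by rewrite {1}b4E
    tb4E; field.
rewrite subrr in e4.
(* The value 1 is treated apart because [hM] is the sum of [e2] and [e3] divided by q2 - 1, up to a
   constant. *)
have [q21|q21] := eqVneq q2 1.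
  have : (1 : K) = 0.
    by apply: (linear_elim (c1 := - (((139*1000+187)*1000+389)/(637*169*589*379)*q1^+3 -
        ((4*1000+732)*1000+755)/(224*91*169*589*379)*q1^+2 -
        ((((4*1000+673)*1000+932)*1000+304)*1000+143)/(384*441*169*247*31*379)*q1 -
        ((((71*1000+760)*1000+657)*1000+417)*1000+733)/(576*147*169*247*31*379))) (c2 := -
        (((1*1000+150)*1000+309)/(784*169*379)*q1^+2 +
        (((1*1000+536)*1000+21)*1000+289)/(576*147*169*379)*q1 +
        ((985*1000+521)*1000+749)/(576*147*169*379))) e3 e4); rewrite q21; field.
  by move/eqP; rewrite oner_eq0.
have hM : (1*1000+333)*q1^+2 + 250*q1*(q2+1) - 98*(q2+1)^+2 + (4*1000+752)*q2 = 0.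
  apply: (mulfI (_ : q2 - 1 != 0)); first by rewrite subr_eq0.
  by apply: (linear_elim (c1 := ( - (208*1000+715)/(32))) (c2 := ( - (208*1000+715)/(32))) e2 e3); field.
have hN : 4*q1^+3 + 23*q1*q2 - 6*q2*(q2+1) = 0.
  by apply: (linear_elim (c1 := ((208*1000+715)/(864))) (c2 := ( - 1/(27))) e3 hM); field.
(* The combination e4 - e1 / q2 of two relations which the inversion exchanges up to sign and a
   power of q2. *)
have e14 : 0 + (( - 1)) / q2 * 0 = (((6*1000+690)*1000+816)/(845*169*361*31)*q1^+4 -
    (150*1000+336)/(845*169*361*31)*q1^+3 - (276*1000+912)/(845*361*31)*q1^+2*q2 -
    (70*1000+912)/(845*169*361*31)*q1^+2 - ((11*1000+749)*1000+24)/(845*361*31)*q1*q2 +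
    ((17*1000+542)*1000+784)/(845*169*361*31)*q1 - (51*1000+392)/(247*589)*q2^+2 -
    (206*1000+144)/(845*361*31)*q2 - ((10*1000+295)*1000+488)/(845*169*361*31)) + (( - 1)) / q2 * (
    - ((6*1000+690)*1000+816)/(845*169*361*31)*q1^+4 + (150*1000+336)/(845*169*361*31)*q1^+3*q2 +
    (70*1000+912)/(845*169*361*31)*q1^+2*q2^+2 + (276*1000+912)/(845*361*31)*q1^+2*q2 -
    ((17*1000+542)*1000+784)/(845*169*361*31)*q1*q2^+3 +
    ((11*1000+749)*1000+24)/(845*361*31)*q1*q2^+2 + ((10*1000+295)*1000+488)/(845*169*361*31)*q2^+4
    + (206*1000+144)/(845*361*31)*q2^+3 + (51*1000+392)/(247*589)*q2^+2) by rewrite {1}e4 {1}e1.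
have hH : (-((5*1000+333)*1000+827))*q1^+2*(q2+1) + (((1*1000+723)*1000+688))*q1*(q2+1)^+2 +
    (-((250*1000+282)*1000+926))*q1*q2 + (-(643*1000+468))*(q2+1)^+3 +
    (-((35*1000+559)*1000+0))*q2*(q2+1) = 0.
  by apply: (linear_elim (c1 := - (((((1*1000+598)*1000+130)*1000+755)/(16)))) (c2 := ( -
      (104*1000+544)*q1 - (104*1000+544)*q1*q2^-1 + (4*1000+698))) e14 hN); field.
have [q10 s0] := cubic_forms_coprime hM hN hH.
have : (1 : K) = 0.
  by apply: (linear_elim (c1 := - 1/(99*48)) (c2 := 1 - 49/(54*44)*(q2+1)) hM s0); rewrite q10; field.
by move/eqP; rewrite oner_eq0.
Qed.
End Recursion.

Section Triads.
Variable K : numClosedFieldType.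
Implicit Types (a b : nat -> K).

Lemma lform_normal (p q r u : option K) : p != q -> p != r -> q != r -> u != p ->
  exists al s, [/\ al != 0, lform p q r u = al *: (1 + s *: 'X) & u != q -> s != 0].
Proof.
move=> pq pr qr up; set al := pform r (pvec q).1 (pvec q).2 * pform u (pvec p).1 (pvec p).2.
have al0 : al != 0 by rewrite mulf_neq0 ?pform_pvec// eq_sym.
exists al, (pform r (pvec p).1 (pvec p).2 * pform u (pvec q).1 (pvec q).2 / al); split=> //.
  by rewrite /lform -/al scalerDr alg_polyC scalerA mulrCA divff// mulr1 addrC.
by move=> uq; rewrite !mulf_neq0 ?invr_eq0// pform_pvec// eq_sym.
Qed.

(** A and B are the products over the fibres of orders 2 and 3, normalised at the point [p] moved to
    0. The final size hypothesis says that A times the quadratic has degree at most 2 deg B, as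
    [ode_equations] needs. A common root of the quadratic and B would also be a root of A, which
    coprimality forbids. *)
Lemma triad_ode_rec d (p q r : option K) (c0 c1 c c2 e2 : K) (L0 L1 : seq (option K)) s1 f2 n e q1 q2 lam :
  p != q -> p != r -> q != r ->
  fcover d [:: Fibre 2 c0 [::] L0; Fibre 3 c1 s1 L1; f2] ->
  p \in fpoints f2 -> q \in fpoints f2 ->
  \prod_(s <- s1) lform p q r s.1 ^+ s.2 = c *: (1 + lam *: 'X) -> c != 0 ->
  pval p q r f2 = c2 *: ('X ^+ n * (e2 *: (1 + q1 *: 'X + q2 *: 'X^2)) ^+ e) -> e2 != 0 ->
  (0 < n)%N -> (0 < e)%N ->
  (size L0 + (size ((1 : {poly K}) + q1 *: 'X + q2 *: 'X^2)%R).-1 <= 2 * size L1)%N ->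
  exists a b, [/\ ode_rec n e q1 q2 lam a b,
    forall i, (size L0 < i)%N -> a i = 0, forall i, (size L1 < i)%N -> b i = 0,
    b (size L1) != 0
    & forall x, 1 + q1 * x + q2 * x ^+ 2 = 0 -> \sum_(i < (size L1).+1) b i * x ^+ i != 0].
Proof.
move=> pq pr qr cov pf qf s1E c_0 f2E e20 n0 e0 sz.
have := pval_sum p q r (cover_sum cov).
have /= /and3P[c00 c10 _] := cover_lead cov.
have := cover_uniq cov; rewrite /= !cat_uniq /= cats0 /fpoints /= -/(fpoints f2) => /and3P[uL0 dis01
    /and3P[uL1 dis12 _]].
rewrite !big_cons big_nil addr0 {1 2}/pval /= big_nil mul1r s1E f2E -/(lprod p q r L0) -/(lprod p q r L1).
have memL0 u : u \in fpoints f2 -> u \notin L0.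
  by move=> uf; apply: (hasPn dis01); rewrite mem_cat uf orbT.
have memL1 u : u \in fpoints f2 -> u \notin L1.
  by move=> /(hasPn dis12); rewrite /= mem_cat negb_or => /andP[].
have disL : ~~ has (mem L0) L1.
  by apply/hasPn => u uL; apply: (hasPn dis01); rewrite !mem_cat uL orbT.
set A0 := lprod p q r L0; set B0 := lprod p q r L1.
have a00 : A0.[0] != 0 by apply: lprod0 => //; apply: memL0.
have b00 : B0.[0] != 0 by apply: lprod0 => //; apply: memL1.
have sA0 : size A0 = (size L0).+1 by apply: lprod_size => //; apply: memL0.
have sB0 : size B0 = (size L1).+1 by apply: lprod_size => //; apply: memL1.
pose A := A0.[0]^-1 *: A0; pose B := B0.[0]^-1 *: B0.
have A1 : A.[0] = 1 by rewrite hornerZ mulVf.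
have B1 : B.[0] = 1 by rewrite hornerZ mulVf.
have sA : size A = (size L0).+1 by rewrite size_scale ?invr_eq0.
have sB : size B = (size L1).+1 by rewrite size_scale ?invr_eq0.
have cAB : coprimep A B.
  apply: coprimep_of_roots => x; rewrite !hornerZ => /eqP; rewrite mulf_eq0 invr_eq0 (negPf a00) /=.
  by move=> /eqP Ax; rewrite mulf_neq0 ?invr_eq0//; apply: lprod_coprime Ax.
have AE : A0 = A0.[0] *: A by rewrite scalerA divff// scale1r.
have BE : B0 = B0.[0] *: B by rewrite scalerA divff// scale1r.
clearbody A B.
pose al := c0 * A0.[0] ^+ 2; pose be := c1 * c * B0.[0] ^+ 3; pose ga := c2 * e2 ^+ e.
set l : {poly K} := 1 + lam *: 'X; set Q : {poly K} := 1 + q1 *: 'X + q2 *: 'X^2.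
have al0 : al != 0 by rewrite mulf_neq0// expf_neq0.
move: AE BE; move: (A0.[0]) (B0.[0]) @al @be al0 => a0 b0 al be al0 AE BE.
rewrite AE BE !exprZn => eqn0.
have eqn : al *: A ^+ 2 + be *: (l * B ^+ 3) + ga *: ('X ^+ n * Q ^+ e) = 0.
  rewrite -[RHS]eqn0 /al /be /ga -!mul_polyC; ring.
have l1 : l.[0] = 1 by rewrite /l hornerD hornerC hornerZ hornerX mulr0 addr0.
have Q1 : Q.[0] = 1.
  by rewrite /Q !hornerD hornerC !hornerZ hornerX hornerXn expr0n /= !mulr0 !addr0.
have B00 : B != 0 by rewrite -size_poly_eq0 sB.
have A00 : A != 0 by rewrite -size_poly_eq0 sA.
have Q00 : Q != 0 by apply: contra_eq_neq Q1 => ->; rewrite horner0 eq_sym oner_neq0.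
have sQ : (0 < size Q)%N by rewrite size_poly_gt0.
have sB2 : size (B ^+ 2) = (size L1).*2.+1.
  by rewrite expr2 size_mul// sB addSn addnS /= addnn.
have sXd (P : {poly K}) : (size ('X * P^`())%R <= size P)%N.
  have [->|P0] := eqVneq P 0; first by rewrite deriv0 mulr0 size_poly0.
  apply: leq_trans (size_polyMleq _ _) _; rewrite size_polyX /=.
  by apply: leq_trans (lt_size_deriv P0).
have sM (P1 P2 : {poly K}) : (size P1 <= size Q)%N -> (size P2 <= size A)%N ->
    (size (P1 * P2)%R <= (size L1).*2.+1)%N.
  move=> h1 h2; apply: leq_trans (size_polyMleq _ _) _.
  by move: sz h1 h2 sQ; rewrite sA -/Q; clear; lia.
have sU : (size (ode_U n e A Q) <= size (B ^+ 2)%R)%N.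
  rewrite sB2 /ode_U; apply: leq_trans (size_polyD _ _) _; rewrite geq_max size_polyN.
  apply/andP; split; apply: sM => //.
    by rewrite -polyC_natr mul_polyC; apply: size_scale_leq.
  rewrite /ode_g; apply: leq_trans (size_polyD _ _) _; rewrite geq_max -!polyC_natr !mul_polyC.
  by rewrite (leq_trans (size_scale_leq _ _))// (leq_trans (size_scale_leq _ _)).
exists (fun i => A`_i), (fun i => B`_i); split.
- split; rewrite -?horner_coef0//.
  + by move=> i; apply: (ode_recA n0 al0 cAB A1 B1 l1 Q1 eqn sU) => //.
  + by move=> i; apply: (ode_recB n0 al0 cAB A1 B1 l1 Q1 eqn sU) => //.
- by move=> i h; apply: nth_default; rewrite sA.
- by move=> i h; apply: nth_default; rewrite sB.
- by have := B00; rewrite -lead_coef_eq0 lead_coefE sB.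
move=> x Qx; rewrite -sB -horner_coef; apply/eqP => Bx.
have Qx' : Q.[x] = 0 by rewrite /Q !hornerD hornerC !hornerZ hornerX hornerXn.
have := congr1 (horner^~ x) eqn; rewrite !(Bx, Qx', hornerD, hornerZ, hornerM, horner_exp) horner0.
rewrite expr0n (gtn_eqF e0) /= !mul0r !mulr0 !addr0 => /eqP.
rewrite mulf_eq0 (negPf al0) mulf_eq0 orbb /= => Ax.
by have := coprimep_root cAB (Ax : root A x); rewrite Bx eqxx.
Qed.

Lemma size_quadratic (s t : K) : size ((1 : {poly K}) + s *: 'X + t *: 'X^2) = if t != 0 then 3%N
    else if s != 0 then 2%N else 1%N.
Proof.
have [->|t0] := eqVneq t 0; last first.
  rewrite addrC size_polyDl size_scale ?size_polyXn//.
  apply: leq_ltn_trans (size_polyD _ _) _; rewrite size_poly1 gtn_max /=.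
  by rewrite (leq_ltn_trans (size_scale_leq _ _))// size_polyX.
rewrite scale0r addr0; have [->|s0] := eqVneq s 0; first by rewrite scale0r addr0 size_poly1.
by rewrite addrC size_polyDl size_scale ?size_polyX// size_poly1.
Qed.

Lemma mul_linear (s t : K) : (1 + s *: 'X) * (1 + t *: 'X) = 1 + (s + t) *: 'X + (s * t) *: 'X^2 :> {poly K}.
Proof. by rewrite -!mul_polyC polyCD polyCM; ring. Qed.

Lemma fcover_123 d (c0 c1 c2 : K) L0 L1 u1 u2 u3 m :
  fcover d [:: Fibre 2 c0 [::] L0; Fibre 3 c1 [::] L1;
               Fibre m c2 [:: (u1, 1); (u2, 2); (u3, 3)]%N [::]] ->
  size L0 = 3 -> size L1 = 2 -> False.
Proof.
move=> cov sL0 sL1; have := cover_uniq cov.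
rewrite /= !cat_uniq => /and3P[_ _ /and3P[_ _]]; rewrite /fpoints /= !inE negb_or !andbT.
case/andP => /andP[u12 u13] u23.
have u31 : u3 != u1 by rewrite eq_sym.
have u32 : u3 != u2 by rewrite eq_sym.
have u21 : u2 != u1 by rewrite eq_sym.
have [al [s [al0 sE /(_ u21) s0]]] := lform_normal u31 u32 u12 u23.
have [c3 c30 c3E] := lform_zero u31 u32.
have [c4 c40 c4E] := lform_infinity u31 u12.
have s1E : \prod_(s <- [::]) lform u3 u1 u2 s.1 ^+ s.2 = 1 *: (1 + 0 *: 'X) :> {poly K}.
  by rewrite big_nil !scale1r scale0r addr0.
have f2E : pval u3 u1 u2 (Fibre m c2 [:: (u1, 1); (u2, 2); (u3, 3)]%N [::]) =
    (c2 * c4 * c3 ^+ 3) *: ('X ^+ 3 * (al *: (1 + s *: 'X + 0 *: 'X^2)) ^+ 2).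
  rewrite /pval /= !big_cons !big_nil expr1n sE c3E c4E -!mul_polyC; ring.
have [|||||a [b [rec _ _ b2 cop]]] := triad_ode_rec u31 u32 u12 cov _ _ s1E (oner_neq0 _) f2E al0.
- by rewrite /fpoints /= !inE eqxx ?orbT.
- by rewrite /fpoints /= !inE eqxx.
- by [].
- by [].
- by rewrite size_quadratic eqxx sL0 sL1; case: ifP.
have [b1E b2E] := ode_rec_3_2 rec.
have rec0 : b 0%N = 1 by case: rec.
have qs : 1 + s * (- s^-1) + 0 * (- s^-1) ^+ 2 = 0 by field.
have := cop _ qs; rewrite sL1 !big_ord_recl big_ord0 /= /bump /= rec0 b1E b2E => /eqP; case.
by field.
Qed.

(** The ordinary point of order 7 goes to 0 and the point of index 3 to infinity. The two simple
    points are the roots of q, whose leading coefficient would have to vanish. *)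
Lemma fcover_113 d (c0 c1 c2 : K) L0 L1 u1 u2 u3 p :
  fcover d [:: Fibre 2 c0 [::] L0; Fibre 3 c1 [::] L1;
               Fibre 7 c2 [:: (u1, 1); (u2, 1); (u3, 3)]%N [:: p]] ->
  size L0 = 6 -> size L1 = 4 -> False.
Proof.
move=> cov sL0 sL1; have := cover_uniq cov.
rewrite /= !cat_uniq => /and3P[_ _ /and3P[_ _]]; rewrite /fpoints /= !inE !negb_or !andbT.
case/and3P => /and3P[u12 u13 u1p] /andP[u23 u2p] u3p.
have p3 : p != u3 by rewrite eq_sym.
have p1 : p != u1 by rewrite eq_sym.
have u31 : u3 != u1 by rewrite eq_sym.
have [al [s [al0 sE /(_ u13) s0]]] := lform_normal p3 p1 u31 u1p.
have [be [t [be0 tE /(_ u23) t0]]] := lform_normal p3 p1 u31 u2p.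
have [c3 c30 c3E] := lform_zero p3 p1.
have [c4 c40 c4E] := lform_infinity p3 u31.
have s1E : \prod_(s <- [::]) lform p u3 u1 s.1 ^+ s.2 = 1 *: (1 + 0 *: 'X) :> {poly K}.
  by rewrite big_nil !scale1r scale0r addr0.
have f2E : pval p u3 u1 (Fibre 7 c2 [:: (u1, 1); (u2, 1); (u3, 3)]%N [:: p]) =
    (c2 * c4 ^+ 3 * c3 ^+ 7) *: ('X ^+ 7 * ((al * be) *: (1 + (s + t) *: 'X + (s * t) *: 'X^2)) ^+ 1).
  by rewrite /pval /= !big_cons !big_nil sE tE c3E c4E -mul_linear -!mul_polyC; ring.
have [|||||a [b [rec a0 b0 b4 _]]] := triad_ode_rec p3 p1 u31 cov _ _ s1E (oner_neq0 _) f2E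
    (mulf_neq0 al0 be0).
- by rewrite /fpoints /= !inE eqxx ?orbT.
- by rewrite /fpoints /= !inE eqxx ?orbT.
- by [].
- by [].
- by rewrite size_quadratic mulf_neq0// sL0 sL1.
rewrite sL0 in a0; rewrite sL1 in b0 b4.
have /eqP := ode_rec_7_1 rec a0 b0 b4.
by rewrite mulf_eq0 (negPf s0) (negPf t0).
Qed.

(** The ordinary point of order 7 goes to 0 and the simple point to infinity; the two points of
    index 2 form q^2. Each solution of the recursion gives q and B a common root. *)
Lemma fcover_122 d (c0 c1 c2 : K) L0 L1 u1 u2 u3 p :
  fcover d [:: Fibre 2 c0 [::] L0; Fibre 3 c1 [::] L1;
               Fibre 7 c2 [:: (u1, 1); (u2, 2); (u3, 2)]%N [:: p]] ->
  size L0 = 6 -> size L1 = 4 -> False.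
Proof.
move=> cov sL0 sL1; have := cover_uniq cov.
rewrite /= !cat_uniq => /and3P[_ _ /and3P[_ _]]; rewrite /fpoints /= !inE !negb_or !andbT.
case/and3P => /and3P[u12 u13 u1p] /andP[u23 u2p] u3p.
have p1 : p != u1 by rewrite eq_sym.
have p2 : p != u2 by rewrite eq_sym.
have u21 : u2 != u1 by rewrite eq_sym.
have u31 : u3 != u1 by rewrite eq_sym.
have [al [s [al0 sE /(_ u21) s0]]] := lform_normal p1 p2 u12 u2p.
have [be [t [be0 tE /(_ u31) t0]]] := lform_normal p1 p2 u12 u3p.
have [c3 c30 c3E] := lform_zero p1 p2.
have [c4 c40 c4E] := lform_infinity p1 u12.
have s1E : \prod_(s <- [::]) lform p u1 u2 s.1 ^+ s.2 = 1 *: (1 + 0 *: 'X) :> {poly K}.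
  by rewrite big_nil !scale1r scale0r addr0.
have f2E : pval p u1 u2 (Fibre 7 c2 [:: (u1, 1); (u2, 2); (u3, 2)]%N [:: p]) =
    (c2 * c4 * c3 ^+ 7) *: ('X ^+ 7 * ((al * be) *: (1 + (s + t) *: 'X + (s * t) *: 'X^2)) ^+ 2).
  by rewrite /pval /= !big_cons !big_nil sE tE c3E c4E -mul_linear -!mul_polyC; ring.
have [|||||a [b [rec a0 b0 b4 cop]]] := triad_ode_rec p1 p2 u12 cov _ _ s1E (oner_neq0 _) f2E
    (mulf_neq0 al0 be0).
- by rewrite /fpoints /= !inE eqxx ?orbT.
- by rewrite /fpoints /= !inE eqxx ?orbT.
- by [].
- by [].
- by rewrite size_quadratic mulf_neq0// sL0 sL1.
rewrite sL0 in a0; rewrite sL1 in b0 b4 cop.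
have rec0 : b 0%N = 1 by case: rec.
have {}cop x : 1 + (s + t) * x + s * t * x ^+ 2 = 0 ->
    1 + b 1%N * x + b 2%N * x ^+ 2 + b 3%N * x ^+ 3 + b 4%N * x ^+ 4 != 0.
  by move/cop; rewrite !big_ord_recr big_ord0 /= rec0 add0r !expr0 mul1r expr1.
have [H|[x qx Bx]] := ode_rec_7_2 rec a0 b0 b4 (mulf_neq0 s0 t0).
  have qs : 1 + (s + t) * (- s^-1) + s * t * (- s^-1) ^+ 2 = 0 by field.
  by have := cop _ qs; rewrite H ?eqxx.
by have := cop _ qx; rewrite Bx eqxx.
Qed.

(** The two ordinary points of order 7 go to 0 and infinity, the simple point w above the order 3
    goes to -1; this gives l = 1 + X. *)
Lemma fcover_1_11 d (c0 c1 c2 : K) L0 L1 w u1 u2 p q :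
  fcover d [:: Fibre 2 c0 [::] L0; Fibre 3 c1 [:: (w, 1)]%N L1;
               Fibre 7 c2 [:: (u1, 1); (u2, 1)]%N [:: p; q]] ->
  size L0 = 8 -> size L1 = 5 -> False.
Proof.
move=> cov sL0 sL1; have U : uniq (L0 ++ (w :: L1) ++ [:: u1; u2; p; q]) := cover_uniq cov.
move: U; rewrite !cat_uniq => /and3P[_ _ /and3P[_ dis]]; rewrite /= !inE !negb_or !andbT.
case/and3P => /and3P[u12 u1p u1q] /andP[u2p u2q] pq.
move: dis; rewrite /= !inE !negb_or => /and5P[/andP[u1w _] /andP[u2w _] /andP[pw _] /andP[qw _] _].
have [al [s [al0 sE /(_ u1q) s0]]] := lform_normal pq pw qw u1p.
have [be [t [be0 tE /(_ u2q) t0]]] := lform_normal pq pw qw u2p.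
have [c3 c30 c3E] := lform_zero pq pw.
have [c4 c40 c4E] := lform_infinity pq qw.
have [c5 c50 c5E] := lform_minus1 pw qw.
have s1E : \prod_(s <- [:: (w, 1%N)]) lform p q w s.1 ^+ s.2 = c5 *: (1 + 1 *: 'X) :> {poly K}.
  by rewrite big_cons big_nil mulr1 expr1 c5E scale1r addrC.
have f2E : pval p q w (Fibre 7 c2 [:: (u1, 1); (u2, 1)]%N [:: p; q]) =
    (c2 * c4 ^+ 7 * c3 ^+ 7) *: ('X ^+ 7 * ((al * be) *: (1 + (s + t) *: 'X + (s * t) *: 'X^2)) ^+ 1).
  by rewrite /pval /= !big_cons !big_nil sE tE c3E c4E -mul_linear -!mul_polyC; ring.
have [|||||a [b [rec a0 b0 b5 _]]] := triad_ode_rec pq pw qw cov _ _ s1E c50 f2E (mulf_neq0 al0 be0).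
- by rewrite /fpoints /= !inE eqxx ?orbT.
- by rewrite /fpoints /= !inE eqxx ?orbT.
- by [].
- by [].
- by rewrite size_quadratic mulf_neq0// sL0 sL1.
rewrite sL0 in a0; rewrite sL1 in b0 b5.
exact: (no_ode_rec_7_1_1 rec a0 b0 b5 (mulf_neq0 s0 t0)).
Qed.

(** Here the large power is the cube of the ordinary point p: two squares of degree at most 4 would
    add up to a multiple of X^3, and 3 exceeds half of that degree. *)
Lemma fcover_1_22 d (c0 c1 c2 : K) L0 w p u1 u2 m :
  fcover d [:: Fibre 2 c0 [::] L0; Fibre 3 c1 [:: (w, 1)]%N [:: p];
               Fibre m c2 [:: (u1, 2); (u2, 2)]%N [::]] ->
  size L0 = 2 -> False.
Proof.
move=> cov sL0; have := cover_uniq cov.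
have /= /and4P[c00 c10 c20 _] := cover_lead cov.
rewrite /= !cat_uniq /= /fpoints /= !inE !negb_or !andbT => /and3P[_ dis /and3P[wp out u12]].
have /andP[p1 p2] := out; have /and3P[_ wu1 wu2] := wp; have /and4P[_ pL0 uL0 _] := dis.
have [c3 c30 c3E] := lform_zero p1 p2.
have [c4 c40 c4E] := lform_infinity p1 u12.
have := pval_sum p u1 u2 (cover_sum cov).
rewrite !big_cons big_nil addr0 /pval /= !big_cons !big_nil !mul1r !mulr1 c3E c4E.
rewrite -/(lprod p u1 u2 L0) => E.
have two : 2%:R != 0 :> K by rewrite pnatr_eq0.
apply: (@no_squares_sum _ (lprod p u1 u2 L0) (lform p u1 u2 u2) (lform p u1 u2 w)
  c0 (c2 * c4 ^+ 2) (c1 * c3 ^+ 3) 3 2 c00) => //.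
- by rewrite mulf_neq0// expf_neq0.
- by rewrite mulf_neq0// expf_neq0.
- by rewrite -size_poly_eq0 lform_size// eq_sym.
- exact: lprod0.
- by rewrite lprod_size// sL0.
- by rewrite lform_size// eq_sym.
by rewrite -[RHS]E /= ?expr1n -!mul_polyC; ring.
Qed.

(** A fourth power is a square, so this is again a difference of squares, now with X^5 and factors
    of degree at most 4. *)
Lemma fcover_111 d (c0 c1 c2 : K) L0 L1 p u1 u2 u3 :
  fcover d [:: Fibre 2 c0 [::] L0; Fibre 4 c1 [::] L1;
               Fibre 5 c2 [:: (u1, 1); (u2, 1); (u3, 1)]%N [:: p]] ->
  size L0 = 4 -> size L1 = 2 -> False.
Proof.
move=> cov sL0 sL1; have := cover_uniq cov.
have /= /and4P[c00 c10 c20 _] := cover_lead cov.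
rewrite /= !cat_uniq /= /fpoints /= !inE !negb_or !andbT => /and3P[_ dis /and3P[_ dis1 u]].
have /and3P[/and3P[u12 u13 u1p] /andP[u23 u2p] u3p] := u.
have p1 : p != u1 by rewrite eq_sym.
have p2 : p != u2 by rewrite eq_sym.
have pL0 : p \notin L0.
  by apply: contra dis => pL; apply/hasP; exists p; rewrite //= ?mem_cat !inE eqxx ?orbT.
have uL0 : u1 \notin L0.
  by apply: contra dis => pL; apply/hasP; exists u1; rewrite //= ?mem_cat !inE eqxx ?orbT.
have /and4P[uL1 _ _ _] := dis1.
have [c3 c30 c3E] := lform_zero p1 p2.
have [c4 c40 c4E] := lform_infinity p1 u12.
have := pval_sum p u1 u2 (cover_sum cov).
rewrite !big_cons big_nil addr0 /pval /= !big_cons !big_nil !mul1r !mulr1 c3E c4E.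
rewrite -/(lprod p u1 u2 L0) -/(lprod p u1 u2 L1) => E.
have two : 2%:R != 0 :> K by rewrite pnatr_eq0.
have sB : size (lprod p u1 u2 L1) = 3 by rewrite lprod_size// sL1.
have B0 : lprod p u1 u2 L1 != 0 by rewrite -size_poly_eq0 sB.
have nz v : v != u1 -> lform p u1 u2 v != 0 by move=> v1; rewrite -size_poly_eq0 lform_size.
apply: (@no_squares_sum _ (lprod p u1 u2 L0) (lprod p u1 u2 L1 ^+ 2)
  (lform p u1 u2 u2 * lform p u1 u2 u3) c0 c1 (c2 * c4 * c3 ^+ 5) 5 4 c00) => //.
- by rewrite !mulf_neq0// expf_neq0.
- by rewrite mulf_neq0// nz// eq_sym.
- exact: lprod0.
- by rewrite lprod_size// sL0.
- by rewrite expr2 size_mul// sB.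
by rewrite -[RHS]E /= ?expr1n -!mul_polyC; ring.
Qed.

End Triads.

(** * Enumeration of the branching patterns *)

(** Compositions of S into n positive parts. *)
Fixpoint comps (n S : nat) : seq (seq nat) :=
  if n is n'.+1 then flatten [seq [seq a :: r | r <- comps n' (S - a)] | a <- iota 1 S]
  else if S == 0%N then [:: [::]] else [::].

Lemma mem_comps (o : seq nat) : all (leq 1) o -> o \in comps (size o) (sumn o).
Proof.
elim: o => [|a o IH] //= /andP[a0 /IH o_in].
apply/flatten_mapP; exists a; first by rewrite mem_iota a0 add1n ltnS leq_addr.
by apply: map_f; rewrite addKn.
Qed.

(* Branching data (degree, orders [k], special ramification indices in the
   three fibres) satisfying the Riemann-Hurwitz count; 0 stands for any order. *)
Definition branch_patterns : seq (nat * seq nat * seq (seq nat)) := [::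
  (2, [:: 2; 0; 0], [:: [::]; [:: 1; 1]; [:: 2]]);
  (2, [:: 2; 0; 0], [:: [::]; [:: 2]; [:: 1; 1]]);
  (3, [:: 3; 3; 0], [:: [::]; [::]; [:: 1; 1; 1]]);
  (3, [:: 2; 3; 0], [:: [:: 1]; [::]; [:: 1; 2]]);
  (4, [:: 2; 4; 0], [:: [::]; [::]; [:: 1; 1; 2]]);
  (4, [:: 2; 3; 0], [:: [::]; [:: 1]; [:: 1; 3]]);
  (4, [:: 2; 3; 0], [:: [::]; [:: 1]; [:: 2; 2]]);
  (6, [:: 2; 3; 0], [:: [::]; [::]; [:: 1; 1; 4]]);
  (6, [:: 2; 3; 0], [:: [::]; [::]; [:: 1; 2; 3]]);
  (6, [:: 2; 3; 0], [:: [::]; [::]; [:: 2; 2; 2]]);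
  (6, [:: 2; 4; 5], [:: [::]; [:: 1; 1]; [:: 1]]);
  (8, [:: 2; 4; 5], [:: [::]; [::]; [:: 1; 1; 1]]);
  (8, [:: 2; 3; 7], [:: [::]; [:: 1; 1]; [:: 1]]);
  (9, [:: 2; 3; 7], [:: [:: 1]; [::]; [:: 1; 1]]);
  (10, [:: 2; 3; 8], [:: [::]; [:: 1]; [:: 1; 1]]);
  (10, [:: 2; 3; 7], [:: [::]; [:: 1]; [:: 1; 2]]);
  (12, [:: 2; 3; 9], [:: [::]; [::]; [:: 1; 1; 1]]);
  (12, [:: 2; 3; 8], [:: [::]; [::]; [:: 1; 1; 2]]);
  (12, [:: 2; 3; 7], [:: [::]; [::]; [:: 1; 1; 3]]);
  (12, [:: 2; 3; 7], [:: [::]; [::]; [:: 1; 2; 2]]);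
  (16, [:: 2; 3; 7], [:: [::]; [:: 1]; [:: 1; 1]]);
  (18, [:: 2; 3; 7], [:: [::]; [::]; [:: 1; 1; 2]]);
  (24, [:: 2; 3; 7], [:: [::]; [::]; [:: 1; 1; 1]])]%N.

Definition matches d (ks : seq nat) (os : seq (seq nat))
    (pat : nat * seq nat * seq (seq nat)) : bool :=
  let: (d', ks', os') := pat in
  [&& d == d', all2 (fun c k => (c == 0) || (c == k))%N ks' ks & all2 perm_eq os os'].

(** The value 43 represents all orders above 42, for which the condition retained is 1/k0 + 1/k1 <
    1. *)
Definition hyperbolic_cap (k0 k1 k2 : nat) : bool :=
  if (k2 <= 42)%N then (k0 * k1 + k0 * k2 + k1 * k2 < k0 * k1 * k2)%N else (k0 + k1 < k0 * k1)%N.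

(** The number of ordinary points of the third fibre is determined by Riemann-Hurwitz and its number
    of special points by their total. Cheap tests come before the compositions, which keeps the
    evaluation feasible. *)
Definition enumerate : bool :=
  all (fun d => all (fun k0 => all (fun k1 => all (fun k2 =>
    if (d.-1 <= d %/ k0 + d %/ k1 + d %/ k2)%N then
      if hyperbolic_cap k0 k1 k2 then
        all (fun t0 => all (fun t1 =>
          if (t0 + t1 <= d.-1)%N && (k2 * (d.-1 - t0 - t1) <= d)%N then
            all (fun n0 => all (fun n1 =>
              all (fun o0 => all (fun o1 => all (fun o2 =>
                has (matches d [:: k0; k1; k2] [:: o0; o1; o2]) branch_patterns)
              (comps (3 - n0 - n1) (d - k2 * (d.-1 - t0 - t1)))) (comps n1 (d - k1 * t1)))
              (comps n0 (d - k0 * t0))) (iota 0 (4 - n0))) (iota 0 4)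
          else true)
        (iota 0 (d %/ k1).+1)) (iota 0 (d %/ k0).+1)
      else true
    else true)
  (iota k1 (44 - k1))) (iota k0 (44 - k0))) (iota 2 42)) (iota 2 41).

Lemma enumerateP : enumerate.
Proof. by vm_compute. Qed.

(** The gap 1 - 1/k0 - 1/k1 - 1/k2 is at least 1/42. Small k0 and k1 are separated; in the other
    cases writing the orders as a lower bound plus a nonnegative remainder makes the inequality
    evident term by term. *)
Lemma hyperbolic_42 (k0 k1 k2 : nat) : (0 < k0)%N -> (k0 <= k1)%N -> (k1 <= k2)%N ->
  (k0 * k1 + k0 * k2 + k1 * k2 < k0 * k1 * k2)%N ->
  [/\ (2 <= k0)%N, (k0 + k1 < k0 * k1)%N &
    (42 * (k0 * k1 + k0 * k2 + k1 * k2) <= 41 * (k0 * k1 * k2))%N].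
Proof.
move=> h0 h1 h2 h.
have k02 : (2 <= k0)%N by case: k0 h0 h1 h => [|[|k]] //= _ _; rewrite !mul1n; lia.
have h3 : (k0 + k1 < k0 * k1)%N by nia.
split=> //; clear h0.
have [k0E|k0b] := eqVneq k0 2.
  rewrite k0E in h h1 *; have k13 : (3 <= k1)%N by lia.
  have [k1E|k1b] := eqVneq k1 3; first by rewrite k1E in h h2 *; lia.
  have [k1E|k1c] := eqVneq k1 4; first by rewrite k1E in h h2 *; lia.
  have k15 : (5 <= k1)%N by lia.
  have [j1 j1E] : exists j, k1 = (5 + j)%N by exists (k1 - 5)%N; lia.
  have [j2 j2E] : exists j, k2 = (5 + j1 + j)%N by exists (k2 - (5 + j1))%N; lia.
  rewrite j2E j1E; clear; nia.
have [k0E|k0c] := eqVneq k0 3.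
  rewrite k0E in h h1 *.
  have [k1E|k1b] := eqVneq k1 3; first by rewrite k1E in h h2 *; lia.
  have [j1 j1E] : exists j, k1 = (4 + j)%N by exists (k1 - 4)%N; lia.
  have [j2 j2E] : exists j, k2 = (4 + j1 + j)%N by exists (k2 - (4 + j1))%N; lia.
  rewrite j2E j1E; clear; nia.
have [j0 j0E] : exists j, k0 = (4 + j)%N by exists (k0 - 4)%N; lia.
have [j1 j1E] : exists j, k1 = (4 + j0 + j)%N by exists (k1 - (4 + j0))%N; lia.
have [j2 j2E] : exists j, k2 = (4 + j0 + j1 + j)%N by exists (k2 - (4 + j0 + j1))%N; lia.
rewrite j2E j1E j0E; clear; nia.
Qed.

Lemma enumeration (d k0 k1 k2 t0 t1 t2 : nat) (o0 o1 o2 : seq nat) :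
  (2 <= d)%N -> (0 < k0)%N -> (k0 <= k1)%N -> (k1 <= k2)%N ->
  (k0 * k1 + k0 * k2 + k1 * k2 < k0 * k1 * k2)%N ->
  d = (sumn o0 + k0 * t0)%N -> d = (sumn o1 + k1 * t1)%N -> d = (sumn o2 + k2 * t2)%N ->
  all (leq 1) o0 -> all (leq 1) o1 -> all (leq 1) o2 ->
  (size o0 + size o1 + size o2 = 3)%N -> (t0 + t1 + t2).+1 = d ->
  has (matches d [:: k0; k1; k2] [:: o0; o1; o2]) branch_patterns.
Proof.
move=> d2 k0p k01 k12 hyp E0 E1 E2 p0 p1 p2 sz ht.
have [k02 k0k1 h42] := hyperbolic_42 k0p k01 k12 hyp.
(* Counting ordinary points gives d - 1 <= d (1/k0 + 1/k1 + 1/k2) <= 41 d / 42. *)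
have d42 : (d <= 42)%N.
  have m0 : (k0 * t0 <= d)%N by rewrite {1}E0 leq_addl.
  have m1 : (k1 * t1 <= d)%N by rewrite {1}E1 leq_addl.
  have m2 : (k2 * t2 <= d)%N by rewrite {1}E2 leq_addl.
  have kp : (0 < k0 * k1 * k2)%N by rewrite !muln_gt0; clear -k02 k01 k12; lia.
  have : (k0 * k1 * k2 * d.-1 <= (k0 * k1 + k0 * k2 + k1 * k2) * d)%N.
    rewrite -ht /=.
    have -> : (k0 * k1 * k2 * (t0 + t1 + t2) = k0 * k1 * (k2 * t2) + k0 * k2 * (k1 * t1) + k1 * k2 *
        (k0 * t0))%N by ring.
    by rewrite ht !mulnDl !leq_add// leq_mul.
  rewrite -(leq_pmul2l kp) -(leq_pmul2l (isT : 0 < 42)%N).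
  move=> hd; have := leq_mul h42 (leqnn d); move: hd d2 kp.
  move: (k0 * k1 + k0 * k2 + k1 * k2)%N (k0 * k1 * k2)%N => S P; clear.
  case: d => // d /= hd _ kp h; nia.
(* A fibre of order k > 42 >= d has no ordinary point, so replacing k by 43 changes no degree
   equation. *)
pose c k := minn k 43.
have big k t o : d = (sumn o + k * t)%N -> d = (sumn o + c k * t)%N.
  rewrite /c => E; have [k43|k43] := leqP k 43; first by rewrite [LHS]E; lia.
  by rewrite [LHS]E; case: t E => [|t] E; [rewrite !muln0 | exfalso; nia].
have := enumerateP; rewrite /enumerate => /allP/(_ d).
rewrite mem_iota d2 (_ : (d < 2 + 41)%N) => [/(_ isT)|]; last by rewrite ltnS.
move=> /allP/(_ (c k0)); rewrite mem_iota (_ : (2 <= c k0 < 2 + 42)%N) => [/(_ isT)|]; last by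
    rewrite /c; move: k02 k01 k12; clear; lia.
move=> /allP/(_ (c k1)); rewrite mem_iota (_ : (c k0 <= c k1 < c k0 + (44 - c k0))%N) => [/(_
    isT)|]; last by rewrite /c; move: k02 k01 k12; clear; lia.
move=> /allP/(_ (c k2)); rewrite mem_iota (_ : (c k1 <= c k2 < c k1 + (44 - c k1))%N) => [/(_
    isT)|]; last by rewrite /c; move: k02 k01 k12; clear; lia.
have cp k : (2 <= k)%N -> (0 < c k)%N by rewrite /c; lia.
have tle k t o : (2 <= k)%N -> d = (sumn o + k * t)%N -> (t <= d %/ c k)%N.
  by move=> k2p /big E; rewrite leq_divRL ?cp// mulnC [leqRHS]E leq_addl.
have l0 := tle _ _ _ k02 E0; have l1 := tle _ _ _ (leq_trans k02 k01) E1.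
have l2 := tle _ _ _ (leq_trans k02 (leq_trans k01 k12)) E2.
rewrite ifT; last by rewrite -ht /= !leq_add// ht.
rewrite ifT; last first.
  rewrite /hyperbolic_cap /c; case: (leqP (minn k2 43) 42) => h.
    have k2s : (k2 <= 42)%N by move: h; clear; lia.
    have me k : (k <= k2)%N -> minn k 43 = k by move: k2s; clear; lia.
    by rewrite !me// (leq_trans k01).
  have k02' : (2 <= minn k0 43)%N by move: k02; clear; lia.
  have [k143|k143] := leqP k1 43.
    by rewrite (minn_idPl (leq_trans k01 k143)).
  by move: k02'; move: (minn k0 43) => k; clear; lia.
move=> /allP/(_ t0); rewrite mem_iota leq0n add0n ltnS l0 => /(_ isT).
move=> /allP/(_ t1); rewrite mem_iota leq0n add0n ltnS l1 => /(_ isT).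
have -> : (d.-1 - t0 - t1 = t2)%N by rewrite -ht /=; clear; lia.
rewrite ifT; last by rewrite {2}(big _ _ _ E2) leq_addl andbT -ht /= leq_addr.
have [z0 z1 z2] : [/\ (0 <= size o0 < 0 + 4)%N, (0 <= size o1 < 0 + (4 - size o0))%N &
    (3 - size o0 - size o1 = size o2)%N] by move: sz; clear; split; lia.
move=> /allP/(_ (size o0)); rewrite mem_iota z0 => /(_ isT).
move=> /allP/(_ (size o1)); rewrite mem_iota z1 => /(_ isT).
have e0 : (d - c k0 * t0 = sumn o0)%N by rewrite {1}(big _ _ _ E0) addnK.
have e1 : (d - c k1 * t1 = sumn o1)%N by rewrite {1}(big _ _ _ E1) addnK.
have e2 : (d - c k2 * t2 = sumn o2)%N by rewrite {1}(big _ _ _ E2) addnK.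
rewrite z2 e0 e1 e2.
move=> /allP/(_ _ (mem_comps p0))/allP/(_ _ (mem_comps p1))/allP/(_ _ (mem_comps p2)).
have eqc a k : (a < 43)%N -> (a == c k) = (a == k) by rewrite /c; clear; move=> a43; apply/eqP/eqP; lia.
by rewrite /= !eqc.
Qed.

(** A rearrangement of values comes from a rearrangement of arguments, without injectivity: points
    can be reordered through their indices, fibres through their orders. *)
Lemma perm_eq_map_lift (T1 T2 : eqType) (f : T1 -> T2) s t :
  perm_eq (map f s) t -> exists2 s', perm_eq s s' & t = map f s'.
Proof.
elim: t s => [|y t IH] s pe.
  exists [::]; last by [].
  by case: s pe => // x s /perm_size.
have : y \in map f s by rewrite (perm_mem pe) mem_head.
case/mapP => x xs yE; have := perm_to_rem xs => px.
have : perm_eq (map f (rem x s)) t.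
  by rewrite -(perm_cons y) {1}yE; apply: perm_trans pe; rewrite perm_sym (perm_map f px).
case/IH => s' ps' ->; exists (x :: s'); last by rewrite yE.
by rewrite (perm_trans px)// perm_cons.
Qed.

Section Respec.
Variable K : numClosedFieldType.
Implicit Types (f g : fibre K) (fs : seq (fibre K)).

Lemma fcover_respec d k c s s' L fs : perm_eq s s' ->
  fcover d (Fibre k c s L :: fs : seq (fibre K)) -> fcover d (Fibre k c s' L :: fs).
Proof.
move=> pe [h1 h2 h3 h4 h5 h6 h7]; split=> //.
- move=> x y; have := h1 x y; rewrite !big_cons /fval /= => E; rewrite -[RHS]E.
  by rewrite (perm_big _ pe).
- move: h3; rewrite /= /fpoints /=; apply: etrans; apply: perm_uniq.
  by rewrite perm_cat2r perm_cat2r perm_map// perm_sym.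
- move: h4 => /= /andP[h4 ->]; rewrite andbT; move: h4; rewrite /fdeg /= !sumnE.
  by rewrite (perm_big _ (perm_map snd pe)).
- by move: h5 => /=; rewrite (perm_all _ pe).
- by move: h6; rewrite /= !size_cat (perm_size pe).
Qed.

Definition orders f := [seq s.2 | s <- fspec f].

Lemma fcover_orders d f0 f1 f2 os : fcover d [:: f0; f1; f2] ->
  all2 perm_eq [seq orders f | f <- [:: f0; f1; f2]] os ->
  exists gs : seq (fibre K), [/\ fcover d gs, [seq fk g | g <- gs] = [:: fk f0; fk f1; fk f2] &
    [seq orders g | g <- gs] = os].
Proof.
case: os => [|o0 [|o1 [|o2 [|o3 os]]]]; rewrite /= ?andbF// andbT => cov /and3P[p0 p1 p2].
have [s0 ps0 ->] := perm_eq_map_lift p0; have [s1 ps1 ->] := perm_eq_map_lift p1.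
have [s2 ps2 ->] := perm_eq_map_lift p2.
case: f0 f1 f2 cov ps0 ps1 ps2 {p0 p1 p2} => [k0 c0 t0 L0] [k1 c1 t1 L1] [k2 c2 t2 L2] /= cov ps0 ps1 ps2.
exists [:: Fibre k0 c0 s0 L0; Fibre k1 c1 s1 L1; Fibre k2 c2 s2 L2]; split=> //.
(* [fcover_respec] acts on the first fibre; a three-cycle brings each fibre to the front in turn. *)
have rot (a b c : fibre K) : perm_eq [:: a; b; c] [:: b; c; a] by rewrite (perm_catC [:: a]).
move: cov => /(fcover_respec ps0) /(fcover_perm (rot _ _ _)) /(fcover_respec ps1).
by move=> /(fcover_perm (rot _ _ _)) /(fcover_respec ps2) /(fcover_perm (rot _ _ _)).
Qed.

Lemma excluded_patterns d (gs : seq (fibre K)) : fcover d gs ->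
  [/\ (d, [seq fk g | g <- gs], [seq orders g | g <- gs]) <>
        (8, [:: 2; 4; 5], [:: [::]; [::]; [:: 1; 1; 1]])%N,
    (d, [seq fk g | g <- gs], [seq orders g | g <- gs]) <>
        (12, [:: 2; 3; 7], [:: [::]; [::]; [:: 1; 1; 3]])%N,
    (d, [seq fk g | g <- gs], [seq orders g | g <- gs]) <>
        (12, [:: 2; 3; 7], [:: [::]; [::]; [:: 1; 2; 2]])%N,
    (d, [seq fk g | g <- gs], [seq orders g | g <- gs]) <>
        (16, [:: 2; 3; 7], [:: [::]; [:: 1]; [:: 1; 1]])%N
   & forall m, (d, [seq fk g | g <- gs], [seq orders g | g <- gs]) <>
        (4, [:: 2; 3; m], [:: [::]; [:: 1]; [:: 2; 2]])%N /\
     (d, [seq fk g | g <- gs], [seq orders g | g <- gs]) <>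
        (6, [:: 2; 3; m], [:: [::]; [::]; [:: 1; 2; 3]])%N].
Proof.
move=> cov.
case: gs cov => [|[k0 c0 s0 L0] [|[k1 c1 s1 L1] [|[k2 c2 s2 L2] [|? ?]]]] /=;
  try by move=> _; split => [|||//|m]; try split; case.
move=> cov; have /= /and4P[] := cover_deg cov; rewrite /fdeg /orders /=.
move=> d0 d1 d2 _; split => [|||//|m]; try split.
all: case=> dE k0E k1E k2E; subst d k0 k1 k2.
all: case: s0 cov d0 => // cov d0 _ + E2; case: s1 cov d1 => [|[w ?] [|? ?]] //= cov d1 E1.
all: rewrite ?E1 ?E2 /= in d1 d2; move: E2; case: s2 cov d2 => [|[u1 j1] [|[u2 j2] [|[u3 j3] [|?
    ?]]]] //= cov d2 [].
all: try (move=> ? ? ?; subst j1 j2 j3); try (move=> ? ?; subst j1 j2).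
all: try (case: E1 => ?; subst).
all: rewrite ?add0n in d0 d1 d2; move: (eqP d0) (eqP d1) (eqP d2) => {}d0 {}d1 {}d2.
- case: L2 cov d2 => [|p [|? ?]] //= cov d2; try by clear -d2; lia.
  by apply: (fcover_111 cov); [move: d0 | move: d1]; move: (size _); clear; lia.
- case: L2 cov d2 => [|p [|? ?]] //= cov d2; try by clear -d2; lia.
  by apply: (fcover_113 cov); [move: d0 | move: d1]; move: (size _); clear; lia.
- case: L2 cov d2 => [|p [|? ?]] //= cov d2; try by clear -d2; lia.
  by apply: (fcover_122 cov); [move: d0 | move: d1]; move: (size _); clear; lia.
- case: L2 cov d2 => [|p [|q [|? ?]]] //= cov d2; try by clear -d2; lia.
  by apply: (fcover_1_11 cov); [move: d0 | move: d1]; move: (size _); clear; lia.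
- have hu := cover_hurwitz cov; case: L2 cov d2 hu => [|p2 L2] //= cov d2 hu; last first.
    by exfalso; move: d0 d1 d2 hu; move: (size L0) (size L1) (size L2); clear; lia.
  case: L1 cov d1 hu => [|p [|? ?]] //= cov d1 hu; try by clear -d1; lia.
  by apply: (fcover_1_22 cov); move: d0; move: (size _); clear; lia.
have hu := cover_hurwitz cov; case: L2 cov d2 hu => [|p2 L2] //= cov d2 hu; last first.
  by exfalso; move: d0 d1 d2 hu; move: (size L0) (size L1) (size L2); clear; lia.
by apply: (fcover_123 cov); [move: d0 | move: d1]; move: (size _); clear; lia.
Qed.

End Respec.

Section PartA.
Variable R : realType.
Local Notation C := R[i].

Definition fibre_exponents (ks : seq nat) (os : seq (seq nat)) : seq R :=
  flatten [seq [seq j%:R / p.1%:R | j <- p.2] | p <- zip ks os].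

Lemma cover_table d (gs : seq (fibre C)) k l m : (0 < k)%N -> (0 < l)%N -> (0 < m)%N ->
  fcover d gs ->
  [seq fk g | g <- gs] = [:: k; l; m] ->
  has (matches d [:: k; l; m] [seq orders g | g <- gs]) branch_patterns ->
  exists (s : seq nat) (t : seq R), [/\ hg_table s t d, perm_eq s [:: k; l; m] &
    perm_eq t (fibre_exponents [:: k; l; m] [seq orders g | g <- gs])].
Proof.
move=> kp lp mp; case: gs => [|f0 [|f1 [|f2 [|? ?]]]] // cov [k0E k1E k2E] /hasP[[[d' ks] os] pin].
rewrite /matches => /and3P[/eqP dE ksE osE].
have [gs [gcov gk go]] := fcover_orders cov osE.
have [x1 x2 x3 x4 x5] := excluded_patterns gcov.
have tE : perm_eq (fibre_exponents [:: k; l; m] os)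
    (fibre_exponents [:: k; l; m] [seq orders g | g <- [:: f0; f1; f2]]).
  move: osE; case: (os) => [|o0 [|o1 [|o2 [|? ?]]]] //=; rewrite ?andbF// andbT => /and3P[p0 p1 p2].
  by rewrite /fibre_exponents /=; apply: perm_cat; [|apply: perm_cat; [|apply: perm_cat]];
    rewrite ?perm_refl// perm_map// perm_sym.
suff [s [t [h1 h2 h3]]] : exists (s : seq nat) (t : seq R), [/\ hg_table s t d,
    perm_eq s [:: k; l; m] & perm_eq t (fibre_exponents [:: k; l; m] os)].
  by exists s, t; split=> //; apply: perm_trans tE.
move: gk go; rewrite k0E k1E k2E => gk go.
rewrite gk go in x1 x2 x3 x4 x5; clear - x1 x2 x3 x4 x5 dE ksE pin kp lp mp.
have perm3 (a b c : R) : perm_eq [:: a; b; c] [:: c; a; b] by rewrite perm_sym (perm_catC [:: c]).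
move: pin; rewrite !inE.
repeat (case/orP).
all: move=> /eqP[? ? ?]; subst d' ks os; move: ksE => /=; rewrite ?andbT.
all: try (case/and3P => /eqP ? /eqP ? /eqP ?); try (case/andP => /eqP ? /eqP ?); try (move=> /eqP ?).
all: subst; try by case: x1.
all: try by case: x2.
all: try by case: x3.
all: try by case: x4.
all: try by case: (x5 m).
all: try first [
    by eexists; eexists; split; [exact: (classical_2_l_m R lp mp) | exact: perm_refl | exact: perm_refl]
  | by eexists; eexists; split; [exact: (classical_2_3_m_deg3 R mp) | exact: perm_refl | exact: perm_refl]
  | by eexists; eexists; split; [exact: (classical_2_3_m_deg4 R mp) | exact: perm_refl | exact: perm_refl]
  | by eexists; eexists; split; [exact: (classical_2_3_m_deg6_114 R mp) | exact: perm_refl | exact: perm_refl]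
  | by eexists; eexists; split; [exact: (classical_2_3_m_deg6_222 R mp) | exact: perm_refl | exact: perm_refl]
  | by eexists; eexists; split; [exact: (classical_2_4_m R mp) | exact: perm_refl | exact: perm_refl]
  | by eexists; eexists; split; [exact: (classical_3_3_m R mp) | exact: perm_refl | exact: perm_refl]
  | by eexists; eexists; split; [exact: (nonclassical_2_3_7_deg8 R) | exact: perm_refl | exact: perm_refl]
  | by eexists; eexists; split; [exact: (nonclassical_2_3_7_deg9 R) | exact: perm_refl | exact: perm_refl]
  | by eexists; eexists; split; [exact: (nonclassical_2_3_7_deg10 R) | exact: perm_refl | exact: perm_refl]
  | by eexists; eexists; split; [exact: (nonclassical_2_3_7_deg18 R) | exact: perm_refl | exact: perm_refl]
  | by eexists; eexists; split; [exact: (nonclassical_2_3_7_deg24 R) | exact: perm_refl | exact: perm_refl]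
  | by eexists; eexists; split; [exact: (nonclassical_2_3_8_deg10 R) | exact: perm_refl | exact: perm_refl]
  | by eexists; eexists; split; [exact: (nonclassical_2_3_9 R) | exact: perm_refl | exact: perm_refl]
  | by eexists; eexists; split; [exact: (nonclassical_2_4_5 R) | exact: perm_refl | exact: perm_refl]].
  (* The quadratic transformation with the two free orders exchanged, since the table does not order
     them. *)
  exists [:: 2; m; l], [:: 1 / m%:R; 1 / m%:R; 2 / l%:R]; split; first exact: classical_2_l_m.
    by rewrite perm_cons (perm_catC [:: m] [:: l]).
  exact: perm3.
(* The covering yields 2/8, which the table writes as 1/4. *)
exists [:: 2; 3; 8], [:: 1 / 4; 1 / 8; 1 / 8]; split; [exact: nonclassical_2_3_8_deg12 | exact: perm_refl |].
have -> : 1 / 4 = 2 / 8 :> R by field.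
by rewrite perm_sym; apply: perm3.
Qed.

End PartA.

Section Classification.
Variable R : realType.
Local Notation C := R[i].

Lemma hyperbolic_nat (a b c : nat) : (0 < a)%N -> (0 < b)%N -> (0 < c)%N ->
  1 / a%:R + 1 / b%:R + 1 / c%:R < 1 :> R -> (a * b + a * c + b * c < a * b * c)%N.
Proof.
rewrite -!(ltr0n R) -(ltr_nat R) !natrD !natrM.
move: a%:R b%:R c%:R => x y z x0 y0 z0 h.
have -> : x * y + x * z + y * z = x * y * z * (1 / x + 1 / y + 1 / z).
  by field; rewrite !gt_eqF.
by rewrite -[ltRHS]mulr1 ltr_pM2l// !mulr_gt0.
Qed.

Definition csq (x : R) : C := (x%:C)%C ^+ 2.

Lemma exponent_squares (E : hgeq R) e : has_exponent_differences E e ->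
  exists2 e', perm_eq e' e & [:: sqexp0 E; sqexp1 E; sqexpoo E] = map csq e'.
Proof.
have sq (c x : C) : (c == x) || (c == - x) -> c ^+ 2 = x ^+ 2.
  by case/orP => /eqP ->; rewrite ?sqrrN.
case=> e' pe h; exists e' => //.
case: e' pe h => [|x [|y [|z [|? ?]]]] //=; rewrite ?andbF// andbT => _ /and3P[h0 h1 h2].
by congr [:: _; _; _]; apply: sq.
Qed.

Lemma csq_ratio (j k : nat) : csq (j%:R / k%:R) = j%:R ^+ 2 * k%:R^-1 ^+ 2.
Proof. by rewrite /csq rmorphM fmorphV !rmorph_nat exprMn. Qed.

(** Nonnegative reals are recovered from their complex squares by the square root of the real
    part. *)
Lemma csq_perm (s t : seq R) : all (fun x => 0 <= x) s -> all (fun x => 0 <= x) t ->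
  perm_eq (map csq s) (map csq t) -> perm_eq s t.
Proof.
pose r (c : C) : R := Num.sqrt (complex.Re c).
have rK x : 0 <= x -> r (csq x) = x.
  by move=> x0; rewrite /r /csq expr2 /= mulr0 subr0 -expr2 sqrtr_sqr ger0_norm.
have mK u : all (fun x => 0 <= x) u -> map r (map csq u) = u.
  move=> /allP u0; rewrite -map_comp -[RHS]map_id; apply/eq_in_map => x /u0; exact: rK.
by move=> s0 t0 /(perm_map r); rewrite !mK.
Qed.

Lemma hg_transformation_table (k l m : nat) (e1 e2 e3 : R) (d : nat) :
  (0 < k)%N -> (k <= l)%N -> (l <= m)%N ->
  1 / k%:R + 1 / l%:R + 1 / m%:R < 1 :> R ->
  0 <= e1 -> 0 <= e2 -> 0 <= e3 -> (2 <= d)%N ->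
  hg_transformation [:: 1 / k%:R; 1 / l%:R; 1 / m%:R] [:: e1; e2; e3] d ->
  exists (s : seq nat) (t : seq R),
    [/\ hg_table s t d, perm_eq s [:: k; l; m] & perm_eq t [:: e1; e2; e3]].
Proof.
move=> kp kl lm hyp e10 e20 e30 d2 [phi [E1 [E2 [dE pb x1 x2]]]].
have lp : (0 < l)%N by apply: leq_trans kl.
have mp : (0 < m)%N by apply: leq_trans lm.
have idt := pullback_pull_identity pb; have W := rdegree_gt0_wronskian pb.1.
have [y1 py1 s1E] := exponent_squares x1; have [y2 py2 s2E] := exponent_squares x2.
(* The exponent differences of [E1] are listed by singular point; [ks] is the corresponding
   arrangement of k, l, m. *)
have : perm_eq [seq 1 / n%:R | n <- [:: k; l; m]] y1 by rewrite perm_sym.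
case/perm_eq_map_lift => ks pks y1E.
have [k0 [k1 [k2 ksE]]] : exists a b c, ks = [:: a; b; c].
  by have := perm_size pks; case: (ks) => [|a [|b [|c [|? ?]]]] // _; exists a, b, c.
rewrite y1E ksE /= !div1r in s1E; rewrite ksE in pks.
have kspos n : n \in [:: k0; k1; k2] -> (0 < n)%N.
  by rewrite -(perm_mem pks) !inE => /or3P[] /eqP ->.
have k0p : (0 < k0)%N by apply: kspos; rewrite !inE eqxx.
have k1p : (0 < k1)%N by apply: kspos; rewrite !inE eqxx orbT.
have k2p : (0 < k2)%N by apply: kspos; rewrite !inE eqxx !orbT.
have hyp' : 1 / k0%:R + 1 / k1%:R + 1 / k2%:R < 1 :> R.
  have pS : \sum_(n <- [:: k; l; m]) 1 / n%:R = \sum_(n <- [:: k0; k1; k2]) 1 / n%:R :> R.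
    exact: perm_big.
  by move: pS; rewrite !big_cons !big_nil !addr0 !addrA => <-.
have sqV n : csq n%:R^-1 = n%:R^-1 ^+ 2 by rewrite /csq fmorphV rmorph_nat.
have [E10 E11 E1oo] : [/\ sqexp0 E1 = k0%:R^-1 ^+ 2, sqexp1 E1 = k1%:R^-1 ^+ 2 &
    sqexpoo E1 = k2%:R^-1 ^+ 2] by rewrite -!sqV; case: s1E.
have [fs [cov fkE pe]] := cover_of_identity (rcoprime phi) idt W (rden_neq0 phi) k0p k1p k2p
  (hyperbolic_nat k0p k1p k2p hyp') E10 E11 E1oo.
have : perm_eq [seq fk f | f <- fs] [:: k; l; m] by rewrite fkE perm_sym.
(* The fibres are sorted by order, as the enumeration requires. *)
case/perm_eq_map_lift => gs pgs /esym gkE.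
have gcov : fcover d gs by have := fcover_perm pgs cov; rewrite -/(rdegree phi) dE.
have [f0 [f1 [f2 gsE]]] : exists f0 f1 f2, gs = [:: f0; f1; f2].
  by have := congr1 size gkE; rewrite size_map; case: (gs) => [|a [|b [|c [|? ?]]]] // _; exists a, b, c.
rewrite gsE in gkE gcov pgs *; have [f0E f1E f2E] := gkE.
have := enumeration d2 kp kl lm (hyperbolic_nat kp lp mp hyp).
have /= /and4P[/eqP d0 /eqP d1 /eqP d3 _] := cover_deg gcov.
have /= /and4P[q0 q1 q2 _] := cover_pos gcov.
have sz := cover_size gcov; have ht := cover_hurwitz gcov.
rewrite /= addn0 addnA in ht; rewrite /= !size_cat addn0 addnA in sz.
rewrite /fdeg f0E -/(orders f0) in d0; rewrite /fdeg f1E -/(orders f1) in d1.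
rewrite /fdeg f2E -/(orders f2) in d3.
have al (f : fibre C) : all (fun s => 0 < s.2)%N (fspec f) -> all (leq 1) (orders f).
  by rewrite /orders all_map.
move=> /(_ _ _ _ _ _ _ (esym d0) (esym d1) (esym d3) (al _ q0) (al _ q1) (al _ q2)).
rewrite !size_map => /(_ sz ht) pat.
have [s [t [ht' ps pt]]] := cover_table kp lp mp gcov gkE pat.
exists s, t; split=> //; apply: perm_trans pt _.
apply: csq_perm; last first.
- have -> : map csq (fibre_exponents R [:: k; l; m] [seq orders g | g <- [:: f0; f1; f2]]) =
      [seq s.2%:R ^+ 2 * (fk f)%:R^-1 ^+ 2 | f <- [:: f0; f1; f2], s <- fspec f].
    rewrite /fibre_exponents /= !map_cat /orders f0E f1E f2E -!map_comp /=.
    by congr (_ ++ (_ ++ (_ ++ _))); apply: eq_map => x /=; apply: csq_ratio.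
  apply: perm_trans (perm_trans pe _).
    by rewrite perm_sym; apply/perm_flatten/perm_map.
  by rewrite s2E; apply: perm_map.
- by rewrite /= e10 e20 e30.
apply/allP => x /flattenP[u /mapP[p _ ->] /mapP[j _ ->]]; by rewrite divr_ge0.
Qed.

End Classification.

(** * Construction of the transformations *)

Section Homogenization.
Variable K : closedFieldType.
Implicit Types (p q F G P Q : {poly K}) (u v : K).

(** Homogenisation in a prescribed degree d, so that v = 0 gives the value at infinity. *)
Definition hval d p u v : K := \sum_(i < d.+1) p`_i * (u ^+ i * v ^+ (d - i)).
Definition hpoly d p P Q : {poly K} := \sum_(i < d.+1) p`_i *: (P ^+ i * Q ^+ (d - i)).

Lemma hval_nonzero d p u v : v != 0 -> (size p <= d.+1)%N -> hval d p u v = v ^+ d * p.[u / v].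
Proof.
move=> v0 sp; rewrite (horner_coef_wide _ sp) mulr_sumr; apply: eq_bigr => i _.
have id : (i <= d)%N by rewrite -ltnS.
have -> : v ^+ d = v ^+ (d - i) * v ^+ i by rewrite -exprD subnK.
rewrite expr_div_n; have := expf_neq0 i v0; move: (v ^+ i) (v ^+ (d - i)) (u ^+ i) => a b c a0.
by field.
Qed.

Lemma hval_infinity d p u : hval d p u 0 = p`_d * u ^+ d.
Proof.
rewrite /hval big_ord_recr /= subnn expr0 mulr1 big1 ?add0r// => i _.
by rewrite expr0n subn_eq0 leqNgt ltn_ord /= !mulr0.
Qed.

Lemma hpoly_eval d p P Q x : (hpoly d p P Q).[x] = hval d p P.[x] Q.[x].
Proof.
rewrite /hpoly horner_sum; apply: eq_bigr => i _.
by rewrite hornerZ hornerM !horner_exp.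
Qed.

(** Away from infinity this is coprimality; at infinity the values are coefficients of degree d, and
    not both vanish because d is the larger of the two degrees. *)
Lemma hval_coprime F G u v : coprimep F G -> (u != 0) || (v != 0) ->
  let d := maxn (size F).-1 (size G).-1 in hval d F u v = 0 -> hval d G u v != 0.
Proof.
move=> cFG uv d.
have sF : (size F <= d.+1)%N by rewrite /d; case: (size F) => // n; rewrite ltnS leq_max leqnn.
have sG : (size G <= d.+1)%N by rewrite /d; case: (size G) => // n; rewrite ltnS leq_max leqnn orbT.
have [v0|v0] := eqVneq v 0; last first.
  rewrite !hval_nonzero// => /eqP; rewrite mulf_eq0 (negPf (expf_neq0 _ v0)) /= => r.
  by rewrite mulf_neq0 ?expf_neq0// (coprimep_root cFG r).
have u0 : u != 0 by rewrite v0 eqxx orbF in uv.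
rewrite v0 !hval_infinity => /eqP; rewrite mulf_eq0 (negPf (expf_neq0 _ u0)) orbF => /eqP Fd.
rewrite mulf_neq0 ?expf_neq0//; apply/eqP => Gd.
have [F0|F0] := eqVneq F 0.
  have [G0|G0] := eqVneq G 0; first by rewrite F0 G0 coprimep0 -size_poly_eq1 size_poly0 in cFG.
  by move: Gd; rewrite /d F0 size_poly0 max0n => /eqP; rewrite -lead_coefE lead_coef_eq0 (negPf G0).
have [sGF|sGF] := leqP (size G) (size F).
  move: Fd; rewrite /d (maxn_idPl _); last by move: sGF; clear; lia.
  by move/eqP; rewrite -lead_coefE lead_coef_eq0 (negPf F0).
move: Gd; rewrite /d (maxn_idPr _); last by move: sGF; clear; lia.
move/eqP; rewrite -lead_coefE lead_coef_eq0 => /eqP G0.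
by rewrite G0 size_poly0 in sGF.
Qed.

Lemma coef_top_mul (p q : {poly K}) m n : (size p <= m.+1)%N -> (size q <= n.+1)%N ->
  (p * q)`_(m + n) = p`_m * q`_n /\ (size (p * q)%R <= (m + n).+1)%N.
Proof.
move=> sp sq; split; last first.
  by apply: leq_trans (size_polyMleq _ _) _; move: sp sq; clear; lia.
have mn : (m < (m + n).+1)%N by rewrite ltnS leq_addr.
rewrite coefM (bigD1 (Ordinal mn)) //= addKn big1 ?addr0// => i im.
have [lim|] := ltnP i m.
  by rewrite [q`__]nth_default ?mulr0//; apply: leq_trans sq _; rewrite ltn_subRL ltn_add2r.
rewrite leq_eqVlt => /orP[/eqP e|lim].
  by case/eqP: im; apply: val_inj.
by rewrite nth_default ?mul0r//; apply: leq_trans sp _.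
Qed.

Lemma coef_top_exp p m k : (size p <= m.+1)%N ->
  (p ^+ k)`_(k * m) = p`_m ^+ k /\ (size (p ^+ k)%R <= (k * m).+1)%N.
Proof.
move=> sp; elim: k => [|k [IH1 IH2]]; first by rewrite !expr0 coefC size_poly1.
by rewrite exprS mulSn; have [-> s] := coef_top_mul sp IH2; rewrite IH1 exprS.
Qed.

Lemma hpoly_top d e p P Q : (size P <= e.+1)%N -> (size Q <= e.+1)%N ->
  (hpoly d p P Q)`_(d * e) = hval d p P`_e Q`_e /\ (size (hpoly d p P Q) <= (d * e).+1)%N.
Proof.
move=> sP sQ.
have top i : (i <= d)%N -> (P ^+ i * Q ^+ (d - i))`_(d * e) = P`_e ^+ i * Q`_e ^+ (d - i)
    /\ (size (P ^+ i * Q ^+ (d - i))%R <= (d * e).+1)%N.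
  move=> id; have [c1 s1] := coef_top_exp i sP; have [c2 s2] := coef_top_exp (d - i) sQ.
  have [c s] := coef_top_mul s1 s2; rewrite -mulnDl subnKC// in c s.
  by rewrite c c1 c2.
split.
  rewrite /hpoly coef_sum; apply: eq_bigr => i _; rewrite coefZ.
  by have [|-> _] := top i; first by rewrite -ltnS.
apply: leq_trans (size_sum _ _ _) _; apply/bigmax_leqP => i _.
by apply: leq_trans (size_scale_leq _ _) _; have [|_] := top i; first by rewrite -ltnS.
Qed.

End Homogenization.

Section Composition.
Variable R : realType.
Local Notation C := (R[i]).
Local Notation T := (C^o).
Implicit Types (E : hgeq R) (phi psi chi : ratfun R) (x : C).

Lemma size_rnum phi : (size (rnum phi) <= (rdegree phi).+1)%N.
Proof. by rewrite /rdegree; case: (size (rnum phi)) => // n; rewrite ltnS leq_max leqnn. Qed.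

Lemma size_rden phi : (size (rden phi) <= (rdegree phi).+1)%N.
Proof. by rewrite /rdegree; case: (size (rden phi)) => // n; rewrite ltnS leq_max leqnn orbT. Qed.

Lemma hpoly_neq0 psi d (p : {poly C}) : (0 < rdegree psi)%N -> p != 0 -> (size p <= d.+1)%N ->
  hpoly d p (rnum psi) (rden psi) != 0.
Proof.
move=> e0 p0 sp; apply/eqP => h0.
have [r pE] := closed_field_poly_normal p.
have W0 := rdegree_gt0_wronskian e0.
pose D := rden psi * \prod_(z <- r) (rnum psi - z *: rden psi).
have D0 : D != 0.
  rewrite mulf_neq0 ?rden_neq0// prodf_seq_neq0; apply/allP => z _ /=; apply: contraNneq W0 => /eqP.
  by rewrite subr_eq0 => /eqP ->; rewrite /wronskian derivZ -!mul_polyC; apply/eqP; ring.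
suff /eqP : (1 : {poly C}) = 0 by rewrite oner_eq0.
apply: (poly_eq0_of_generic D0) => x; rewrite hornerM horner_prod mulf_eq0 negb_or => /andP[q0 rx].
have : hval d p (rnum psi).[x] (rden psi).[x] = 0 by rewrite -hpoly_eval h0 horner0.
rewrite hval_nonzero// => /eqP.
rewrite mulf_eq0 (negPf (expf_neq0 _ q0)) /= pE hornerZ mulf_eq0 lead_coef_eq0 (negPf p0) /=.
rewrite horner_prod prodf_seq_eq0 => /hasP[z zr /=]; rewrite hornerXsubC subr_eq0 => /eqP zE.
move: rx; rewrite prodf_seq_neq0 => /allP/(_ z zr) /=.
by rewrite hornerD hornerN hornerZ -zE divfK// subrr eqxx.
Qed.

(** Substituting numerator and denominator of psi into the forms of phi leaves no common factor by
    [hval_coprime]. The same lemma at psi(infinity) shows that one of the two top coefficients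
    survives, so degrees multiply. *)
Lemma ratfun_comp phi psi : (0 < rdegree psi)%N ->
  exists chi, rdegree chi = (rdegree phi * rdegree psi)%N /\
    forall x, (rden psi).[x] != 0 ->
      (rnum chi).[x] = (rden psi).[x] ^+ rdegree phi * (rnum phi).[reval psi x] /\
      (rden chi).[x] = (rden psi).[x] ^+ rdegree phi * (rden phi).[reval psi x].
Proof.
move=> e0; set d := rdegree phi; set e := rdegree psi.
pose N := hpoly d (rnum phi) (rnum psi) (rden psi).
pose D := hpoly d (rden phi) (rnum psi) (rden psi).
have D0 : D != 0 by apply: hpoly_neq0; rewrite ?rden_neq0// size_rden.
have cND : coprimep N D.
  apply: coprimep_of_roots => x; rewrite !hpoly_eval.
  apply: (hval_coprime (rcoprime phi)).
  have [/eqP u0|//] := eqVneq (rnum psi).[x] 0.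
  by rewrite (coprimep_root (rcoprime psi)).
exists (RatFun D0 cND); split; last first.
  by move=> x q0; rewrite /= !hpoly_eval !hval_nonzero ?size_rnum ?size_rden.
have [cN sN] := hpoly_top d (rnum phi) (size_rnum psi) (size_rden psi).
have [cD sD] := hpoly_top d (rden phi) (size_rnum psi) (size_rden psi).
rewrite /rdegree /=; apply/eqP; rewrite eqn_leq geq_max.
have pr (p : {poly C}) n : (size p <= n.+1)%N -> ((size p).-1 <= n)%N by case: (size p).
rewrite !pr//= leq_max.
have nz : ((rnum psi)`_e != 0) || ((rden psi)`_e != 0).
  apply/orP; rewrite /e /rdegree.
  have [sGF|sGF] := leqP (size (rden psi)) (size (rnum psi)).
    left; rewrite (maxn_idPl _); last by move: sGF; clear; lia.
    rewrite -lead_coefE lead_coef_eq0 -size_poly_gt0; apply: leq_trans sGF.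
    by rewrite size_poly_gt0 rden_neq0.
  right; rewrite (maxn_idPr _); last by move: sGF; clear; lia.
  by rewrite -lead_coefE lead_coef_eq0 rden_neq0.
have ge (p : {poly C}) n : p`_n != 0 -> (n <= (size p).-1)%N.
  by move=> pn; rewrite -ltnS; apply: leq_trans (leqSpred _); rewrite ltnNge; apply: contraNN pn =>
      /(nth_default 0) ->.
have [z0|z0] := eqVneq (hval d (rnum phi) (rnum psi)`_e (rden psi)`_e) 0.
  have := hval_coprime (rcoprime phi) nz z0; rewrite -cD => /ge ->; exact: orbT.
by move: z0; rewrite -cN => /ge ->.
Qed.

Lemma pull_identityP E1 E2 (F G : {poly C}) x : F.[x] != 0 -> G.[x] != 0 -> (F - G).[x] != 0 ->
  (wronskian F G).[x] != 0 -> x != 0 -> x != 1 ->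
  ('X ^+ 2 * ('X - 1%:P) ^+ 2 * pull_lhs E1 F G - pull_den F G ^+ 2 * pull_rhs E2).[x] = 0 <->
  2 * pull_log1 E1 F G x + pull_log E1 F G x ^+ 2
    - 4 * pull_phi1 F G x ^+ 2 * hgq E1 (F.[x] / G.[x]) =
  2 * hgp1 E2 x + hgp E2 x ^+ 2 - 4 * hgq E2 x.
Proof.
move=> f0 g0 h0 w0 x0 x1; have pw := pull_identity_pointwise E1 E2 f0 g0 h0 w0 x0 x1.
have kx := pull_den_neq0 f0 g0 h0 w0.
split=> [P0|e].
  rewrite P0 mul0r in pw; apply/eqP; rewrite -subr_eq0; apply/eqP.
  by rewrite -[RHS](mulr0 4) -pw; field.
apply/eqP; rewrite -[_ == 0]orbF.
have <- : ((4 * (x ^+ 2 * (x - 1) ^+ 2 * (pull_den F G).[x] ^+ 2))^-1 == 0) = false.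
  by apply/negbTE; rewrite invr_eq0 !mulf_neq0 ?expf_neq0 ?subr_eq0 ?pnatr_eq0.
rewrite -mulf_eq0 -pw; apply/eqP.
set l1 := pull_log1 _ _ _ _ in e *; set l := pull_log _ _ _ _ in e *.
have -> : l1 = (2 * hgp1 E2 x + hgp E2 x ^+ 2 - 4 * hgq E2 x - l ^+ 2
   + 4 * pull_phi1 F G x ^+ 2 * hgq E1 (F.[x] / G.[x])) / 2 by rewrite -e; field.
by field.
Qed.

(* In the coordinate z = psi(x), g(z) = N_phi(z) - p_2(z) measures the change of
   the first-order coefficient; the logarithmic term N of phi o psi is
   N_psi + psi' g(psi), and the two identities combine. *)
Lemma pullback_comp phi psi E1 E2 E3 d : pullback phi E1 E2 -> pullback psi E2 E3 ->
  (rdegree phi * rdegree psi)%N = d -> exists2 chi, rdegree chi = d & pullback chi E1 E3.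
Proof.
move=> pb1 pb2 <-; have e0 := pb2.1; have [chi [dE chiE]] := ratfun_comp phi e0.
have d0 : (0 < rdegree chi)%N by rewrite dE muln_gt0 pb1.1.
exists chi => //; apply: pull_identity_pullback => //.
have i1 := pullback_pull_identity pb1; have i2 := pullback_pull_identity pb2.
have Wchi := rdegree_gt0_wronskian d0; have Wpsi := rdegree_gt0_wronskian e0.
have /andP[F0 H0] := wronskian_neq0_num Wchi; have /andP[P0 PQ0] := wronskian_neq0_num Wpsi.
pose D := 'X * ('X - 1%:P) * pull_den (rnum chi) (rden chi) * pull_den (rnum psi) (rden psi).
have D0 : D != 0 by rewrite /D /pull_den !mulf_neq0 ?polyX_eq0 ?polyXsubC_eq0 ?rden_neq0.
rewrite /pull_identity; apply/eqP; rewrite -subr_eq0; apply/eqP.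
pose generic x := [/\ x != 0, x != 1, [/\ (rnum chi).[x] != 0, (rden chi).[x] != 0,
   (rnum chi - rden chi).[x] != 0 & (wronskian (rnum chi) (rden chi)).[x] != 0] &
   [/\ (rnum psi).[x] != 0, (rden psi).[x] != 0,
   (rnum psi - rden psi).[x] != 0 & (wronskian (rnum psi) (rden psi)).[x] != 0]].
have gen x : D.[x] != 0 -> generic x.
  rewrite /D /pull_den !(hornerM _ _ x) hornerX hornerXsubC !mulf_eq0 !negb_or -!andbA.
  by move=> /and5P[? x1 ? ? /and5P[? ? ? ? /andP[? ?]]]; split; rewrite // -subr_eq0.
have fin (x : C) : D.[x] != 0 -> \forall w \near (x : T), generic w.
  by move=> Dx; have := near_poly_neq0 Dx; apply: filterS => w /gen.
have rch w : generic w -> reval chi w = reval phi (reval psi w).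
  case=> _ _ [_ g1 _ _] [_ g2 _ _]; have [nE dE'] := chiE w g2.
  rewrite /reval nE dE' -/(reval psi w).
  by rewrite -mulf_div divff ?mul1r// expf_neq0.
have gphi w : generic w -> (rden phi).[reval psi w] != 0.
  case=> _ _ [_ g1 _ _] [_ g2 _ _]; have [_ dE'] := chiE w g2.
  by move: g1; rewrite dE' mulf_eq0 negb_or => /andP[].
have c1 x : D.[x] != 0 -> rderiv chi x = rderiv phi (reval psi x) * rderiv psi x.
  move=> Dx; have gx := gen x Dx; have [_ _ [_ g1 _ _] [_ g2 _ _]] := gx.
  rewrite -(cder_derive (cder_reval g1)).
  apply: cder_derive; apply: cder_near (cder_comp (cder_reval g2) (cder_reval (gphi x gx))).
  by apply: filterS (fin x Dx) => w /rch.
have c2 x : D.[x] != 0 -> pull_phi2 (rnum chi) (rden chi) x =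
    pull_phi2 (rnum phi) (rden phi) (reval psi x) * rderiv psi x ^+ 2
    + rderiv phi (reval psi x) * pull_phi2 (rnum psi) (rden psi) x.
  move=> Dx; have gx := gen x Dx; have [_ _ [_ g1 _ _] [_ g2 _ _]] := gx.
  rewrite -(cder_derive (cder_rderiv g1)).
  have dd := cderM (cder_comp (cder_reval g2) (cder_rderiv (gphi x gx))) (cder_rderiv g2).
  apply: cder_derive; apply: cder_near (cder_eq dd _); last by ring.
  by have := near_poly_neq0 Dx; apply: filterS => w Dw; rewrite c1.
pose g (z : T) : T := pull_log E1 (rnum phi) (rden phi) z - hgp E2 z.
have dataphi x : D.[x] != 0 -> [/\ (rnum phi).[reval psi x] != 0,
    (rden phi).[reval psi x] != 0, (rnum phi - rden phi).[reval psi x] != 0,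
    (wronskian (rnum phi) (rden phi)).[reval psi x] != 0 &
    reval psi x != 0 /\ reval psi x != 1].
  move=> Dx; have gx := gen x Dx; have [_ _ [f1 g1 h1 w1] [f2 g2 h2 w2]] := gx.
  have [nE dE'] := chiE x g2; have gp := gphi x gx.
  have [r0 r1] := reval_poly_neq01 g2.
  have qd : (rden psi).[x] ^+ rdegree phi != 0 by rewrite expf_neq0.
  split=> //.
  - by move: f1; rewrite nE mulf_eq0 negb_or => /andP[].
  - move: h1; rewrite !hornerD !hornerN nE dE' -mulrBr mulf_eq0 negb_or => /andP[_].
    by [].
  - have := c1 x Dx; rewrite !rderivE// /pull_phi1 => e; apply: contraNneq w1 => w0.
    have : (wronskian (rnum chi) (rden chi)).[x] / (rden chi).[x] ^+ 2 = 0 by rewrite e w0 !mul0r.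
    by move/eqP; rewrite mulf_eq0 invr_eq0 (negPf (expf_neq0 _ g1)) orbF.
  by rewrite r0 r1.
have logE x : D.[x] != 0 -> pull_log E1 (rnum chi) (rden chi) x =
    pull_log E2 (rnum psi) (rden psi) x + rderiv psi x * g (reval psi x).
  move=> Dx; have [x0 x1 [f1 g1 h1 w1] [f2 g2 h2 w2]] := gen x Dx.
  have [f3 g3 h3 w3 _] := dataphi x Dx.
  have fo1 := pull_first_order E1 f1 g1 h1 w1.
  have fo2 := pull_first_order E2 f2 g2 h2 w2.
  have fo3 := pull_first_order E1 f3 g3 h3 w3.
  have := c1 x Dx; have := c2 x Dx; move: fo1 fo2 fo3; rewrite /g.
  rewrite -!rderivE// -![_ / (rden _).[x]]/(reval _ x) -[_ / (rden phi).[_]]/(reval phi _).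
  rewrite (rch _ (gen x Dx)).
  have q1 : rderiv psi x != 0 by rewrite rderivE// mulf_neq0// invr_eq0 expf_neq0.
  have q3 : rderiv phi (reval psi x) != 0 by rewrite rderivE// mulf_neq0// invr_eq0 expf_neq0.
  move: (reval psi x) q3 => z; move: (pull_log E1 (rnum chi) _ x) (pull_log E2 _ _ x) (pull_log E1 _
      _ z) => Nc Np Nf.
  move: (pull_phi2 _ _ x) (pull_phi2 _ _ z) (pull_phi2 (rnum psi) _ x).
  move: (rderiv chi x) (rderiv phi z) (rderiv psi x) q1 (hgp E1 _) (hgp E2 _).
  move=> chi1 phi1 psi1 q1 h k chi2 phi2 psi2 q3 fo1 fo2 fo3 e2 e1.
  have {}fo3 : phi2 = phi1 ^+ 2 * h - phi1 * Nf by apply/eqP; rewrite -subr_eq0; apply/eqP;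
      move/eqP: fo3; rewrite -subr_eq0 => /eqP <-; ring.
  have {}fo2 : psi2 = psi1 ^+ 2 * k - psi1 * Np by apply/eqP; rewrite -subr_eq0; apply/eqP;
      move/eqP: fo2; rewrite -subr_eq0 => /eqP <-; ring.
  apply: (mulfI (mulf_neq0 q3 q1)); move: fo1; rewrite e2 e1 fo3 fo2 => /eqP; rewrite -subr_eq0 => /eqP fo1.
  by apply/eqP; rewrite -subr_eq0; apply/eqP; rewrite -[RHS]fo1; ring.
apply: (poly_eq0_of_generic D0) => x Dx.
have [x0 x1 [f1 g1 h1 w1] [f2 g2 h2 w2]] := gen x Dx.
have [f3 g3 h3 w3 [z0 z1]] := dataphi x Dx.
apply/pull_identityP => //.
have /pull_identityP : ('X ^+ 2 * ('X - 1%:P) ^+ 2 * pull_lhs E1 (rnum phi) (rden phi)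
   - pull_den (rnum phi) (rden phi) ^+ 2 * pull_rhs E2).[reval psi x] = 0 by rewrite i1 subrr horner0.
move=> /(_ f3 g3 h3 w3 z0 z1) e1.
have /pull_identityP : ('X ^+ 2 * ('X - 1%:P) ^+ 2 * pull_lhs E2 (rnum psi) (rden psi)
   - pull_den (rnum psi) (rden psi) ^+ 2 * pull_rhs E3).[x] = 0 by rewrite i2 subrr horner0.
move=> /(_ f2 g2 h2 w2 x0 x1) <-.
pose g1' := pull_log1 E1 (rnum phi) (rden phi) (reval psi x) - hgp1 E2 (reval psi x).
have dg : cder g (reval psi x) g1'.
  have k3 := pull_den_neq0 f3 g3 h3 w3.
  have := cderD (cder_pull_log E1 k3) (cderM (cder_cst (-1 : T) (reval psi x : T)) (cder_hgp E2 z0 z1)).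
  move=> dd; apply: cder_ext (cder_eq dd _); first by move=> w; rewrite mulN1r.
  by rewrite mul0r add0r mulN1r.
have log1E : pull_log1 E1 (rnum chi) (rden chi) x = pull_log1 E2 (rnum psi) (rden psi) x
    + pull_phi2 (rnum psi) (rden psi) x * g (reval psi x) + rderiv psi x ^+ 2 * g1'.
  rewrite -(cder_derive (cder_pull_log E1 (pull_den_neq0 f1 g1 h1 w1))).
  have dd := cderD (cder_pull_log E2 (pull_den_neq0 f2 g2 h2 w2))
    (cderM (cder_rderiv g2) (cder_comp (cder_reval g2) dg)).
  apply: cder_derive; apply: cder_near (cder_eq dd _); last by ring.
  by have := near_poly_neq0 Dx; apply: filterS => w Dw; rewrite logE.
have fo2 := pull_first_order E2 f2 g2 h2 w2; move: fo2 e1.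
rewrite log1E logE// -!rderivE// (c1 x Dx) -![_ / (rden _).[x]]/(reval _ x) -[_ / (rden
    phi).[_]]/(reval phi _).
rewrite (rch _ (gen x Dx)) /g1' /g.
move: (reval psi x) => z; move: (pull_log E2 _ _ x) (pull_log1 E2 _ _ x) (pull_log E1 _ _ z)
    (pull_log1 E1 _ _ z).
move: (pull_phi2 _ _ x) (rderiv phi z) (rderiv psi x) (hgq E1 _) (hgq E2 _) (hgp E2 _) (hgp1 E2 _).
move=> psi2 phi1 psi1 qa qb k k1 Np Np1 Nf Nf1 fo2 e1.
have {}fo2 : psi2 = psi1 ^+ 2 * k - psi1 * Np by apply/eqP; rewrite -subr_eq0; apply/eqP; move/eqP:
    fo2; rewrite -subr_eq0 => /eqP <-; ring.
have {}e1 : Nf1 = k1 + (k ^+ 2 - 4 * qb - Nf ^+ 2 + 4 * phi1 ^+ 2 * qa) / 2.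
  by apply/eqP; rewrite -subr_eq0; apply/eqP; move/eqP: e1; rewrite -subr_eq0 => /eqP e1;
    rewrite -[RHS](mul0r 2^-1) -e1; field.
by rewrite fo2 e1; field.
Qed.

End Composition.

(** * Coverings whose fibres are powers of polynomials *)

Section Factored.
Variable R : realType.
Local Notation C := (R[i]).
Implicit Types (F G H : {poly C}).

(* The equation with exponent differences a, b, c at 0, 1, infinity. *)
Definition hge (a b c : C) : hgeq R := HGEq ((1 - a - b + c) / 2) ((1 - a - b - c) / 2) (1 - a).

Local Notation S := ('X * ('X - 1) : {poly C}).

(* The logarithmic term N = M / K has no poles at the roots of A and B when
   l0 and l1 are the inverses of the exponents of A and B. *)
Lemma factored_identity (A B D f0 f1 f2 w V n0 n1 n2 nw : {poly C}) (i0 i1 i2 : nat)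
    (l0 l1 l2 m0 m1 m2 : C) :
  S * f0^`() = n0 * f0 -> S * f1^`() = n1 * f1 -> S * f2^`() = n2 * f2 -> S * w^`() = nw * w ->
  f0 != 0 -> f1 != 0 -> f2 != 0 -> A != 0 -> B != 0 -> D != 0 ->
  ((i0.+2)%:R * l0 - 1)%:P * A^`() = 0 -> ((i1.+2)%:R * l1 - 1)%:P * B^`() = 0 ->
  f0 * A ^+ i0.+2 - f2 * D ^+ i2.+1 = f1 * B ^+ i1.+2 ->
  f0 * f2 * ((n0 - n2) * A * D + i0.+2%:R * S * A^`() * D - i2.+1%:R * S * A * D^`()) =
    S * w * B ^+ i1.+1 ->
  V * (f0 * f1 * f2 ^+ 2) = S ^+ 2 * w ^+ 2 ->
  (let m := ((1 - l0)%:P * n0 + (1 - l1)%:P * n1 + (l0 + l1)%:P * n2 - nw) * D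
           + ((l0 + l1) * i2.+1%:R - i2%:R)%:P * S * D^`() in
   2%:R * (m^`() * (S * D) - m * (S * D)^`()) + m ^+ 2
     - ((1 - l0 - l1) ^+ 2 - l2 ^+ 2)%:P * V * (A ^+ i0 * B ^+ i1) =
   ((m0 ^+ 2 - 1)%:P * ('X - 1) ^+ 2 + (m1 ^+ 2 - 1)%:P * 'X ^+ 2
     + (1 - m0 ^+ 2 - m1 ^+ 2 + m2 ^+ 2)%:P * S) * D ^+ 2) ->
  pull_identity (hge l0 l1 l2) (hge m0 m1 m2) (f0 * A ^+ i0.+2) (f2 * D ^+ i2.+1).
Proof.
move=> h0 h1 h2 hw f00 f10 f20 A0 B0 D0 e0 e1 hH hII hV; set m := (X in let _ := X in _); cbv zeta => hI.
have S0 : S != 0 by rewrite mulf_neq0 ?polyX_eq0// -polyC1 polyXsubC_eq0.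
set F := f0 * A ^+ i0.+2; set G := f2 * D ^+ i2.+1; set H := f1 * B ^+ i1.+2.
have FGH : F - G = H by [].
have logd (f n P : {poly C}) k : S * f^`() = n * f ->
    S * P * (f * P ^+ k)^`() = (n * P + k%:R * S * P^`()) * (f * P ^+ k).
  move=> hf; have d := mul_deriv_exp P k.
  have -> : S * P * (f * P ^+ k)^`() = (S * f^`()) * P * P ^+ k + S * f * (P * (P ^+ k)^`()).
    by rewrite derivM; ring.
  by rewrite hf d; ring.
have lF := logd _ _ A i0.+2 h0; have lG := logd _ _ D i2.+1 h2; have lH := logd _ _ B i1.+2 h1.
have WE : wronskian F G = w * A ^+ i0.+1 * B ^+ i1.+1 * D ^+ i2.
  have nz : S ^+ 2 * A * D != 0.
    by apply: mulf_neq0 => //; apply: mulf_neq0 => //; apply: expf_neq0.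
  apply: (mulfI nz).
  have -> : S ^+ 2 * A * D * wronskian F G = S * ((S * A * F^`()) * D * G - F * A * (S * D * G^`())).
    by rewrite /wronskian; ring.
  rewrite lF lG -/F -/G.
  have -> : S * ((n0 * A + i0.+2%:R * S * A^`()) * F * D * G
      - F * A * ((n2 * D + i2.+1%:R * S * D^`()) * G)) =
    S * (f0 * f2 * ((n0 - n2) * A * D + i0.+2%:R * S * A^`() * D - i2.+1%:R * S * A * D^`()))
     * (A ^+ i0.+2 * D ^+ i2.+1) by rewrite /F /G; ring.
  by rewrite hII (exprS A i0.+1) (exprS D i2); ring.
have lW : S * A * B * D * (wronskian F G)^`() =
    (nw * A * B * D + i0.+1%:R * S * A^`() * B * D + i1.+1%:R * S * A * B^`() * D
     + i2%:R * S * A * B * D^`()) * wronskian F G.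
  rewrite WE; have dA := mul_deriv_exp A i0.+1; have dB := mul_deriv_exp B i1.+1.
  have dD := mul_deriv_exp D i2.
  move: (A ^+ i0.+1) (B ^+ i1.+1) (D ^+ i2) dA dB dD => a b d dA dB dD.
  have -> : S * A * B * D * (w * a * b * d)^`() = (S * w^`()) * A * B * D * a * b * d
     + S * B * D * w * b * d * (A * a^`()) + S * A * D * w * a * d * (B * b^`())
     + S * A * B * w * a * b * (D * d^`()) by rewrite !derivM; ring.
  by rewrite hw dA dB dD; ring.
set W := wronskian F G in lW WE.
pose K := pull_den F G; pose M := pull_num (hge l0 l1 l2) F G.
have c1E : hgc1 (hge l0 l1 l2) = 1 - l1 by rewrite /hgc1 /=; field.
have cooE : hgcoo (hge l0 l1 l2) = l0 + l1 by rewrite /hgcoo /=; field.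
have KE : K = F * G * H * W by rewrite /K /pull_den FGH.
(* This says N = m / (S D): the poles at the roots of A and B have disappeared. *)
have MK : M * (S * D) = m * K.
  have nz : A * B != 0 by rewrite mulf_neq0.
  apply: (mulfI nz); rewrite KE /M /pull_num c1E cooE FGH -/W /= -!mul_polyC.
  have -> : A * B * (((1 - l0)%:P * (F^`() * G * H * W) + (1 - l1)%:P * (H^`() * F * G * W) +
       (l0 + l1)%:P * (G^`() * F * H * W) - W^`() * F * G * H) * (S * D)) =
    (1 - l0)%:P * (S * A * F^`()) * (B * D * G * H * W)
    + (1 - l1)%:P * (S * B * H^`()) * (A * D * F * G * W)
    + (l0 + l1)%:P * (S * D * G^`()) * (A * B * F * H * W)
    - (S * A * B * D * W^`()) * (F * G * H) by ring.
  rewrite lF lG lH lW -/F -/G -/H.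
  have e0' : (i0.+2)%:R * l0%:P * A^`() = A^`().
    by apply/eqP; rewrite -subr_eq0; apply/eqP; rewrite -[RHS]e0 polyCB polyCM polyC_natr; ring.
  have e1' : (i1.+2)%:R * l1%:P * B^`() = B^`().
    by apply/eqP; rewrite -subr_eq0; apply/eqP; rewrite -[RHS]e1 polyCB polyCM polyC_natr; ring.
  apply/eqP; rewrite -subr_eq0; apply/eqP.
  transitivity (S * F * G * H * W * (B * D * (A^`() - i0.+2%:R * l0%:P * A^`())
      + A * D * (B^`() - i1.+2%:R * l1%:P * B^`()))); last by rewrite e0' e1'; ring.
  by rewrite /m; ring.
have VP : (S * D) ^+ 2 * W ^+ 2 = F * H * G ^+ 2 * (V * (A ^+ i0 * B ^+ i1)).
  have -> : F * H * G ^+ 2 * (V * (A ^+ i0 * B ^+ i1)) =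
     (V * (f0 * f1 * f2 ^+ 2)) * (A ^+ i0.+2 * A ^+ i0 * (B ^+ i1.+2 * B ^+ i1) * (D ^+ i2.+1) ^+ 2).
    by rewrite /F /G /H; ring.
  by rewrite hV WE !exprS; ring.
rewrite /pull_identity; apply: (mulfI (expf_neq0 2 (mulf_neq0 S0 D0))).
have Sq : 'X ^+ 2 * ('X - 1%:P) ^+ 2 = S ^+ 2 :> {poly C} by rewrite polyC1; ring.
rewrite Sq /pull_lhs -/K -/M -/W FGH.
have rhsE : pull_rhs (hge m0 m1 m2) = (m0 ^+ 2 - 1)%:P * ('X - 1) ^+ 2 + (m1 ^+ 2 - 1)%:P * 'X ^+ 2
     + (1 - m0 ^+ 2 - m1 ^+ 2 + m2 ^+ 2)%:P * S.
  rewrite /pull_rhs /hgc1 /= -!mul_polyC polyC1.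
  by congr (_%:P * _ + _%:P * _ + _%:P * _); field.
have abE : 4 * (hgA (hge l0 l1 l2) * hgB (hge l0 l1 l2)) = (1 - l0 - l1) ^+ 2 - l2 ^+ 2.
  by rewrite /=; field.
rewrite rhsE abE -!mul_polyC.
have dMK : M^`() * (S * D) = m^`() * K + m * K^`() - M * (S * D)^`().
  by have := congr1 (fun p => p^`()) MK; rewrite /= !(derivM M) (derivM m) => <-; rewrite addrK.
set v := ((1 - l0 - l1) ^+ 2 - l2 ^+ 2)%:P in hI *.
move: hI VP MK dMK; set Z := S * D; set Q := A ^+ i0 * B ^+ i1.
set RR := (m0 ^+ 2 - 1)%:P * _ + _ + _.
move: (m^`()) (M^`()) (K^`()) (Z^`()) => dm dM dK dZ hI VP MK dMK.
have -> : Z ^+ 2 * (S ^+ 2 * (2%:P * (dM * K - M * dK) + M ^+ 2 - v * (F * H * W ^+ 4))) =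
   S ^+ 2 * (2%:R * (Z * K * (dM * Z) - (M * Z) * Z * dK) + (M * Z) ^+ 2
     - v * F * H * W ^+ 2 * (Z ^+ 2 * W ^+ 2)) by rewrite polyC_natr; ring.
rewrite dMK MK VP.
have -> : S ^+ 2 * (2%:R * (Z * K * (dm * K + m * dK - M * dZ) - m * K * Z * dK) + (m * K) ^+ 2
     - v * F * H * W ^+ 2 * (F * H * G ^+ 2 * (V * Q))) =
   S ^+ 2 * (K ^+ 2 * (2%:R * (dm * Z) + m ^+ 2) - 2%:R * K * dZ * (M * Z)
     - v * (F * G * H * W) ^+ 2 * (V * Q)) by ring.
rewrite MK -KE.
have -> : S ^+ 2 * (K ^+ 2 * (2%:R * (dm * Z) + m ^+ 2) - 2%:R * K * dZ * (m * K)
     - v * K ^+ 2 * (V * Q)) =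
   S ^+ 2 * K ^+ 2 * (2%:R * (dm * Z - m * dZ) + m ^+ 2 - v * V * Q) by ring.
by rewrite hI /Z; ring.
Qed.

End Factored.

Section Transformations.
Variable R : realType.
Local Notation C := (R[i]).
Implicit Types (a b c l m : C).

Definition transforms (l0 l1 l2 m0 m1 m2 : C) (d : nat) : Prop :=
  exists2 phi : ratfun R, rdegree phi = d & pullback phi (hge l0 l1 l2) (hge m0 m1 m2).

Lemma transforms_comp l0 l1 l2 m0 m1 m2 n0 n1 n2 d e :
  transforms l0 l1 l2 m0 m1 m2 d -> transforms m0 m1 m2 n0 n1 n2 e ->
  transforms l0 l1 l2 n0 n1 n2 (d * e).
Proof.
move=> [phi <- p1] [psi <- p2]; have [chi dE p3] := pullback_comp p1 p2 erefl.
by exists chi.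
Qed.

Lemma transforms_identity (F G : {poly C}) d l0 l1 l2 m0 m1 m2 :
  (forall x, F.[x] = 0 -> G.[x] != 0) -> G != 0 -> maxn (size F).-1 (size G).-1 = d -> (0 < d)%N ->
  pull_identity (hge l0 l1 l2) (hge m0 m1 m2) F G -> transforms l0 l1 l2 m0 m1 m2 d.
Proof.
move=> cFG G0 dE d0 idt; pose phi := RatFun G0 (coprimep_of_roots cFG).
by exists phi => //; apply: pull_identity_pullback => //; rewrite /rdegree dE.
Qed.

(* Lists of coefficients start with the constant term. *)
Fixpoint cpoly (s : seq C) : {poly C} := if s is a :: s' then a%:P + 'X * cpoly s' else 0.
Fixpoint ceval (s : seq C) (x : C) : C := if s is a :: s' then a + x * ceval s' x else 0.
Fixpoint cderiv (s : seq C) (x : C) : C :=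
  if s is a :: s' then ceval s' x + x * cderiv s' x else 0.

Lemma ceval_horner s x : (cpoly s).[x] = ceval s x.
Proof.
elim: s => [|a s IH] /=; first by rewrite horner0.
by rewrite hornerD hornerM hornerC hornerX IH.
Qed.

Lemma cderiv_horner s x : (cpoly s)^`().[x] = cderiv s x.
Proof.
elim: s => [|a s IH] /=; first by rewrite deriv0 horner0.
by rewrite derivD derivM derivC derivX add0r mul1r hornerD hornerM hornerX IH ceval_horner.
Qed.

Lemma size_cpoly a s : last a s != 0 -> size (cpoly (a :: s)) = (size s).+1.
Proof.
elim: s a => [|b s IH] a h; first by rewrite /= mulr0 addr0 size_polyC h.
have sE := IH b h; rewrite -[cpoly _]/(a%:P + 'X * cpoly (b :: s)) addrC (mulrC 'X).
have p0 : cpoly (b :: s) != 0 by rewrite -size_poly_eq0 sE.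
by rewrite size_polyDl size_mulX// ?sE// size_polyC; case: eqP.
Qed.

Lemma cpoly_neq0 s : last 0 s != 0 -> cpoly s != 0 /\ (size (cpoly s)).-1 = (size s).-1.
Proof.
case: s => [|a s] h; first by rewrite eqxx in h.
by rewrite -size_poly_eq0 size_cpoly.
Qed.

Lemma poly_ext (p q : {poly C}) : (forall x, p.[x] = q.[x]) -> p = q.
Proof.
move=> h; apply/eqP; rewrite -subr_eq0; apply/eqP.
apply: (@poly_eq0_of_generic _ 1); first exact: oner_neq0.
by move=> x _; rewrite hornerD hornerN h subrr.
Qed.

Lemma factor_degree (f A : {poly C}) k : f != 0 -> A != 0 ->
  (size (f * A ^+ k)).-1 = ((size f).-1 + (size A).-1 * k)%N.
Proof.
move=> f0 A0; rewrite size_mul ?expf_neq0// -size_exp.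
move: f0 (expf_neq0 k A0); rewrite -!size_poly_gt0.
by case: (size f) => // a _; case: (size (A ^+ k)) => // b _; rewrite /= addnS.
Qed.

(** Polynomials given by coefficient lists turn [factored_identity] into scalar identities in x,
    which [field] decides. The lists [t0], [t1], [t2], [tw] are x (x - 1) times logarithmic
    derivatives of [s0], [s1], [s2], [sw]; [sw] is the part of the Wronskian outside the powers of
    A, B, D, and [sm] is the numerator of N over x (x - 1) D. *)
Lemma transforms_factored (sA sB sD s0 s1 s2 sw sV t0 t1 t2 tw sm : seq C) (i0 i1 i2 d : nat)
    (l0 l1 l2 m0 m1 m2 : C) :
  all (fun s => last 0 s != 0) [:: s0; s1; s2; sA; sB; sD] ->
  maxn ((size s0).-1 + (size sA).-1 * i0.+2) ((size s2).-1 + (size sD).-1 * i2.+1) = d -> (0 < d)%N ->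
  (forall x, ceval s0 x = 0 \/ ceval sA x = 0 -> ceval s2 x != 0 /\ ceval sD x != 0) ->
  (forall x, x * (x - 1) * cderiv s0 x = ceval t0 x * ceval s0 x) ->
  (forall x, x * (x - 1) * cderiv s1 x = ceval t1 x * ceval s1 x) ->
  (forall x, x * (x - 1) * cderiv s2 x = ceval t2 x * ceval s2 x) ->
  (forall x, x * (x - 1) * cderiv sw x = ceval tw x * ceval sw x) ->
  (forall x, ((i0.+2)%:R * l0 - 1) * cderiv sA x = 0) ->
  (forall x, ((i1.+2)%:R * l1 - 1) * cderiv sB x = 0) ->
  (forall x, ceval s0 x * ceval sA x ^+ i0.+2 - ceval s2 x * ceval sD x ^+ i2.+1 =
     ceval s1 x * ceval sB x ^+ i1.+2) ->
  (forall x, ceval s0 x * ceval s2 x * ((ceval t0 x - ceval t2 x) * ceval sA x * ceval sD x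
      + i0.+2%:R * (x * (x - 1)) * cderiv sA x * ceval sD x
      - i2.+1%:R * (x * (x - 1)) * ceval sA x * cderiv sD x) =
    x * (x - 1) * ceval sw x * ceval sB x ^+ i1.+1) ->
  (forall x, ceval sV x * (ceval s0 x * ceval s1 x * ceval s2 x ^+ 2) =
    (x * (x - 1)) ^+ 2 * ceval sw x ^+ 2) ->
  (forall x, ceval sm x = ((1 - l0) * ceval t0 x + (1 - l1) * ceval t1 x + (l0 + l1) * ceval t2 x
      - ceval tw x) * ceval sD x + ((l0 + l1) * i2.+1%:R - i2%:R) * (x * (x - 1)) * cderiv sD x) ->
  (forall x, 2 * (cderiv sm x * (x * (x - 1) * ceval sD x)
      - ceval sm x * ((2 * x - 1) * ceval sD x + x * (x - 1) * cderiv sD x)) + ceval sm x ^+ 2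
     - ((1 - l0 - l1) ^+ 2 - l2 ^+ 2) * ceval sV x * (ceval sA x ^+ i0 * ceval sB x ^+ i1) =
   ((m0 ^+ 2 - 1) * (x - 1) ^+ 2 + (m1 ^+ 2 - 1) * x ^+ 2
     + (1 - m0 ^+ 2 - m1 ^+ 2 + m2 ^+ 2) * (x * (x - 1))) * ceval sD x ^+ 2) ->
  transforms l0 l1 l2 m0 m1 m2 d.
Proof.
move=> /= /and5P[/cpoly_neq0[z0 d0] /cpoly_neq0[z1 _] /cpoly_neq0[z2 d2] /cpoly_neq0[zA dA]].
move=> /and3P[/cpoly_neq0[zB _] /cpoly_neq0[zD dD] _] dE dp cop h0 h1 h2 hw e0 e1 hH hII hV hm hI.
pose hE := (ceval_horner, cderiv_horner).
have hX (x : C) : ('X * ('X - 1) : {poly C}).[x] = x * (x - 1).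
  by rewrite hornerM hornerD hornerN hornerX hornerC.
apply: (@transforms_identity (cpoly s0 * cpoly sA ^+ i0.+2) (cpoly s2 * cpoly sD ^+ i2.+1)) => //.
- move=> x; rewrite (hornerM (cpoly s0)) horner_exp (hornerM (cpoly s2)) horner_exp !hE => /eqP.
  rewrite mulf_eq0 expf_eq0 /= => h.
  have [|g0 gD] := cop x; first by case/orP: h => /eqP ->; [left | right].
  by apply: mulf_neq0 => //; apply: expf_neq0.
- by rewrite mulf_neq0// expf_neq0.
- by rewrite !factor_degree// d0 d2 dA dD.
have ld s t : (forall x, x * (x - 1) * cderiv s x = ceval t x * ceval s x) ->
    'X * ('X - 1) * (cpoly s)^`() = cpoly t * cpoly s.
  move=> h; apply: poly_ext => x.
  by rewrite (hornerM ('X * ('X - 1))) hX (hornerM (cpoly t)) !hE.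
have lc k (c : C) s : (forall x, (k%:R * c - 1) * cderiv s x = 0) ->
    (k%:R * c - 1)%:P * (cpoly s)^`() = 0.
  by move=> h; apply: poly_ext => x; rewrite hornerCM hE h horner0.
apply: (factored_identity (ld _ _ h0) (ld _ _ h1) (ld _ _ h2) (ld _ _ hw) z0 z1 z2 zA zB zD
  (lc _ _ _ e0) (lc _ _ _ e1) (V := cpoly sV)).
- apply: poly_ext => x; rewrite hornerD hornerN (hornerM (cpoly s0)) (hornerM (cpoly s2)).
  by rewrite (hornerM (cpoly s1)) !horner_exp !hE.
- apply: poly_ext => x; rewrite -!polyC_natr.
  rewrite (hornerM (_ * cpoly sw)) (hornerM _ (cpoly sw)) hX (hornerM (cpoly s0 * _)) (hornerM (cpoly s0)).
  rewrite !hornerD !hornerN !(hornerM _ (cpoly sD)) !(hornerM _ (cpoly sD)^`()) !(hornerM _ (cpoly sA)).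
  rewrite (hornerM _ (cpoly sA)^`()) !hornerCM hX !hornerD !hornerN horner_exp !hE.
  exact: hII.
- apply: poly_ext => x; rewrite (hornerM (cpoly sV)) (hornerM _ (cpoly s2 ^+ 2)) (hornerM (cpoly s0)).
  by rewrite (hornerM _ (cpoly sw ^+ 2)) !horner_exp hX !hE.
cbv zeta; have -> : ((1 - l0)%:P * cpoly t0 + (1 - l1)%:P * cpoly t1 + (l0 + l1)%:P * cpoly t2 - cpoly tw)
    * cpoly sD + ((l0 + l1) * i2.+1%:R - i2%:R)%:P * ('X * ('X - 1)) * (cpoly sD)^`() = cpoly sm.
  apply: poly_ext => x; rewrite hornerD !(hornerM _ (cpoly sD)) (hornerM _ (cpoly sD)^`()).
  by rewrite !(hornerD, hornerN) !hornerCM hX !hE -hm.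
have dS : (('X * ('X - 1) : {poly C}) * cpoly sD)^`() =
    (2%:P * 'X - 1%:P) * cpoly sD + 'X * ('X - 1) * (cpoly sD)^`().
  by rewrite !derivM derivD derivN derivX (derivC (1 : C)) polyC1 polyC_natr; ring.
rewrite dS -polyC_natr; apply: poly_ext => x.
pose hR := (hornerD, hornerN, hornerCM, hornerC, hornerX, horner_exp).
have hS (p : {poly C}) : ('X * ('X - 1) * p).[x] = x * (x - 1) * p.[x] by rewrite hornerM hX.
rewrite !(hornerM _ (cpoly sD ^+ 2)) !hR hX.
rewrite !(hornerM (cpoly sm)^`()) !(hornerM (cpoly sm)) hS !hR hS.
rewrite !(hornerM _ (cpoly sD)) !(hornerM _ (cpoly sA ^+ i0 * _)) !(hornerM _ (cpoly sV)) !(hornerM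
    _ (cpoly sB ^+ i1)).
rewrite !hR !hE; exact: hI.
Qed.

Lemma transforms_swap01 a b c : transforms a b c b a c 1.
Proof.
apply: (@transforms_factored [:: 1] [:: 1] [:: 1] [:: 1; -1] [:: 0; -1] [:: 1] [:: -1]
  [:: 0; -1; 1] [:: 0; 1] [:: -1; 1] [:: 0] [:: 0] [:: b - 1; 2 - a - b] 0 0 0) => //.
- by rewrite /= ?oppr_eq0 ?oner_neq0.
- by move=> x _ /=; rewrite mulr0 addr0 oner_neq0.
all: move=> x /=; by field.
Qed.

Lemma transforms_swap0oo a b c : transforms a b c c b a 1.
Proof.
apply: (@transforms_factored [:: 1] [:: 1] [:: 1] [:: 1] [:: 1; -1] [:: 0; 1] [:: -1]
  [:: 1; -1] [:: 0] [:: 0; 1] [:: -1; 1] [:: 0] [:: - (a + b); 1 + a] 0 0 0) => //.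
- by rewrite /= ?oppr_eq0 ?oner_neq0.
- by move=> x [] /eqP /=; rewrite mulr0 addr0 oner_eq0.
all: move=> x /=; by field.
Qed.

(** phi = (2 x - 1)^2 and phi - 1 = 4 x (x - 1). *)
Lemma transforms_quadratic b c : transforms (1/2) b c b b (2 * c) 2.
Proof.
apply: (@transforms_factored [:: -1; 2] [:: 1] [:: 1] [:: 1] [:: 0; -4; 4] [:: 1] [:: 4]
  [:: 0; -4; 4] [:: 0] [:: -1; 2] [:: 0] [:: 0] [:: b - 1; 2 - 2 * b] 0 0 0) => //.
- by rewrite /= ?oner_neq0 ?pnatr_eq0.
- by move=> x _ /=; rewrite mulr0 addr0 oner_neq0.
all: move=> x /=; by field.
Qed.

(** phi = x (8 x - 9)^2 / (27 (1 - x)), with numerator of phi - 1 equal to (4 x - 3)^3. *)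
Lemma transforms_cubic c : transforms (1/2) (1/3) c (1/2) c (2 * c) 3.
Proof.
apply: (@transforms_factored [:: -9; 8] [:: -3; 4] [:: 1] [:: 0; 1] [:: 1] [:: 27; -27] [:: -27]
  [:: 0; 1] [:: -1; 1] [:: 0] [:: 0; 1] [:: 0] [:: -1/2; 4/3] 0 1 0) => //.
- by rewrite /= ?oppr_eq0 ?oner_neq0 ?pnatr_eq0.
- move=> x /= h; rewrite !mulr0 !addr0 oner_neq0; split=> //.
  apply/eqP => g; have x1 : x = 1 by apply: (linear_elim (c1 := -1/27) (c2 := 0) g (erefl 0)); field.
  suff /eqP : (1 : C) = 0 by rewrite oner_eq0.
  by case: h => h; rewrite x1 in h; [apply: (linear_elim (c1 := 1) (c2 := 0) h (erefl 0)) |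
    apply: (linear_elim (c1 := -1) (c2 := 0) h (erefl 0))]; ring.
all: move=> x /=; by field.
Qed.

(** phi = (27 x^2 - 36 x + 8)^2 / (64 (1 - x)), with numerator of phi - 1 equal to x (9 x - 8)^3. *)
Lemma transforms_quartic c : transforms (1/2) (1/3) c (1/3) c (3 * c) 4.
Proof.
apply: (@transforms_factored [:: 8; -36; 27] [:: -8; 9] [:: 1] [:: 1] [:: 0; 1] [:: 64; -64] [:: -64]
  [:: 0; 1] [:: 0] [:: -1; 1] [:: 0; 1] [:: 0] [:: -2/3; 3/2] 0 1 0) => //.
- by rewrite /= ?oppr_eq0 ?oner_neq0 ?pnatr_eq0.
- move=> x /= h; rewrite !mulr0 !addr0 oner_neq0; split=> //.
  apply/eqP => g; have x1 : x = 1 by apply: (linear_elim (c1 := -1/64) (c2 := 0) g (erefl 0)); field.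
  suff /eqP : (1 : C) = 0 by rewrite oner_eq0.
  by case: h => h; rewrite x1 in h; [apply: (linear_elim (c1 := 1) (c2 := 0) h (erefl 0)) |
    apply: (linear_elim (c1 := -1) (c2 := 0) h (erefl 0))]; ring.
all: move=> x /=; by field.
Qed.

End Transformations.

Section MoreTransformations.
Variable R : realType.
Local Notation C := (R[i]).
Local Notation transforms := (@transforms R).

Lemma quadratic_root (u v : C) : exists t, t ^+ 2 = u * t + v.
Proof.
have [x xE] := solve_monicpoly (fun i => if i is 0%N then v else u) (isT : (0 < 2)%N).
by exists x; rewrite xE !big_ord_recl big_ord0 /= expr0 mulr1 expr1 addr0 addrC.
Qed.

(* The coverings of degree 8 and 10 and the one of degree 6 are those of Vidunas;
   the one of degree 9 was found by solving the recursion for the coefficients. *)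
Lemma transforms_cyclic_cubic c : transforms (1/3) (1/3) c c c c 3.
Proof.
(* [th] is a primitive cube root of unity, and (x + th)^3 - (x + th^2)^3 = (3 + 6 th) x (x - 1). *)
have [th e] := quadratic_root (- 1) (- 1).
have nzf2 : (3 + 6 * th) != 0 :> C.
  apply/eqP => g; suff /eqP : (1 : C) = 0 by rewrite oner_eq0.
  by apply: (linear_elim (c1 := - 1 / 9 - 2 / 9 * th) (c2 := 0) g (erefl 0)); field: e.
apply: (@transforms_factored R [:: th; 1]
  [:: - 1 - th; 1]
  [:: 1]
  [:: 1] [:: 1] [:: 0; - 3 - 6 * th; 3 + 6 * th] [:: 3 + 6 * th]
  [:: 1] [:: 0] [:: 0] [:: - 1; 2] [:: 0]
  [:: - 2 / 3; 4 / 3] 1 1 0).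
- apply/andP; split; [exact: oner_neq0 _ | apply/andP; split; [exact: oner_neq0 _ | apply/andP;
    split; [exact: nzf2 | apply/andP; split; [exact: oner_neq0 _ | apply/andP; split; [exact:
    oner_neq0 _ | apply/andP; split; [exact: oner_neq0 _ | by []]]]]]].
- by [].
- by [].
- move=> x /= h; split; apply/eqP => g; (suff /eqP : (1 : C) = 0 by rewrite oner_eq0); case: h => h.
  + by apply: (linear_elim (c1 := (1)) (c2 := 0) h g); field: e.
  + by apply: (linear_elim (c1 := (- 1 - th + x * (1))) (c2 := (1 / 9 + 2 / 9 * th)) h g); field: e.
  + by apply: (linear_elim (c1 := 0) (c2 := (1)) h g); field: e.
  + by apply: (linear_elim (c1 := 0) (c2 := (1)) h g); field: e.
all: move=> x /=; by field: e.
Qed.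

Lemma transforms_degree_6 : transforms (1/4) (1/2) (1/5) (1/4) (1/4) (1/5) 6.
Proof.
(* [th] is a square root of -1, and phi = 4 th x (x - 1) (4 x - 2 - 11 th)^4 / (8 x - 4 + 3
   th)^5. *)
have [th e] := quadratic_root (0) (- 1).
have nzf0 : (4 * th) != 0 :> C.
  apply/eqP => g; suff /eqP : (1 : C) = 0 by rewrite oner_eq0.
  by apply: (linear_elim (c1 := - 1 / 4 * th) (c2 := 0) g (erefl 0)); field: e.
have nzf1 : (th) != 0 :> C.
  apply/eqP => g; suff /eqP : (1 : C) = 0 by rewrite oner_eq0.
  by apply: (linear_elim (c1 := - th) (c2 := 0) g (erefl 0)); field: e.
have nzA : (4) != 0 :> C.
  apply/eqP => g; suff /eqP : (1 : C) = 0 by rewrite oner_eq0.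
  by apply: (linear_elim (c1 := 1 / 4) (c2 := 0) g (erefl 0)); field: e.
have nzB : (32) != 0 :> C.
  apply/eqP => g; suff /eqP : (1 : C) = 0 by rewrite oner_eq0.
  by apply: (linear_elim (c1 := 1 / 32) (c2 := 0) g (erefl 0)); field: e.
have nzD : (8) != 0 :> C.
  apply/eqP => g; suff /eqP : (1 : C) = 0 by rewrite oner_eq0.
  by apply: (linear_elim (c1 := 1 / 8) (c2 := 0) g (erefl 0)); field: e.
apply: (@transforms_factored R [:: - 2 - 11 * th; 4]
  [:: - 41 - 38 * th; 98 - 336 * th; - 48 + 336 * th; 32]
  [:: - 4 + 3 * th; 8]
  [:: 0; - 4 * th; 4 * th] [:: th] [:: 1] [:: 4 * th]
  [:: 0; - 4; 4] [:: - 1; 2] [:: 0] [:: 0] [:: 0]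
  [:: 3 - 9 / 4 * th; - 10 + 9 / 2 * th; 10] 2 0 4).
- apply/andP; split; [exact: nzf0 | apply/andP; split; [exact: nzf1 | apply/andP; split; [exact:
    oner_neq0 _ | apply/andP; split; [exact: nzA | apply/andP; split; [exact: nzB | apply/andP;
    split; [exact: nzD | by []]]]]]].
- by [].
- by [].
- move=> x /= h; split; apply/eqP => g; (suff /eqP : (1 : C) = 0 by rewrite oner_eq0); case: h => h.
  + by apply: (linear_elim (c1 := 0) (c2 := (1)) h g); field: e.
  + by apply: (linear_elim (c1 := 0) (c2 := (1)) h g); field: e.
  + by apply: (linear_elim (c1 := (16 / 25 * th)) (c2 := (- 4 / 25 - 3 / 25 * th + x * (8 / 25))) h
      g); field: e.
  + by apply: (linear_elim (c1 := (2 / 25 * th)) (c2 := (- 1 / 25 * th)) h g); field: e.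
all: move=> x /=; by field: e.
Qed.

Lemma transforms_degree_8 : transforms (1/3) (1/2) (1/7) (1/3) (1/3) (1/7) 8.
Proof.
(* The covering is defined over the field of cube roots of unity; it has the form x (x - 1) A^3 /
   (64 D^7) with A quadratic and D linear. *)
have [th e] := quadratic_root (- 1) (- 1).
have nzf1 : (1 / 3) != 0 :> C.
  apply/eqP => g; suff /eqP : (1 : C) = 0 by rewrite oner_eq0.
  by apply: (linear_elim (c1 := 3) (c2 := 0) g (erefl 0)); field: e.
have nzf2 : (64) != 0 :> C.
  apply/eqP => g; suff /eqP : (1 : C) = 0 by rewrite oner_eq0.
  by apply: (linear_elim (c1 := 1 / 64) (c2 := 0) g (erefl 0)); field: e.
have nzA : (27) != 0 :> C.
  apply/eqP => g; suff /eqP : (1 : C) = 0 by rewrite oner_eq0.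
  by apply: (linear_elim (c1 := 1 / 27) (c2 := 0) g (erefl 0)); field: e.
have nzB : (243) != 0 :> C.
  apply/eqP => g; suff /eqP : (1 : C) = 0 by rewrite oner_eq0.
  by apply: (linear_elim (c1 := 1 / 243) (c2 := 0) g (erefl 0)); field: e.
have nzD : (3 + 6 * th) != 0 :> C.
  apply/eqP => g; suff /eqP : (1 : C) = 0 by rewrite oner_eq0.
  by apply: (linear_elim (c1 := - 1 / 9 - 2 / 9 * th) (c2 := 0) g (erefl 0)); field: e.
apply: (@transforms_factored R [:: - 496 + 696 * th; - 723 - (1 * 1000 + 392) * th; 27]
  [:: (10 * 1000 + 40) + (14 * 1000 + 104) * th; - (113 * 1000 + 464) - (14 * 1000 + 276) * th; (85
      * 1000 + 671) - (41 * 1000 + 796) * th; (13 * 1000 + 446) + (27 * 1000 + 864) * th; 243]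
  [:: - 8 - 3 * th; 3 + 6 * th]
  [:: 0; - 1; 1] [:: 1 / 3] [:: 64] [:: 64 / 3 + 128 / 3 * th]
  [:: 0; 1; - 1] [:: - 1; 2] [:: 0] [:: 0] [:: 0]
  [:: 16 / 3 + 2 * th; - 73 / 6 - 7 * th; 7 / 2 + 7 * th] 1 0 6).
- apply/andP; split; [exact: oner_neq0 _ | apply/andP; split; [exact: nzf1 | apply/andP; split;
    [exact: nzf2 | apply/andP; split; [exact: nzA | apply/andP; split; [exact: nzB | apply/andP;
    split; [exact: nzD | by []]]]]]].
- by [].
- by [].
- move=> x /= h; split; apply/eqP => g; (suff /eqP : (1 : C) = 0 by rewrite oner_eq0); case: h => h.
  + by apply: (linear_elim (c1 := 0) (c2 := (1 / 64)) h g); field: e.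
  + by apply: (linear_elim (c1 := 0) (c2 := (1 / 64)) h g); field: e.
  + by apply: (linear_elim (c1 := (- 27 / 49)) (c2 := (- 5 / 49 + 3 / 49 * th + x * (- 3 / 49 - 6 /
      49 * th))) h g); field: e.
  + by apply: (linear_elim (c1 := (- 1 / (2 * 1000 + 401))) (c2 := (- 237 / (2 * 1000 + 401) + 3 /
      (2 * 1000 + 401) * th + x * (- 3 / (2 * 1000 + 401) - 6 / (2 * 1000 + 401) * th))) h g);
      field: e.
all: move=> x /=; by field: e.
Qed.

Lemma transforms_degree_9 : transforms (1/7) (1/2) (1/3) (1/2) (1/7) (1/7) 9.
Proof.
(* [th] generates the field of a square root of -7, over which the covering is defined. *)
have [th e] := quadratic_root (- 1) (- 2).
have nzf0 : (27) != 0 :> C.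
  apply/eqP => g; suff /eqP : (1 : C) = 0 by rewrite oner_eq0.
  by apply: (linear_elim (c1 := 1 / 27) (c2 := 0) g (erefl 0)); field: e.
have nzA : (- 3 + 7 * th) != 0 :> C.
  apply/eqP => g; suff /eqP : (1 : C) = 0 by rewrite oner_eq0.
  by apply: (linear_elim (c1 := - 5 / 64 - 7 / 128 * th) (c2 := 0) g (erefl 0)); field: e.
have nzB : (- (1 * 1000 + 541) - 287 * th) != 0 :> C.
  apply/eqP => g; suff /eqP : (1 : C) = 0 by rewrite oner_eq0.
  by apply: (linear_elim (c1 := - 627 / ((1 * 1000 + 48) * 1000 + 576) + 287 / ((2 * 1000 + 97) *
      1000 + 152) * th) (c2 := 0) g (erefl 0)); field: e.
have nzD : (89 + 91 * th) != 0 :> C.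
  apply/eqP => g; suff /eqP : (1 : C) = 0 by rewrite oner_eq0.
  by apply: (linear_elim (c1 := - 1 / (8 * 1000 + 192) - 91 / (16 * 1000 + 384) * th) (c2 := 0) g
      (erefl 0)); field: e.
apply: (@transforms_factored R [:: - 7 - 14 * th; - 3 + 7 * th]
  [:: - (151 * 1000 + 263) - (302 * 1000 + 526) * th; (509 * 1000 + 12) + (605 * 1000 + 52) * th; -
      (429 * 1000 + 534) - (239 * 1000 + 610) * th; (74 * 1000 + 580) - (62 * 1000 + 916) * th; - (1
      * 1000 + 541) - 287 * th]
  [:: (1 * 1000 + 29) + (2 * 1000 + 58) * th; - (6 * 1000 + 517) - (3 * 1000 + 87) * th; (5 * 1000 +
      397) + 847 * th; 89 + 91 * th]
  [:: - 27; 27] [:: 0; 1] [:: 1] [:: - 27]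
  [:: 0; - 27; 27] [:: 0; 1] [:: - 1; 1] [:: 0] [:: 0]
  [:: - (1 * 1000 + 29) / 2 - (1 * 1000 + 29) * th; (8 * 1000 + 379) / 2 + (4 * 1000 + 116) * th; -
      (20 * 1000 + 613) / 2 - (8 * 1000 + 543) / 2 * th; (91 * 1000 + 393) / 14 + (2 * 1000 + 5) / 2
      * th; 712 / 7 + 104 * th] 5 0 2).
- apply/andP; split; [exact: nzf0 | apply/andP; split; [exact: oner_neq0 _ | apply/andP; split;
    [exact: oner_neq0 _ | apply/andP; split; [exact: nzA | apply/andP; split; [exact: nzB |
    apply/andP; split; [exact: nzD | by []]]]]]].
- by [].
- by [].
- move=> x /= h; split; apply/eqP => g; (suff /eqP : (1 : C) = 0 by rewrite oner_eq0); case: h => h.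
  + by apply: (linear_elim (c1 := 0) (c2 := (1)) h g); field: e.
  + by apply: (linear_elim (c1 := 0) (c2 := (1)) h g); field: e.
  + by apply: (linear_elim (c1 := (- (299 * 1000 + 359) / (442 * 1000 + 368) + (9 * 1000 + 947) /
      (49 * 1000 + 152) * th + x * (- (17 * 1000 + 641) / (24 * 1000 + 576) - (248 * 1000 + 675) /
      (221 * 1000 + 184) * th + x * ((8 * 1000 + 641) / (442 * 1000 + 368) - (2 * 1000 + 639) / (147
      * 1000 + 456) * th)))) (c2 := (89 / (16 * 1000 + 384) + 91 / (16 * 1000 + 384) * th)) h g);
      field: e.
  + by apply: (linear_elim (c1 := ((2 * 1000 + 509) / (114 * 1000 + 688) + (5 * 1000 + 879) / (114 *
      1000 + 688) * th + x * (- (17 * 1000 + 419) / (401 * 1000 + 408) + 31 / (8 * 1000 + 192) * th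
      + x * (- (40 * 1000 + 309) / ((39 * 1000 + 337) * 1000 + 984) - (25 * 1000 + 199) / ((39 *
      1000 + 337) * 1000 + 984) * th)))) (c2 := (393 / ((39 * 1000 + 337) * 1000 + 984) + (2 * 1000
      + 795) / ((39 * 1000 + 337) * 1000 + 984) * th)) h g); field: e.
all: move=> x /=; by field: e.
Qed.

Lemma transforms_degree_10 : transforms (1/7) (1/2) (1/3) (2/7) (1/7) (1/3) 10.
Proof.
have nzf0 : (- 1) != 0 :> C.
  apply/eqP => g; suff /eqP : (1 : C) = 0 by rewrite oner_eq0.
  by apply: (linear_elim (c1 := - 1) (c2 := 0) g (erefl 0)); field.
have nzf1 : (- 1) != 0 :> C.
  apply/eqP => g; suff /eqP : (1 : C) = 0 by rewrite oner_eq0.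
  by apply: (linear_elim (c1 := - 1) (c2 := 0) g (erefl 0)); field.
have nzf2 : (4) != 0 :> C.
  apply/eqP => g; suff /eqP : (1 : C) = 0 by rewrite oner_eq0.
  by apply: (linear_elim (c1 := 1 / 4) (c2 := 0) g (erefl 0)); field.
have nzA : (49) != 0 :> C.
  apply/eqP => g; suff /eqP : (1 : C) = 0 by rewrite oner_eq0.
  by apply: (linear_elim (c1 := 1 / 49) (c2 := 0) g (erefl 0)); field.
have nzB : ((823 * 1000 + 543)) != 0 :> C.
  apply/eqP => g; suff /eqP : (1 : C) = 0 by rewrite oner_eq0.
  by apply: (linear_elim (c1 := 1 / (823 * 1000 + 543)) (c2 := 0) g (erefl 0)); field.
have nzD : ((16 * 1000 + 807)) != 0 :> C.
  apply/eqP => g; suff /eqP : (1 : C) = 0 by rewrite oner_eq0.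
  by apply: (linear_elim (c1 := 1 / (16 * 1000 + 807)) (c2 := 0) g (erefl 0)); field.
apply: (@transforms_factored R [:: - 81; 49]
  [:: ((1 * 1000 + 62) * 1000 + 882); - ((3 * 1000 + 365) * 1000 + 793); ((10 * 1000 + 287) * 1000 +
      648); - ((15 * 1000 + 169) * 1000 + 518); ((6 * 1000 + 353) * 1000 + 46); (823 * 1000 + 543)]
  [:: (6 * 1000 + 561); - (13 * 1000 + 851); - (9 * 1000 + 261); (16 * 1000 + 807)]
  [:: 0; 0; 1; - 1] [:: - 1] [:: 4] [:: 0; - 4]
  [:: 0; 0; - 1; 1] [:: - 2; 3] [:: 0] [:: 0] [:: - 1; 1]
  [:: - (32 * 1000 + 805) / 7; (269 * 1000 + 1) / 14; - (30 * 1000 + 969) / 2; - (43 * 1000 + 267) /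
      2; (45 * 1000 + 619) / 2] 5 0 2).
- apply/andP; split; [exact: nzf0 | apply/andP; split; [exact: nzf1 | apply/andP; split; [exact:
    nzf2 | apply/andP; split; [exact: nzA | apply/andP; split; [exact: nzB | apply/andP; split;
    [exact: nzD | by []]]]]]].
- by [].
- by [].
- move=> x /= h; split; apply/eqP => g; (suff /eqP : (1 : C) = 0 by rewrite oner_eq0); case: h => h.
  + by apply: (linear_elim (c1 := 0) (c2 := (1 / 4)) h g); field.
  + by apply: (linear_elim (c1 := 0) (c2 := (1 / 4)) h g); field.
  + by apply: (linear_elim (c1 := (- ((1 * 1000 + 35) * 1000 + 731) / (62 * 1000 + 208) + x * (((26
      * 1000 + 291) * 1000 + 293) / (839 * 1000 + 808) + x * (((871 * 1000 + 963) * 1000 + 967) /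
      ((15 * 1000 + 116) * 1000 + 544))))) (c2 := (1 / (6 * 1000 + 561) + x * (19 / (59 * 1000 + 49)
      + x * ((51 * 1000 + 881) / ((15 * 1000 + 116) * 1000 + 544))))) h g); field.
  + by apply: (linear_elim (c1 := (- 23 / (2 * 1000 + 304) + x * (- 343 / (31 * 1000 + 104) + x * (-
      (16 * 1000 + 807) / ((1 * 1000 + 679) * 1000 + 616))))) (c2 := (49 / ((1 * 1000 + 679) * 1000
      + 616))) h g); field.
all: move=> x /=; by field.
Qed.

Lemma transforms_degree_10_order_8 : transforms (1/8) (1/2) (1/3) (1/8) (1/8) (1/3) 10.
Proof.
(* The coefficients of this covering lie in the field of a square root of -2. *)
have [th e] := quadratic_root (0) (- 2).
have nzf0 : (4) != 0 :> C.
  apply/eqP => g; suff /eqP : (1 : C) = 0 by rewrite oner_eq0.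
  by apply: (linear_elim (c1 := 1 / 4) (c2 := 0) g (erefl 0)); field: e.
have nzA : (8 * th) != 0 :> C.
  apply/eqP => g; suff /eqP : (1 : C) = 0 by rewrite oner_eq0.
  by apply: (linear_elim (c1 := - 1 / 16 * th) (c2 := 0) g (erefl 0)); field: e.
have nzB : ((32 * 1000 + 768)) != 0 :> C.
  apply/eqP => g; suff /eqP : (1 : C) = 0 by rewrite oner_eq0.
  by apply: (linear_elim (c1 := 1 / (32 * 1000 + 768)) (c2 := 0) g (erefl 0)); field: e.
have nzD : ((2 * 1000 + 48) * th) != 0 :> C.
  apply/eqP => g; suff /eqP : (1 : C) = 0 by rewrite oner_eq0.
  by apply: (linear_elim (c1 := - 1 / (4 * 1000 + 96) * th) (c2 := 0) g (erefl 0)); field: e.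
apply: (@transforms_factored R [:: 7 - 4 * th; 8 * th]
  [:: 329 + 460 * th; - (69 * 1000 + 10) + (11 * 1000 + 200) * th; (188 * 1000 + 672) + (193 * 1000
      + 600) * th; - (71 * 1000 + 168) - (409 * 1000 + 600) * th; - (81 * 1000 + 920) + (204 * 1000
      + 800) * th; (32 * 1000 + 768)]
  [:: - 17 + 56 * th; (3 * 1000 + 264) + 912 * th; - (3 * 1000 + 264) - (3 * 1000 + 72) * th; (2 *
      1000 + 48) * th]
  [:: 0; - 4; 4] [:: 1] [:: 1] [:: - 4]
  [:: 0; - 4; 4] [:: - 1; 2] [:: 0] [:: 0] [:: 0]
  [:: 119 / 8 - 49 * th; - (9 * 1000 + 911) / 4 - 586 * th; (7 * 1000 + 344) + (3 * 1000 + 402) *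
      th; - (4 * 1000 + 896) - (5 * 1000 + 632) * th; (2 * 1000 + 816) * th] 6 0 2).
- apply/andP; split; [exact: nzf0 | apply/andP; split; [exact: oner_neq0 _ | apply/andP; split;
    [exact: oner_neq0 _ | apply/andP; split; [exact: nzA | apply/andP; split; [exact: nzB |
    apply/andP; split; [exact: nzD | by []]]]]]].
- by [].
- by [].
- move=> x /= h; split; apply/eqP => g; (suff /eqP : (1 : C) = 0 by rewrite oner_eq0); case: h => h.
  + by apply: (linear_elim (c1 := 0) (c2 := (1)) h g); field: e.
  + by apply: (linear_elim (c1 := 0) (c2 := (1)) h g); field: e.
  + by apply: (linear_elim (c1 := ((8 * 1000 + 528) / (6 * 1000 + 561) - (50 * 1000 + 48) / (6 *
      1000 + 561) * th + x * (- (114 * 1000 + 688) / (6 * 1000 + 561) + (100 * 1000 + 96) / (6 *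
      1000 + 561) * th + x * ((114 * 1000 + 688) / (6 * 1000 + 561))))) (c2 := (- 17 / (6 * 1000 +
      561) - 56 / (6 * 1000 + 561) * th + x * (112 / (6 * 1000 + 561) * th))) h g); field: e.
  + by apply: (linear_elim (c1 := (581 / (6 * 1000 + 561) + 316 / (6 * 1000 + 561) * th + x * (512 /
      (6 * 1000 + 561) - 632 / (6 * 1000 + 561) * th + x * (- 512 / (6 * 1000 + 561))))) (c2 := (2 /
      (6 * 1000 + 561))) h g); field: e.
all: move=> x /=; by field: e.
Qed.

End MoreTransformations.

(** * Realisation of the table by explicit coverings and their composites *)

Section Realisation.
Variable R : realType.
Local Notation C := (R[i]).
Local Notation transforms := (@transforms R).
Local Notation inj := (real_complex R).

Lemma transforms_swap1oo (a b c : C) : transforms a b c a c b 1.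
Proof.
exact: (transforms_comp (transforms_comp (transforms_swap01 a b c) (transforms_swap0oo b a c))
  (transforms_swap01 c a b)).
Qed.

Lemma transforms_cast (a b c a' b' c' c'' : C) d : c' = c'' ->
  transforms a b c a' b' c' d -> transforms a b c a' b' c'' d.
Proof. by move=> ->. Qed.

Lemma hge_exponents (a b c : R) e : perm_eq [:: a; b; c] e ->
  has_exponent_differences (hge (inj a) (inj b) (inj c)) e.
Proof.
move=> pe; exists [:: a; b; c] => //=; rewrite andbT.
by apply/and3P; split; apply/orP; left; apply/eqP; field.
Qed.

Lemma transforms_hg (xs ys : seq R) (a b c a' b' c' : C) d s t :
  transforms a b c a' b' c' d ->
  [:: a; b; c] = map inj xs -> [:: a'; b'; c'] = map inj ys ->
  perm_eq xs s -> perm_eq ys t -> hg_transformation s t d.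
Proof.
move=> [phi dE pb] xE yE ps pt; exists phi, (hge a b c), (hge a' b' c'); split=> //.
  by case: xs xE ps => [|x [|y [|z [|? ?]]]] // [-> -> ->]; apply: hge_exponents.
by case: ys yE pt => [|x [|y [|z [|? ?]]]] // [-> -> ->]; apply: hge_exponents.
Qed.

Lemma inj_ratio (j k : nat) : inj (j%:R / k%:R) = j%:R / k%:R.
Proof. by rewrite rmorphM fmorphV !rmorph_nat. Qed.

Lemma inj_inv (k : nat) : inj (1 / k%:R) = 1 / k%:R.
Proof. exact: (inj_ratio 1). Qed.

Section Perm3.
Variables (T : eqType) (a b c : T).
Lemma perm_eq132 : perm_eq [:: a; b; c] [:: a; c; b].
Proof. by rewrite perm_cons (perm_catC [:: b] [:: c]). Qed.
Lemma perm_eq213 : perm_eq [:: a; b; c] [:: b; a; c].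
Proof. by rewrite (perm_catCA [:: a] [:: b] [:: c]). Qed.
Lemma perm_eq231 : perm_eq [:: a; b; c] [:: b; c; a].
Proof. by rewrite (perm_catC [:: a] [:: b; c]). Qed.
Lemma perm_eq312 : perm_eq [:: a; b; c] [:: c; a; b].
Proof. by rewrite (perm_catC [:: a; b] [:: c]). Qed.
End Perm3.

Lemma perm_eq321 (T : eqType) (a b c : T) : perm_eq [:: a; b; c] [:: c; b; a].
Proof. by apply: perm_trans (perm_eq231 _ _ _) (perm_eq213 _ _ _). Qed.

(** Composite entries: both classical ones of degree 6 are 3 * 2, the one from (2, 4, m) is 2 * 2,
    the degrees 18 and 24 are 9 * 2 and 8 * 3, and the two of degree 12 are 3 * 2 * 2 and 4 * 3.
    Swaps in between put the differences where the next factor expects them, for instance 1/2 at 0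
    for the quadratic one. *)
Lemma table_transformation (s : seq nat) (t : seq R) (d : nat) : hg_table s t d ->
  hg_transformation (inverses R s) t d.
Proof.
have h2 : (1 / 2 : C) = inj (1 / 2) by rewrite (inj_inv 2).
have h3 : (1 / 3 : C) = inj (1 / 3) by rewrite (inj_inv 3).
have hn k : 1 / k%:R = inj (1 / k%:R) by rewrite inj_inv.
have hj j k : j%:R * (1 / k%:R) = inj (j%:R / k%:R) by rewrite inj_ratio mulrA mulr1.
have six k : 2 * (2 * (1 / k%:R)) = inj (4 / k%:R).
  by rewrite (inj_ratio 4) !mulrA mulr1 -natrM.
have half : (1 / 2 : C) = 2 * (1 / 4) by field.
case=> [l m lp mp|m mp|m mp|m mp|m mp|m mp|m mp|||||||||].
- apply: (@transforms_hg [:: 1 / 2; 1 / l%:R; 1 / m%:R] [:: 1 / l%:R; 1 / l%:R; 2 / m%:R] _ _ _ _ _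
    _ _ _ _ (transforms_quadratic (1 / l%:R) (1 / m%:R))); [| | exact: perm_refl | exact:
    perm_refl].
    by rewrite /= -h2 -!hn.
  by rewrite /= -hn -(hj 2).
- apply: (@transforms_hg [:: 1 / 2; 1 / 3; 1 / m%:R] [:: 1 / 2; 1 / m%:R; 2 / m%:R] _ _ _ _ _ _ _ _
    _ (transforms_cubic (1 / m%:R))); [| | exact: perm_refl | exact: perm_refl].
    by rewrite /= -h2 -h3 -hn.
  by rewrite /= -h2 -hn -(hj 2).
- apply: (@transforms_hg [:: 1 / 2; 1 / 3; 1 / m%:R] [:: 1 / 3; 1 / m%:R; 3 / m%:R] _ _ _ _ _ _ _ _
    _ (transforms_quartic (1 / m%:R))); [| | exact: perm_refl | exact: perm_refl].
    by rewrite /= -h2 -h3 -hn.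
  by rewrite /= -h3 -hn -(hj 3).
- apply: (@transforms_hg [:: 1 / 2; 1 / 3; 1 / m%:R] [:: 1 / m%:R; 1 / m%:R; 4 / m%:R] _ _ _ _ _ _ _
    _ _ (transforms_comp (transforms_cubic (1 / m%:R))
    (transforms_quadratic _ _))); [| | exact: perm_refl | exact: perm_refl].
    by rewrite /= -h2 -h3 -hn.
  by rewrite /= -hn -six.
- apply: (@transforms_hg [:: 1 / 2; 1 / 3; 1 / m%:R] [:: 2 / m%:R; 2 / m%:R; 2 / m%:R] _ _ _ _ _ _ _
    _ _ (transforms_comp (transforms_comp (transforms_cubic (1 / m%:R))
    (transforms_swap1oo _ _ _)) (transforms_quadratic _ _))); [| | exact: perm_refl | exact: perm_refl].
    by rewrite /= -h2 -h3 -hn.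
  by rewrite /= -(hj 2).
- have T : transforms (1 / 2) (1 / m%:R) (1 / 4) (1 / m%:R) (1 / m%:R) (1 / 2) 2.
    exact: transforms_cast (esym half) (transforms_quadratic _ _).
  have T1 : transforms (1 / 2) (1 / m%:R) (1 / 4) (1 / 2) (1 / m%:R) (1 / m%:R) 2.
    exact: transforms_comp T (transforms_swap0oo _ _ _).
  have T2 : transforms (1 / 2) (1 / m%:R) (1 / 4) (1 / m%:R) (1 / m%:R) (2 * (1 / m%:R)) 4.
    exact: transforms_comp T1 (transforms_quadratic _ _).
  apply: (transforms_hg (xs := [:: 1 / 2; 1 / m%:R; 1 / 4]) (ys := [:: 1 / m%:R; 1 / m%:R; 2 / m%:R]) T2);
    [| | exact: perm_eq132 | exact: perm_refl].
    by rewrite /= -h2 -(hn m) -(hn 4).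
  by rewrite /= -hn -(hj 2).
- apply: (@transforms_hg [:: 1 / 3; 1 / 3; 1 / m%:R] [:: 1 / m%:R; 1 / m%:R; 1 / m%:R] _ _ _ _ _ _ _
    _ _ (transforms_cyclic_cubic (1 / m%:R))); [| | exact: perm_refl | exact: perm_refl].
    by rewrite /= -h3 -hn.
  by rewrite /= -hn.
- apply: (@transforms_hg [:: 1 / 3; 1 / 2; 1 / 7] [:: 1 / 3; 1 / 3; 1 / 7] _ _ _ _ _ _ _ _ _
    (transforms_degree_8 R)); [| | exact: perm_eq213 | exact: perm_refl].
    by rewrite /= -h2 -h3 -(hn 7).
  by rewrite /= -h3 -(hn 7).
- apply: (@transforms_hg [:: 1 / 7; 1 / 2; 1 / 3] [:: 1 / 2; 1 / 7; 1 / 7] _ _ _ _ _ _ _ _ _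
    (transforms_degree_9 R)); [| | exact: perm_eq231 | exact: perm_refl].
    by rewrite /= -h2 -h3 -(hn 7).
  by rewrite /= -h2 -(hn 7).
- apply: (@transforms_hg [:: 1 / 7; 1 / 2; 1 / 3] [:: 2 / 7; 1 / 7; 1 / 3] _ _ _ _ _ _ _ _ _
    (transforms_degree_10 R)); [| | exact: perm_eq231 | exact: perm_eq321].
    by rewrite /= -h2 -h3 -(hn 7).
  by rewrite /= -h3 -(hn 7) (inj_ratio 2 7).
- apply: (@transforms_hg [:: 1 / 7; 1 / 2; 1 / 3] [:: 1 / 7; 1 / 7; 2 / 7] _ _ _ _ _ _ _ _ _
    (transforms_comp (transforms_degree_9 R) (transforms_quadratic _ _)));
    [| | exact: perm_eq231 | exact: perm_refl].
    by rewrite /= -h2 -h3 -(hn 7).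
  by rewrite /= -(hn 7) -(hj 2 7).
- apply: (@transforms_hg [:: 1 / 3; 1 / 2; 1 / 7] [:: 1 / 7; 1 / 7; 1 / 7] _ _ _ _ _ _ _ _ _
    (transforms_comp (transforms_degree_8 R) (transforms_cyclic_cubic _)));
    [| | exact: perm_eq213 | exact: perm_refl].
    by rewrite /= -h2 -h3 -(hn 7).
  by rewrite /= -(hn 7).
- apply: (@transforms_hg [:: 1 / 8; 1 / 2; 1 / 3] [:: 1 / 8; 1 / 8; 1 / 3] _ _ _ _ _ _ _ _ _
    (transforms_degree_10_order_8 R)); [| | exact: perm_eq231 | exact: perm_eq312].
    by rewrite /= -h2 -h3 -(hn 8).
  by rewrite /= -h3 -(hn 8).
- have E : 2 * (2 * (1 / 8)) = 1 / 2 :> C by field.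
  have E' : 2 * (1 / 8) = 1 / 4 :> C by field.
  have T1 : transforms (1 / 2) (1 / 3) (1 / 8) (1 / 2) (1 / 8) (2 * (1 / 8)) 3.
    exact: transforms_cubic.
  have T2 : transforms (1 / 2) (1 / 3) (1 / 8) (1 / 8) (1 / 8) (1 / 2) 6.
    exact: transforms_cast E (transforms_comp T1 (transforms_quadratic _ _)).
  have T3 : transforms (1 / 2) (1 / 3) (1 / 8) (1 / 2) (1 / 8) (1 / 8) 6.
    exact: transforms_comp T2 (transforms_swap0oo _ _ _).
  have T4 : transforms (1 / 2) (1 / 3) (1 / 8) (1 / 8) (1 / 8) (1 / 4) 12.
    exact: transforms_cast E' (transforms_comp T3 (transforms_quadratic _ _)).
  apply: (transforms_hg (xs := [:: 1 / 2; 1 / 3; 1 / 8]) (ys := [:: 1 / 8; 1 / 8; 1 / 4]) T4);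
    [| | exact: perm_refl | exact: perm_eq312].
    by rewrite /= -h2 -h3 -(hn 8).
  by rewrite /= -(hn 4) -(hn 8).
- have E : 3 * (1 / 9) = 1 / 3 :> C by field.
  have T1 : transforms (1 / 2) (1 / 3) (1 / 9) (1 / 3) (1 / 9) (1 / 3) 4.
    exact: transforms_cast E (transforms_quartic _).
  have T2 : transforms (1 / 2) (1 / 3) (1 / 9) (1 / 3) (1 / 3) (1 / 9) 4.
    exact: transforms_comp T1 (transforms_swap1oo _ _ _).
  have T3 : transforms (1 / 2) (1 / 3) (1 / 9) (1 / 9) (1 / 9) (1 / 9) 12.
    exact: transforms_comp T2 (transforms_cyclic_cubic _).
  apply: (transforms_hg (xs := [:: 1 / 2; 1 / 3; 1 / 9]) (ys := [:: 1 / 9; 1 / 9; 1 / 9]) T3);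
    [| | exact: perm_refl | exact: perm_refl].
    by rewrite /= -h2 -h3 -(hn 9).
  by rewrite /= -(hn 9).
apply: (@transforms_hg [:: 1 / 4; 1 / 2; 1 / 5] [:: 1 / 4; 1 / 4; 1 / 5] _ _ _ _ _ _ _ _ _
    (transforms_degree_6 R)); [| | exact: perm_eq213 | exact: perm_refl].
  by rewrite /= -h2 -(hn 4) -(hn 5).
by rewrite /= -(hn 4) -(hn 5).
Qed.

End Realisation.
Theorem mainTheorem1 (R : realType) :
  (forall (k l m : nat) (e1 e2 e3 : R) (d : nat),
     (0 < k)%N -> (k <= l)%N -> (l <= m)%N ->
     1 / k%:R + 1 / l%:R + 1 / m%:R < 1 :> R ->
     0 <= e1 -> 0 <= e2 -> 0 <= e3 ->
     (2 <= d)%N ->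
     hg_transformation [:: 1 / k%:R; 1 / l%:R; 1 / m%:R] [:: e1; e2; e3] d ->
     exists (s : seq nat) (t : seq R),
       [/\ hg_table s t d,
           perm_eq s [:: k; l; m] & perm_eq t [:: e1; e2; e3]])
  /\
  (forall (s : seq nat) (t : seq R) (d : nat),
     hg_table s t d ->
     \sum_(e <- inverses R s) e < 1 ->
     hg_transformation (inverses R s) t d).

Proof.
split; first exact: hg_transformation_table.
by move=> s t d table _; exact: table_transformation.
Qed.
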